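(* Let $E$ be an infinite-dimensional Banach space with basis $(e_n)$. Then there is a block sequence $(x_n)$ of $(e_n)$ satisfying one of the following two properties, which are mutually exclusive and both possible (i.e. each occurs for some $E$). (1) $(x_n)$ is tight with constants. (2) $[x_n]$ is locally minimal.
   Context: All Banach spaces are real and infinite-dimensional, and ''subspace'' means infinite-dimensional closed subspace unless said to be finite-dimensional. $[x_n\mid n\in A]$ is the closed linear span, ''basis'' means normalised Schauder basis. $X\sqsubseteq_KY$ means that there is an isomorphic embedding $T$ of $X$ into $Y$ with $\|T\|\cdot\|T^{-1}\|\le K$ (embedding with constant $K$). Blocks: for the normalised basis $(e_n)$, a countable subfield $\mathbf F$ of $\mathbb R$ containing $\mathbb Q$ is fixed such that the norm of every finite $\mathbf F$-linear combination of $(e_n)$ lies in $\mathbf F$. A block is a norm-one finite $\mathbf F$-linear combination of $(e_n)$; a block sequence is an infinite sequence of blocks with successive supports. A basic sequence $(x_n)$ is tight with constants if for every infinite-dimensional Banach space $Y$ there are successive non-empty intervals $I_0<I_1<I_2<\ldots$ of $\mathbb N$ such that $Y\not\sqsubseteq_K[x_n\mid n\notin I_K]$ for every integer constant $K$. A space $X$ is locally minimal if for some constant $K$ and every subspace $Z$ of $X$, every finite-dimensional subspace of $X$ embeds with constant $K$ into $Z$. *)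

(* Defs.v *)
From HB Require Import structures.
From mathcomp Require Import all_boot all_order all_algebra.
From mathcomp Require Import all_classical all_reals all_analysis.
Set Implicit Arguments.
Unset Strict Implicit.
Unset Printing Implicit Defensive.
Import Order.TTheory GRing.Theory Num.Theory.
Import numFieldNormedType.Exports.
Local Open Scope classical_set_scope.
Local Open Scope ring_scope.

Section Subspaces.
Context {R : realType} {E : normedModType R}.
Implicit Types A V : set E.

Definition linear_subspace V : Prop := GRing.submod_closed [in V].

Definition linear_span A : set E := smallest linear_subspace A.

Definition closed_span A : set E := closure (linear_span A).

Definition finite_dimensional V : Prop :=
  exists2 B, finite_set B & V = linear_span B.

(* The convention "subspace = infinite-dimensional closed subspace". *)
Definition subspace V : Prop :=
  [/\ linear_subspace V, closed V & ~ finite_dimensional V].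

End Subspaces.

Section Embeddings.
Context {R : realType}.

Definition linear_on (Y E : normedModType R) (V : set Y) (T : Y -> E) : Prop :=
  forall (a : R) (u v : Y), V u -> V v -> T (a *: u + v) = a *: T u + T v.

(* Norm of the restriction of T to V; it is +oo when T is unbounded on V. *)
Definition op_norm (Y E : normedModType R) (V : set Y) (T : Y -> E) : \bar R :=
  ereal_sup [set (`|T v|)%:E | v in [set v | V v /\ `|v| <= 1]].

(* Only the values of T on V and of S on T(V) matter; there S is the inverse
   of T. Finiteness of the norms is stated separately since 0 * +oo = 0. *)
Definition embeds (Y E : normedModType R) (K : R) (V : set Y) (W : set E) :
    Prop :=
  exists (T : Y -> E) (S : E -> Y),
    [/\ linear_on V T, T @` V `<=` W & forall v, V v -> S (T v) = v] /\
    [/\ (op_norm V T < +oo)%E, (op_norm (T @` V) S < +oo)%E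
      & (op_norm V T * op_norm (T @` V) S <= K%:E)%E].

End Embeddings.

Section Sequences.
Context {R : realType} {E : completeNormedModType R}.
Implicit Types (e x : nat -> E) (F : {pred R}).

Definition normalised_basis e : Prop :=
  (forall n, `|e n| = 1) /\
  forall v : E, exists! a : nat -> R,
    series (fun k => a k *: e k) @ \oo --> v.

Definition block_scalars e F : Prop :=
  [/\ GRing.divring_closed F, countable [set` F],
      forall q : rat, ratr q \in F
    & forall (n : nat) (a : nat -> R), (forall i, a i \in F) ->
        `|\sum_(i < n) a i *: e i| \in F].

(* x is the block with coefficients a in the basis e. *)
Definition is_block e F (a : nat -> R) (x : E) : Prop :=
  [/\ forall i, a i \in F, `|x| = 1
    & exists2 n, forall i, (n <= i)%N -> a i = 0
               & x = \sum_(i < n) a i *: e i].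

Definition block_sequence e F x : Prop :=
  exists a : nat -> nat -> R,
    (forall n, is_block e F (a n) (x n)) /\
    forall n i j, a n i != 0 -> a n.+1 j != 0 -> (i < j)%N.

(* The intervals are I_k = {l k, ..., r k}. *)
Definition tight_with_constants x : Prop :=
  forall Y : completeNormedModType R, ~ finite_dimensional [set: Y] ->
  exists l r : nat -> nat,
    (forall k, (l k <= r k)%N /\ (r k < l k.+1)%N) /\
    forall K : nat,
      ~ embeds K%:R [set: Y]
          (closed_span (x @` [set n | ~~ (l K <= n <= r K)%N])).

Definition locally_minimal (X : set E) : Prop :=
  exists K : R, forall Z G : set E,
    subspace Z -> Z `<=` X ->
    linear_subspace G -> finite_dimensional G -> G `<=` X ->
    embeds K G Z.

End Sequences.

(* Main.v *)
(* Write "Y embeds in the tails of x" when, for some K, Y embeds with constant K in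
   every [x_n | n >= m].  Moving the first l vectors of a basic sequence past a gap
   costs a constant depending only on l, so x fails to be tight with constants exactly
   when some infinite-dimensional Y embeds in its tails.

   Dichotomy.  There are countably many pairs (K, finite list of blocks), so a diagonal
   argument gives a block sequence x such that, for each pair, either the list has no
   K-equivalent copy in some tail of x, or it has one in the span of every block sequence
   of some tail of x.  If Y embeds in the tails of x, take blocks y_n close to vectors of
   an image of Y: finite lists of y_n have copies in all tails of x, hence in every
   subspace of [y_n], after a small perturbation.

   Exclusion.  If [x_n] is locally minimal, pick n_0 < n_1 < ... so fast that
   x_{n_0}, ..., x_{n_{m-1}} has a uniform copy in the span of the x_j with
   m <= j < n_m; then [x_{n_i}] embeds in the tails of x.

   Examples.  Block sequences of l_1 span isometric copies of l_1, so they are not tight.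
   In the 2-convexification of the modified Tsirelson space, N vectors supported after N
   satisfy, for a suitable choice of signs, a lower 2-estimate.  A space embedding in the
   tails of its basis would thus give blocks w_i dominating the basis of l_2, so the
   squares w_i^2 would dominate the basis of l_1 in the modified Tsirelson space.  There,
   however, averages (w_0 + (w_1 + ... + w_r) / r) / 2 of sparse successive vectors shrink
   the norm by a fixed factor, and iterating this gives a contradiction. *)

From HB Require Import structures.
Require Import Defs.
From mathcomp Require Import all_boot all_order all_algebra.
From mathcomp Require Import all_classical all_reals all_analysis.
From mathcomp Require Import ring lra.
Set Implicit Arguments.
Unset Strict Implicit.
Unset Printing Implicit Defensive.
Import Order.TTheory GRing.Theory Num.Theory.
Import numFieldNormedType.Exports.
Local Open Scope classical_set_scope.
Local Open Scope ring_scope.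

(** * Linear spans *)

Section Spans.
Context {R : realType} {E : normedModType R}.
Implicit Types (A V W : set E) (x y : nat -> E) (a : nat -> R).

(** Tightness quantifies over Banach spaces [Y], while subspaces of [E] are mere sets. A space
    refuting tightness is therefore built from coefficient sequences: a compatible family of norms
    on the spaces R^n is completed to a Banach space with a normalised basis. The same construction
    yields l_1 and the Tsirelson-type example.

    A basis is given by unique expansions only, so the uniform bound on partial sums, on which all
    estimates rest, has to be extracted by a Baire category argument.

    The copies of w_0, ..., w_{N-1} found in a tail may have overlapping supports. This dictates the
    second example: its squared norm is a supremum of quadratic forms, so signs chosen one at a time
    make every cross term nonnegative, whatever the supports, and these signs do not affect norms of
    combinations of the blocks w_i themselves, whose supports are disjoint. What remains, about the
    squares, concerns nonnegative vectors only. *)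

Definition lcomb a x (n : nat) : E := \sum_(i < n) a i *: x i.

Lemma subspaceP V : linear_subspace V <->
  V 0 /\ forall (a : R) u v, V u -> V v -> V (a *: u + v).
Proof.
rewrite /linear_subspace; split=> -[V0 Vl]; split.
- by have := V0; rewrite inE.
- by move=> a u v Vu Vv; have := Vl a u v; rewrite !inE; apply.
- by rewrite inE.
- by move=> a u v; rewrite !inE; exact: Vl.
Qed.

Lemma subspace0 V : linear_subspace V -> V 0.
Proof. by case/subspaceP. Qed.

Lemma subspaceZD V (a : R) u v :
  linear_subspace V -> V u -> V v -> V (a *: u + v).
Proof. by case/subspaceP => _; apply. Qed.

Lemma subspaceZ V (a : R) u : linear_subspace V -> V u -> V (a *: u).
Proof.
by move=> lV Vu; rewrite -[_ *: _]addr0; apply: subspaceZD (subspace0 lV).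
Qed.

Lemma subspaceD V u v : linear_subspace V -> V u -> V v -> V (u + v).
Proof. by move=> lV Vu Vv; rewrite -[u]scale1r; exact: subspaceZD. Qed.

Lemma subspaceB V u v : linear_subspace V -> V u -> V v -> V (u - v).
Proof.
by move=> lV Vu Vv; rewrite addrC -scaleN1r; exact: subspaceZD.
Qed.

Lemma subspace_lcomb V a x n : linear_subspace V ->
  (forall i, (i < n)%N -> V (x i)) -> V (lcomb a x n).
Proof.
move=> lV Vx; apply: (big_ind V); first exact: subspace0.
  by move=> u v; exact: subspaceD.
by move=> i _; apply: subspaceZ => //; exact: Vx.
Qed.

Lemma lcombD a b x n : lcomb (fun i => a i + b i) x n = lcomb a x n + lcomb b x n.
Proof. by rewrite -big_split; apply: eq_bigr => i _; rewrite scalerDl. Qed.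

Lemma lcombZ (c : R) a x n : lcomb (fun i => c * a i) x n = c *: lcomb a x n.
Proof. by rewrite /lcomb scaler_sumr; apply: eq_bigr => i _; rewrite scalerA. Qed.

Lemma lcombB a b x n : lcomb (fun i => a i - b i) x n = lcomb a x n - lcomb b x n.
Proof. by rewrite -sumrB; apply: eq_bigr => i _; rewrite scalerBl. Qed.

Lemma eq_lcomb a b x n : (forall i, (i < n)%N -> a i = b i) ->
  lcomb a x n = lcomb b x n.
Proof. by move=> ab; apply: eq_bigr => i _; rewrite ab. Qed.

Lemma eq_lcombr a x y n : (forall i, (i < n)%N -> x i = y i) ->
  lcomb a x n = lcomb a y n.
Proof. by move=> ab; apply: eq_bigr => i _; rewrite ab. Qed.

Lemma lcomb0 x n : lcomb (fun=> 0) x n = 0.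
Proof. by apply: big1 => i _; rewrite scale0r. Qed.

Lemma lcombS a x n : lcomb a x n.+1 = lcomb a x n + a n *: x n.
Proof. by rewrite /lcomb big_ord_recr. Qed.

Lemma lcomb_trunc a x m n : (m <= n)%N ->
  lcomb (fun i => if (i < m)%N then a i else 0) x n = lcomb a x m.
Proof.
move=> mn; rewrite /lcomb (big_ord_widen _ (fun i => a i *: x i) mn).
rewrite [RHS]big_mkcond /=; apply: eq_bigr => i _.
by case: ifP => // _; rewrite scale0r.
Qed.

Lemma lcomb_widen a x m n : (m <= n)%N ->
  (forall i, (m <= i)%N -> a i = 0) -> lcomb a x m = lcomb a x n.
Proof.
move=> mn a0; rewrite -(lcomb_trunc a x mn); apply: eq_lcomb => i _.
by case: ltnP => // /a0.
Qed.

Lemma lcomb_delta x i n : (i < n)%N -> lcomb (fun j => (j == i)%:R) x n = x i.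
Proof.
move=> i_n; rewrite /lcomb (bigD1 (Ordinal i_n)) //= eqxx scale1r big1 ?addr0 //.
by move=> j; rewrite -val_eqE /= => /negPf ->; rewrite scale0r.
Qed.

Lemma lcomb_shift a x k n : (forall i, (i < k)%N -> a i = 0) ->
  lcomb a x (k + n) = lcomb (fun i => a (k + i)%N) (fun i => x (k + i)%N) n.
Proof.
move=> a0; rewrite /lcomb big_split_ord /= big1 ?add0r // => i _.
by rewrite a0 ?scale0r.
Qed.

Lemma linear_span_subspace A : linear_subspace (linear_span A).
Proof.
apply/subspaceP; split=> [V [lV _]|a u v Au Av V [lV AV]]; first exact: subspace0.
by apply: subspaceZD => //; [exact: Au|exact: Av].
Qed.

Lemma linear_span_sub A V : linear_subspace V -> A `<=` V -> linear_span A `<=` V.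
Proof. by move=> lV AV; apply: smallest_sub. Qed.

Lemma sub_linear_span A : A `<=` linear_span A.
Proof. exact: sub_gen_smallest. Qed.

Lemma linear_spanS A B : A `<=` B -> linear_span A `<=` linear_span B.
Proof.
move=> AB; apply: linear_span_sub; first exact: linear_span_subspace.
exact: subset_trans AB (@sub_linear_span B).
Qed.

Lemma linear_span_imageP x (D : set nat) v : linear_span (x @` D) v <->
  exists n a, (forall i, ~ D i -> a i = 0) /\ v = lcomb a x n.
Proof.
split; last first.
  move=> [n [a [aD ->]]]; apply: (big_ind (linear_span (x @` D))).
  - exact: subspace0 (linear_span_subspace _).
  - by move=> u w; exact: subspaceD (linear_span_subspace _).
  - move=> i _; have [Di|/aD ->] := pselect (D i).
      apply: (subspaceZ _ (linear_span_subspace _)).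
      by apply: sub_linear_span; exists i.
    by rewrite scale0r; exact: subspace0 (linear_span_subspace _).
move: v; apply: linear_span_sub.
  apply/subspaceP; split; first by exists 0%N, (fun=> 0); rewrite lcomb0.
  move=> c u v [m [a [aD ->]]] [n [b [bD ->]]].
  (* Coefficients beyond the length of a combination are arbitrary, so both are cut off before being
     added over the common length [m + n]. *)
  exists (m + n)%N, (fun i => c * (if (i < m)%N then a i else 0)
                         + (if (i < n)%N then b i else 0)).
  split=> [i Di|]; last by rewrite lcombD lcombZ !lcomb_trunc ?leq_addl ?leq_addr.
  by rewrite aD // bD // !if_same mulr0 addr0.
move=> _ [i Di <-]; exists i.+1, (fun j => (j == i)%:R).
by split=> [j Dj|]; [case: eqP => // ji; case: Dj; rewrite ji|rewrite lcomb_delta].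
Qed.

Lemma linear_span_rangeP x v : linear_span (range x) v <->
  exists n a, v = lcomb a x n.
Proof.
rewrite linear_span_imageP; split=> [[n [a [_ ->]]]|[n [a ->]]]; first by exists n, a.
by exists n, a; split=> // i; case.
Qed.

Lemma linear_span_firstP x n v : linear_span (x @` [set i | (i < n)%N]) v <->
  exists a, v = lcomb a x n.
Proof.
rewrite linear_span_imageP; split=> [[m [a [aD ->]]]|[a ->]].
  exists (fun i => if (i < m)%N then a i else 0).
  have [mn|nm] := leqP m n; first by rewrite lcomb_trunc.
  rewrite -(@lcomb_widen a x n m) ?(ltnW nm) // => [|i ni]; last first.
    by apply: aD; rewrite /= ltnNge ni.
  by apply: eq_lcomb => i i_n; rewrite (ltn_trans i_n nm).
exists n, (fun i => if (i < n)%N then a i else 0); split=> [i /= /negP/negPf -> //|].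
by rewrite lcomb_trunc.
Qed.

Lemma linear_span_finite_support x (D : set nat) (u : nat -> E) n :
  (forall i, (i < n)%N -> linear_span (x @` D) (u i)) ->
  exists M, forall i, (i < n)%N ->
    linear_span (x @` [set j | D j /\ (j < M)%N]) (u i).
Proof.
elim: n => [_|n IHn uD]; first by exists 0%N.
have [M hM] := IHn (fun i i_n => uD i (ltnW i_n)).
have [N [a [aD un]]] := (linear_span_imageP x D (u n)).1 (uD n (ltnSn n)).
exists (maxn M N) => i; rewrite ltnS leq_eqVlt => /orP[/eqP ->|i_n]; last first.
  apply: linear_spanS (hM i i_n) => _ [j [Dj jM] <-]; exists j => //=.
  by rewrite leq_max jM.
apply/linear_span_imageP; exists N, (fun i => if (i < N)%N then a i else 0).
rewrite lcomb_trunc //; split=> // j /not_andP [Dj|/negP jMN].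
  by rewrite aD ?if_same.
by rewrite ltnNge; move: jMN; rewrite -leqNgt geq_max => /andP[_ ->].
Qed.

Lemma closure_normP A v :
  closure A v <-> forall eps : R, 0 < eps -> exists2 w, A w & `|v - w| < eps.
Proof.
split=> [Av eps eps0|Av B].
  have [w [Aw]] := Av _ (nbhsx_ballx v _ eps0).
  by rewrite -ball_normE /= => wv; exists w.
move=> /nbhs_ballP [eps /= eps0 Beps]; have [w Aw vw] := Av _ eps0.
by exists w; split=> //; apply: Beps; rewrite -ball_normE.
Qed.

Lemma closed_spanP A v : closed_span A v <->
  forall eps : R, 0 < eps -> exists2 w, linear_span A w & `|v - w| < eps.
Proof. exact: closure_normP. Qed.

Lemma sub_closed_span A : linear_span A `<=` closed_span A.
Proof. exact: subset_closure. Qed.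

Lemma closed_spanS A B : A `<=` B -> closed_span A `<=` closed_span B.
Proof. by move=> AB; apply: closureS; exact: linear_spanS. Qed.

Lemma closed_closed_span A : closed (closed_span A).
Proof. exact: closed_closure. Qed.

Lemma closed_span_subspace A : linear_subspace (closed_span A).
Proof.
have lA := linear_span_subspace A.
apply/subspaceP; split=> [|a u v /closed_spanP Au /closed_spanP Av].
  by apply: sub_closed_span; exact: subspace0 lA.
apply/closed_spanP => eps eps0.
have a0 : 0 < 1 + `|a| by rewrite ltr_pwDl.
have [u' Au' uu'] := Au _ (divr_gt0 eps0 (mulr_gt0 (ltr0n _ 2) a0)).
have [v' Av' vv'] := Av _ (divr_gt0 eps0 (ltr0n _ 2)).
exists (a *: u' + v'); first exact: (subspaceZD _ lA).
rewrite opprD addrACA -scalerBr (le_lt_trans (ler_normD _ _)) // normrZ.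
have h : `|a| * `|u - u'| <= eps / 2.
  apply: (@le_trans _ _ ((1 + `|a|) * (eps / (2 * (1 + `|a|))))).
    by apply: ler_pM => //; [rewrite ler_wpDl|exact: ltW].
  by rewrite le_eqVlt; apply/orP; left; apply/eqP; field; rewrite gt_eqF.
by rewrite (splitr eps) ler_ltD.
Qed.

Lemma closed_span_sub A V : linear_subspace V -> closed V -> A `<=` V ->
  closed_span A `<=` V.
Proof.
move=> lV cV AV; rewrite /closed_span closureE.
by apply: smallest_sub => //; exact: linear_span_sub.
Qed.

End Spans.

(** * Finite-dimensional subspaces *)

Section FiniteDimension.
Context {R : realType} {E : normedModType R}.
Implicit Types (A V W : set E) (x y g : nat -> E) (a : nat -> R).

Lemma finite_dimensionalP V : finite_dimensional V ->
  exists n g, V = linear_span (g @` [set i | (i < n)%N]).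
Proof.
move=> [B /finite_seqP [s ->] ->]; exists (size s), (nth 0 s); congr linear_span.
apply/seteqP; split=> [v /= /(nthP 0) [i ilt <-]|_ /= [i ilt <-]]; first by exists i.
exact: mem_nth.
Qed.

Lemma finite_dimensional_span n g :
  finite_dimensional (linear_span (g @` [set i | (i < n)%N])).
Proof.
exists (g @` [set i | (i < n)%N]) => //; apply: finite_image; exact: finite_II.
Qed.

(** Induction on the number of generators: one with a nonzero coefficient in a relation lies in the
    span of the others and is discarded. *)
Lemma finite_dimensional_free V : finite_dimensional V -> exists n g,
  V = linear_span (g @` [set i | (i < n)%N]) /\
  forall a, lcomb a g n = 0 -> forall i, (i < n)%N -> a i = 0.
Proof.
move=> /finite_dimensionalP [n]; elim: n V => [|n IHn] V [g Vg].
  by exists 0%N, g; split.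
have [[a [a0 [i i_n ai]]]|free] := pselect (exists a, lcomb a g n.+1 = 0 /\
    exists2 i, (i < n.+1)%N & a i != 0); last first.
  exists n.+1, g; split=> // a a0 i i_n; apply: contrapT => /eqP ai.
  by apply: free; exists a; split=> //; exists i.
(* The slot [i] of the redundant generator is reused for the last one, so that the remaining
   generators again occupy the indices below [n]. *)
pose g' j := if j == i then g n else g j.
apply: IHn; exists g'; rewrite Vg.
have lS := linear_span_subspace (g' @` [set i | (i < n)%N]).
have g'S j : (j < n.+1)%N -> j != i -> linear_span (g' @` [set i | (i < n)%N]) (g j).
  move=> jn ji; apply: sub_linear_span; have [jltn|] := ltnP j n.
    by exists j => //; rewrite /g' (negPf ji).
  move=> nj; have {nj jn} jn : j = n by apply/eqP; rewrite eqn_leq -ltnS jn.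
  exists i; last by rewrite /g' eqxx jn.
  by rewrite /= ltn_neqAle -ltnS i_n -jn eq_sym ji.
have lS' := linear_span_subspace (g @` [set i | (i < n.+1)%N]).
apply/seteqP; split; apply: linear_span_sub => //.
- move=> _ [j /= jn <-]; have [->|ji] := eqVneq j i; last exact: g'S.
  have -> : g i = lcomb (fun k => if k == i then 0 else - a k / a i) g n.+1.
    move: a0; rewrite /lcomb (bigD1 (Ordinal i_n)) //= => a0.
    rewrite [RHS](bigD1 (Ordinal i_n)) //= eqxx scale0r add0r; move: a0.
    move=> /(congr1 (fun v => (a i)^-1 *: v)); rewrite scaler0 scalerDr scalerA.
    rewrite mulVf // scale1r => /eqP; rewrite addr_eq0 => /eqP ->.
    rewrite scaler_sumr -sumrN; apply: eq_bigr => k ki.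
    by rewrite -[_ == i]/(k == Ordinal i_n) (negPf ki) scalerA -scaleNr mulNr mulrC.
  apply: (big_ind (linear_span (g' @` [set i | (i < n)%N]))).
  + exact: subspace0 lS.
  + by move=> u v; exact: subspaceD lS.
  + move=> k _; case: eqP => [_|/eqP ki]; first by rewrite scale0r; exact: subspace0 lS.
    by apply: (subspaceZ _ lS); exact: g'S.
- move=> _ [j /= jn <-]; apply: sub_linear_span; rewrite /g'; case: eqP => _.
    by exists n => /=.
  by exists j => //=; rewrite (ltn_trans jn).
Qed.

(** Compactness of the unit sphere of R^n: the norm of the combination is continuous there and, by
    freeness, has a positive minimum; [c] is its inverse. *)
Lemma free_coef_bound n g :
  (forall a, lcomb a g n = 0 -> forall i, (i < n)%N -> a i = 0) ->
  exists2 c : R, 0 < c & forall a i, (i < n)%N -> `|a i| <= c * `|lcomb a g n|.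
Proof.
case: n => [|n] free; first by exists 1.
pose f (v : 'rV[R]_n.+1) : R := `|\sum_i v ord0 i *: g i|.
pose S : set 'rV[R]_n.+1 := [set v | `|v| = 1].
have sc (s : seq 'I_n.+1) :
    continuous (fun v : 'rV[R]_n.+1 => \sum_(i <- s) v ord0 i *: g i).
  elim: s => [|i s IHs] v.
    rewrite (_ : (fun=> _) = cst 0); first exact: cst_continuous.
    by apply/funext => w; rewrite big_nil.
  rewrite (_ : (fun=> _) = fun w : 'rV[R]_n.+1 =>
    w ord0 i *: g i + \sum_(j <- s) w ord0 j *: g j); last first.
    by apply/funext => w; rewrite big_cons.
  have h : (fun w : 'rV[R]_n.+1 => w ord0 i *: g i) @ v --> v ord0 i *: g i.
    have h := @coord_continuous R 1 n.+1 ord0 i v.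
    by apply: cvgZr_tmp; [exact: nbhs_filter|exact: h].
  exact: cvgD h (IHs v).
have fc : continuous f.
  move=> v; exact: (cvg_norm (sc (index_enum 'I_n.+1) v)).
have cS : closed S.
  have -> : S = Num.norm @^-1` [set 1] by [].
  apply: closed_comp; first by move=> ? _; exact: norm_continuous.
  exact: closed_eq.
have bS : bounded_set S.
  exists 1; split; first exact: num_real.
  by move=> M M1 v vS; rewrite /= (vS : `|v| = 1) ltW.
have S0 : S !=set0.
  pose w : 'rV[R]_n.+1 := const_mx 1.
  have w0 : w != 0.
    by apply/eqP => /rowP/(_ ord0); rewrite !mxE => /eqP; rewrite oner_eq0.
  by exists (`|w|^-1 *: w); rewrite /S /= normrZ normfV normr_id mulVf ?normr_eq0.
have [v] := EVT_min_rV S0 (bounded_closed_compact bS cS) (continuous_subspaceT fc).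
rewrite inE => Sv fmin.
have fv : 0 < f v.
  rewrite /f normr_gt0; apply: contra_eq_neq (Sv : `|v| = 1) => /eqP fv0.
  suff -> : v = 0 by rewrite normr0 eq_sym oner_eq0.
  apply/rowP => i; rewrite mxE.
  have := free (fun k => v ord0 (inord k)) _ i (ltn_ord i); rewrite inord_val; apply.
  by rewrite /lcomb; under eq_bigr do rewrite inord_val; exact/eqP.
exists (f v)^-1; rewrite ?invr_gt0 // => a i i_n.
pose w : 'rV[R]_n.+1 := \row_j a j.
have ai : `|a i| <= `|w|.
  have -> : a i = w ord0 (Ordinal i_n) by rewrite mxE.
  by rewrite {2}/Num.norm/= mx_normrE (le_trans _ (le_bigmax _ _ (ord0, Ordinal i_n))).
have [w0|w0] := eqVneq w 0.
  by rewrite (le_trans ai) // w0 normr0 mulr_ge0 // invr_ge0 ltW.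
have {}w0 : 0 < `|w| by rewrite normr_gt0.
rewrite (le_trans ai) // mulrC ler_pdivlMr // mulrC -ler_pdivlMr //.
have /fmin : `|w|^-1 *: w \in S by rewrite inE /S /= normrZ normfV normr_id mulVf ?gt_eqF.
move/le_trans; apply; rewrite /f le_eqVlt; apply/orP; left; apply/eqP.
under eq_bigr do rewrite !mxE -scalerA.
by rewrite -scaler_sumr normrZ normfV normr_id mulrC.
Qed.

(** In a span of [n] vectors, the first [n.+1] of the [v i] satisfy a nontrivial relation, read off
    from the kernel of a matrix with more rows than columns; applying [c j] to it isolates the
    [j]-th coefficient. *)
Lemma not_fd_biorthogonal V (v : nat -> E) (c : nat -> E -> R) :
  linear_subspace V -> (forall i, V (v i)) ->
  (forall i (r : R) u w, V u -> V w -> c i (r *: u + w) = r * c i u + c i w) ->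
  (forall i j, c i (v j) = (i == j)%:R) -> ~ finite_dimensional V.
Proof.
move=> lV Vv clin cv /finite_dimensionalP [n [g Vg]].
have /choice [M Mv] : forall i, exists a, v i = lcomb a g n.
  by move=> i; apply/linear_span_firstP; rewrite -Vg.
pose A := \matrix_(i < n.+1, j < n) M i j.
have : kermx A != 0.
  by rewrite -mxrank_eq0 mxrank_ker subn_eq0 -ltnNge (leq_ltn_trans (rank_leq_col _)).
case/rowV0Pn => r /sub_kermxP rA r0.
have c0 i : c i 0 = 0.
  have := clin i 1 0 0 (subspace0 lV) (subspace0 lV).
  by rewrite scaler0 addr0 mul1r => /eqP; rewrite eq_sym -subr_eq0 addrK => /eqP.
have rv : \sum_(i < n.+1) r ord0 i *: v i = 0.
  under eq_bigr do rewrite Mv /lcomb scaler_sumr.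
  rewrite exchange_big big1 //= => j _.
  have := congr1 (fun B : 'rV_n => B ord0 j) rA; rewrite !mxE => rA0.
  under eq_bigr do rewrite scalerA.
  rewrite -scaler_suml; move: rA0; under eq_bigr do rewrite mxE.
  by move=> ->; rewrite scale0r.
case/eqP: r0; apply/rowP => j; rewrite mxE.
have {rv} := congr1 (c j) rv; rewrite c0 => <-.
have csum : forall s : seq 'I_n.+1, V (\sum_(i <- s) r ord0 i *: v i) /\
    c j (\sum_(i <- s) r ord0 i *: v i) = \sum_(i <- s) r ord0 i * c j (v i).
  elim=> [|i s [IH1 IH2]]; first by rewrite !big_nil c0; split=> //; exact: subspace0.
  by rewrite !big_cons clin // IH2; split=> //; exact: subspaceZD.
rewrite (csum _).2 (bigD1 j) //= cv eqxx mulr1 big1 ?addr0 // => i ij.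
by rewrite cv eq_sym val_eqE (negPf ij) mulr0.
Qed.

Lemma not_fd_kernel V (phi : E -> R) : linear_subspace V ->
  (forall (r : R) u w, V u -> V w -> phi (r *: u + w) = r * phi u + phi w) ->
  ~ finite_dimensional V ->
  linear_subspace [set v | V v /\ phi v = 0] /\
  ~ finite_dimensional [set v | V v /\ phi v = 0].
Proof.
move=> lV plin nV.
have p0 : phi 0 = 0.
  have := plin 1 0 0 (subspace0 lV) (subspace0 lV).
  by rewrite scaler0 addr0 mul1r => /eqP; rewrite eq_sym -subr_eq0 addrK => /eqP.
split.
  apply/subspaceP; split; first by split=> //; exact: subspace0.
  move=> a u w [Vu pu] [Vw pw]; split; first exact: subspaceZD.
  by rewrite plin // pu pw mulr0 addr0.
have [[z Vz pz]|pV] := pselect (exists2 z, V z & phi z != 0); last first.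
  suff -> : [set v | V v /\ phi v = 0] = V by [].
  apply/seteqP; split=> [v []//|v Vv]; split=> //.
  by apply: contrapT => /eqP pv; apply: pV; exists v.
move=> [B Bfin kB]; apply: nV; exists (B `|` [set z]).
  by rewrite finite_setU; split=> //; exact: finite_set1.
have BV : linear_span B `<=` V by rewrite -kB => v [].
have lS := linear_span_subspace (B `|` [set z]).
apply/seteqP; split=> [v Vv|]; last first.
  apply: linear_span_sub => // v [Bv|->//]; apply: BV; exact: sub_linear_span.
have -> : v = (phi v / phi z) *: z + ((- (phi v / phi z)) *: z + v).
  by rewrite addrA -scalerDl subrr scale0r add0r.
apply: (subspaceZD _ lS); first by apply: sub_linear_span; right.
apply: (@linear_spanS _ _ B); first by left.
rewrite -kB; split; first exact: subspaceZD.
by rewrite plin // mulNr divfK // addNr.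
Qed.

(** Each functional cuts the space down to a kernel that is still infinite-dimensional. With
    coordinate functionals for [phi], this provides vectors of a subspace that live past [k]. *)
Lemma exists_common_zero V (phi : nat -> E -> R) k : linear_subspace V ->
  (forall i (r : R) u w, V u -> V w -> phi i (r *: u + w) = r * phi i u + phi i w) ->
  ~ finite_dimensional V ->
  exists2 v, V v & v != 0 /\ forall i, (i < k)%N -> phi i v = 0.
Proof.
elim: k V => [|k IHk] V lV plin nV.
  have [[v Vv v0]|V0] := pselect (exists2 v, V v & v != 0); first by exists v.
  case: nV; exists set0; first exact: finite_set0.
  apply/seteqP; split=> v; last by apply: linear_span_sub => // ? [].
  move=> Vv; have -> : v = 0 by apply: contrapT => /eqP v0; apply: V0; exists v.
  exact: subspace0 (linear_span_subspace _).
have [lV' nV'] := not_fd_kernel lV (plin k) nV.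
have [|v [Vv pk] [v0 pv]] := IHk _ lV' _ nV'.
  by move=> i a u w [Vu _] [Vw _]; exact: plin.
exists v => //; split=> // i; rewrite ltnS leq_eqVlt => /orP[/eqP -> //|]; exact: pv.
Qed.

End FiniteDimension.

(** * Embeddings and equivalent finite sequences *)

Section LinearOn.
Context {R : realType} {Y E : normedModType R}.
Variables (V : set Y) (T : Y -> E).
Hypotheses (lV : linear_subspace V) (lT : linear_on V T).

Lemma linear_on0 : T 0 = 0.
Proof.
have := lT 1 (subspace0 lV) (subspace0 lV).
by rewrite scaler0 addr0 scale1r => /eqP; rewrite eq_sym -subr_eq0 addrK => /eqP.
Qed.

Lemma linear_onZ (r : R) v : V v -> T (r *: v) = r *: T v.
Proof.
by move=> Vv; rewrite -[r *: v]addr0 lT // ?linear_on0 ?addr0 //; exact: subspace0.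
Qed.

Lemma linear_onB u v : V u -> V v -> T (u - v) = T u - T v.
Proof.
by move=> Vu Vv; rewrite addrC -scaleN1r lT // scaleN1r addrC.
Qed.

Lemma linear_on_lcomb a y n : (forall i, (i < n)%N -> V (y i)) ->
  T (lcomb a y n) = lcomb a (T \o y) n.
Proof.
elim: n => [|n IHn] Vy; first by rewrite /lcomb !big_ord0 linear_on0.
have Vn i : (i < n)%N -> V (y i) by move=> i_n; apply: Vy; exact: ltnW.
rewrite !lcombS addrC lT; [|exact: Vy|exact: subspace_lcomb].
by rewrite IHn // addrC.
Qed.

Lemma linear_on_image : linear_subspace (T @` V).
Proof.
apply/subspaceP; split; first by exists 0; [exact: subspace0|exact: linear_on0].
move=> r _ _ [u Vu <-] [v Vv <-]; exists (r *: u + v); first exact: subspaceZD.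
exact: lT.
Qed.

Lemma op_norm_ltyP : (op_norm V T < +oo)%E -> exists2 A : R,
  op_norm V T = A%:E & 0 <= A /\ forall v, V v -> `|T v| <= A * `|v|.
Proof.
move=> Tfin.
have T0 : (0 <= op_norm V T)%E.
  apply: le_ereal_sup_tmp; exists (`|T 0|)%:E.
    by exists 0 => //=; split; [exact: subspace0|rewrite normr0].
  by rewrite lee_fin.
case TA: (op_norm V T) Tfin T0 => [A||] // _ A0.
exists A => //; split=> [|v Vv]; first by rewrite -lee_fin.
have [->|v0] := eqVneq v 0; first by rewrite linear_on0 !normr0 mulr0.
have {}v0 : 0 < `|v| by rewrite normr_gt0.
rewrite -ler_pdivrMr //.
have -> : `|T v| / `|v| = `|T (`|v|^-1 *: v)|.
  by rewrite linear_onZ // normrZ normfV normr_id mulrC.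
rewrite -lee_fin -TA; apply: le_ereal_sup_tmp.
exists (`|T (`|v|^-1 *: v)|)%:E => //.
exists (`|v|^-1 *: v) => //.
split; first exact: subspaceZ.
by rewrite normrZ normfV normr_id mulVf // gt_eqF.
Qed.

Lemma op_norm_le (A : R) : 0 <= A -> (forall v, V v -> `|T v| <= A * `|v|) ->
  (op_norm V T <= A%:E)%E.
Proof.
move=> A0 TA; apply: ge_ereal_sup => _ [v [Vv v1] <-].
by rewrite lee_fin (le_trans (TA _ Vv)) // ler_piMr.
Qed.

End LinearOn.

Section Kembeds.
Context {R : realType}.
Implicit Types (Y E : normedModType R).

(** A symmetric substitute for [embeds], free of extended reals: a single constant bounds the map
    and its inverse. Passing from [embeds] gives [max 1 K], passing back squares the constant. *)
Definition kembeds Y E (K : R) (V : set Y) (W : set E) : Prop :=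
  exists T : Y -> E, [/\ linear_on V T, forall v, V v -> W (T v)
    & forall v, V v -> `|v| <= K * `|T v| /\ `|T v| <= K * `|v|].

Lemma embeds_kembeds Y E (K : R) (V : set Y) (W : set E) :
  linear_subspace V -> linear_subspace W -> embeds K V W ->
  kembeds (Num.max 1 K) V W.
Proof.
move=> lV lW [T [S [[lT TW ST] [Tfin Sfin TSK]]]].
have lTV := linear_on_image lV lT.
have lS : linear_on (T @` V) S.
  move=> r _ _ [u Vu <-] [v Vv <-]; rewrite -lT // !ST //.
  exact: subspaceZD.
have [A TA [A0 TvA]] := op_norm_ltyP lV lT Tfin.
have [B SB [B0 SvB]] := op_norm_ltyP lTV lS Sfin.
move: TSK; rewrite TA SB -EFinM lee_fin => ABK.
have ABv v : V v -> `|v| <= B * `|T v|.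
  by move=> Vv; rewrite -{1}(ST v Vv); apply: SvB; exists v.
(* Scaling by the norm [B] of the inverse turns the constant of the lower bound into [1] and that of
   the upper bound into [A * B <= K]. *)
exists (fun v => B *: T v); split.
- by move=> r u v Vu Vv; rewrite lT // scalerDr !scalerA mulrC.
- by move=> v Vv; apply: subspaceZ => //; apply: TW; exists v.
- move=> v Vv; rewrite normrZ ger0_norm //; split.
    rewrite (le_trans (ABv _ Vv)) // ler_peMl ?mulr_ge0 //.
    by rewrite le_max lexx.
  rewrite (@le_trans _ _ (B * (A * `|v|))) // ?ler_wpM2l ?TvA //.
  by rewrite mulrA ler_wpM2r // mulrC le_max ABK orbT.
Qed.

Lemma kembeds_embeds Y E (K L : R) (V : set Y) (W : set E) :
  linear_subspace V -> 0 <= K -> K * K <= L -> kembeds K V W -> embeds L V W.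
Proof.
move=> lV K0 KL [T [lT TW TK]].
have Tinj u v : V u -> V v -> T u = T v -> u = v.
  move=> Vu Vv Tuv; apply/eqP; rewrite -subr_eq0 -normr_le0.
  have [+ _] := TK _ (subspaceB lV Vu Vv).
  by rewrite (linear_onB lT) // Tuv subrr normr0 mulr0.
pose S w := xget 0 [set v | V v /\ T v = w].
have ST v : V v -> S (T v) = v.
  move=> Vv; rewrite /S; case: xgetP => [u _ [Vu Tu]|/(_ v)]; first exact: Tinj.
  by case.
have lTV := linear_on_image lV lT.
have lS : linear_on (T @` V) S.
  move=> r _ _ [u Vu <-] [v Vv <-]; rewrite -lT // !ST //.
  exact: subspaceZD.
exists T, S.
have TA : (op_norm V T <= K%:E)%E by apply: op_norm_le => // v /TK [].
have SB : (op_norm (T @` V) S <= K%:E)%E.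
  by apply: op_norm_le => // _ [v Vv <-]; rewrite ST //; case: (TK v Vv).
split; split=> //.
- by move=> _ [v Vv <-]; exact: TW.
- exact: le_lt_trans TA (ltry _).
- exact: le_lt_trans SB (ltry _).
have [A TA' [A0 _]] := op_norm_ltyP lV lT (le_lt_trans TA (ltry _)).
have [B SB' [B0 _]] := op_norm_ltyP lTV lS (le_lt_trans SB (ltry _)).
move: TA SB; rewrite TA' SB' -EFinM !lee_fin => AK BK.
by rewrite (le_trans _ KL) // ler_pM.
Qed.

Lemma kembedsS Y E (K : R) (V : set Y) (W W' : set E) : W `<=` W' ->
  kembeds K V W -> kembeds K V W'.
Proof.
by move=> WW' [T [lT TW TK]]; exists T; split=> // v /TW; exact: WW'.
Qed.

Lemma kembeds_trans Y E E' (K L : R) (V : set Y) (W : set E) (U : set E') :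
  0 <= K -> 0 <= L ->
  kembeds K V W -> kembeds L W U -> kembeds (K * L) V U.
Proof.
move=> K0 L0 [T [lT TW TK]] [S [lS SU SK]]; exists (S \o T); split.
- by move=> r u v Vu Vv /=; rewrite lT // lS //; exact: TW.
- by move=> v Vv /=; apply: SU; exact: TW.
move=> v Vv /=; have [h1 h2] := TK v Vv; have [h3 h4] := SK _ (TW _ Vv).
by split; [apply: le_trans h1 _; rewrite -mulrA ler_wpM2l|
  apply: le_trans h4 _; rewrite [K * L]mulrC -mulrA ler_wpM2l].
Qed.

Definition equivn Y E (K : R) n (y : nat -> Y) (z : nat -> E) : Prop :=
  forall a, `|lcomb a y n| <= K * `|lcomb a z n| /\
            `|lcomb a z n| <= K * `|lcomb a y n|.

Lemma equivn_sym Y E (K : R) n (y : nat -> Y) (z : nat -> E) :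
  equivn K n y z -> equivn K n z y.
Proof. by move=> h a; have [] := h a. Qed.

Lemma equivn_trans Y E E' (K L : R) n (y : nat -> Y) (z : nat -> E) (w : nat -> E') :
  0 <= K -> 0 <= L -> equivn K n y z -> equivn L n z w -> equivn (K * L) n y w.
Proof.
move=> K0 L0 h1 h2 a; have [h3 h4] := h1 a; have [h5 h6] := h2 a.
by split; [apply: le_trans h3 _; rewrite -mulrA ler_wpM2l|
  apply: le_trans h6 _; rewrite [K * L]mulrC -mulrA ler_wpM2l].
Qed.

Lemma equivn_le Y E (K L : R) n (y : nat -> Y) (z : nat -> E) : K <= L ->
  equivn K n y z -> equivn L n y z.
Proof.
move=> KL h a; have [h1 h2] := h a.
by split; [apply: le_trans h1 _|apply: le_trans h2 _]; rewrite ler_wpM2r.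
Qed.

Lemma equivn_lin Y E (K : R) n (y : nat -> Y) (V : set Y) (T : Y -> E) :
  linear_subspace V -> linear_on V T ->
  (forall v, V v -> `|v| <= K * `|T v| /\ `|T v| <= K * `|v|) ->
  (forall i, (i < n)%N -> V (y i)) -> equivn K n y (T \o y).
Proof.
move=> lV lT TK Vy a; rewrite -(linear_on_lcomb lV lT) //.
by apply: TK; exact: subspace_lcomb.
Qed.

Lemma equivn_kembeds Y E (K : R) n (y : nat -> Y) (z : nat -> E) (W : set E) :
  equivn K n y z -> linear_subspace W -> (forall i, (i < n)%N -> W (z i)) ->
  kembeds K (linear_span (y @` [set i | (i < n)%N])) W.
Proof.
move=> yz lW Wz.
(* The coefficients of [v] are chosen arbitrarily; [TE] shows that the choice is immaterial, since
   [equivn] sends vanishing combinations of [y] to vanishing combinations of [z]. *)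
pose T v := lcomb (xget (fun=> 0) [set a | v = lcomb a y n]) z n.
have TE a : T (lcomb a y n) = lcomb a z n.
  rewrite /T; case: xgetP => [b _ /= ab|/(_ a) []//].
  apply/eqP; rewrite -subr_eq0 -lcombB -normr_le0.
  by have [_] := yz (fun i => b i - a i); rewrite !lcombB -ab subrr normr0 mulr0.
exists T; split.
- move=> r u v /linear_span_firstP [a ->] /linear_span_firstP [b ->].
  by rewrite -lcombZ -lcombD !TE lcombD lcombZ.
- by move=> v /linear_span_firstP [a ->]; rewrite TE; exact: subspace_lcomb.
- by move=> v /linear_span_firstP [a ->]; rewrite TE; exact: (yz a).
Qed.

(** The principle of small perturbations: coefficients are at most [C] times the norm, so replacing
    [y] by [z] changes a combination by at most half the norm of the one in [y]. *)
Lemma equivn_perturb E (C : R) n (y z : nat -> E) (d : nat -> R) :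
  (forall a j, (j < n)%N -> `|a j| <= C * `|lcomb a y n|) ->
  (forall j, (j < n)%N -> `|z j - y j| <= d j) ->
  C * \sum_(j < n) d j <= 2^-1 -> equivn 2 n y z.
Proof.
move=> yC zd Cd a.
have h : `|lcomb a z n - lcomb a y n| <= 2^-1 * `|lcomb a y n|.
  rewrite /lcomb -sumrB (le_trans (ler_norm_sum _ _ _)) //.
  apply: (@le_trans _ _ (\sum_(j < n) (C * `|lcomb a y n|) * d j)).
    apply: ler_sum => j _; rewrite -scalerBr normrZ.
    by apply: ler_pM => //; [exact: yC|exact: zd].
  by rewrite -mulr_sumr mulrAC ler_wpM2r.
have h1 := ler_normD (lcomb a z n - lcomb a y n) (lcomb a y n).
have h2 := ler_normD (lcomb a y n - lcomb a z n) (lcomb a z n).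
rewrite subrK in h1; rewrite subrK distrC in h2.
have := normr_ge0 (lcomb a y n); have := normr_ge0 (lcomb a z n).
by split; lra.
Qed.

Lemma equivn_closed_span Y E (A : set E) (C K : R) n (y : nat -> Y) (u : nat -> E) :
  0 <= C -> 0 <= K ->
  (forall a j, (j < n)%N -> `|a j| <= C * `|lcomb a y n|) ->
  (forall i, (i < n)%N -> closed_span A (u i)) -> equivn K n y u ->
  exists u' : nat -> E, (forall i, (i < n)%N -> linear_span A (u' i)) /\
    equivn (K * 2) n y u'.
Proof.
move=> C0 K0 yC uA yu.
have CK0 : 0 < 1 + C * K by rewrite ltr_pwDl // mulr_ge0.
(* [C * K] bounds the coefficients of combinations of [u] and there are [n] errors; the added units
   keep the factors nonzero. The total perturbation is at most one half. *)
pose d : R := (2 * (1 + C * K) * n.+1%:R)^-1.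
have d0 : 0 < d by rewrite invr_gt0 !mulr_gt0.
have /choice [u' uP] : forall i, exists w, (i < n)%N ->
    linear_span A w /\ `|u i - w| < d.
  move=> i; have [i_n|] := ltnP i n; last by exists 0.
  by have /closed_spanP /(_ _ d0) [w Aw uw] := uA i i_n; exists w.
exists u'; split=> [i i_n|]; first by case: (uP i i_n).
apply: equivn_trans (yu) _ => //.
apply: (@equivn_perturb _ (1 + C * K) _ _ _ (fun=> d)).
- move=> a j jn; rewrite (le_trans (yC a j jn)) //.
  apply: (@le_trans _ _ (C * (K * `|lcomb a u n|))).
    by rewrite ler_wpM2l //; case: (yu a).
  by rewrite mulrA ler_wpM2r // ler_wpDl.
- by move=> j jn; rewrite distrC ltW //; case: (uP j jn).
rewrite sumr_const card_ord -[_ *+ n]mulr_natr.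
have -> : (1 + C * K) * (d * n%:R) = n%:R / n.+1%:R * 2^-1.
  by rewrite /d; field; rewrite !gt_eqF.
by rewrite ler_piMl ?invr_ge0 // ler_pdivrMr // mul1r ler_nat.
Qed.

End Kembeds.

(** * The basis constant *)

Section Limits.
Context {R : realType}.

Lemma cvg_norm_bound (V : normedModType R) (s : nat -> V) l x (D : R) N :
  s @ \oo --> l -> (forall n, (N <= n)%N -> `|s n - x| <= D) -> `|l - x| <= D.
Proof.
move=> sl sD; rewrite leNgt; apply/negP => lD.
have /cvgrPdist_lt /(_ (`|l - x| - D)) := sl.
rewrite subr_gt0 => /(_ lD) [M _ sM].
have := sM (maxn M N) (leq_maxl _ _); have := sD (maxn M N) (leq_maxr _ _).
have := ler_distD (s (maxn M N)) l x.
by rewrite /=; lra.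
Qed.

Lemma cauchy_seq_cvg (V : completeNormedModType R) (s : nat -> V) :
  (forall eps : R, 0 < eps ->
    exists N, forall n, (N <= n)%N -> `|s n - s N| < eps) -> cvgn s.
Proof.
move=> sC; apply/cauchy_cvgP; apply/cauchy_exP => eps eps0.
have [N sN] := sC _ eps0; exists (s N); exists N => // n /= Nn.
by rewrite -ball_normE /= distrC; exact: sN.
Qed.

Lemma half_pow_small (D eps : R) : 0 < eps -> exists N, D * 2^-1 ^+ N < eps.
Proof.
move=> eps0.
have /cvgrPdist_lt /(_ eps eps0) [N _ hN] : geometric D (2^-1 : R) @ \oo --> (0 : R).
  by apply: cvg_geometric; rewrite ger0_norm ?invr_ge0 // invf_lt1 ?ltr1n.
exists N; have := hN N (leqnn _); rewrite /= distrC subr0.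
exact: le_lt_trans (ler_norm _).
Qed.

Lemma half_pow_cauchy (V : normedModType R) (s : nat -> V) (D : R) :
  (forall k, `|s k.+1 - s k| <= D * 2^-1 ^+ k) ->
  forall k l, (k <= l)%N -> `|s l - s k| <= 2 * D * 2^-1 ^+ k.
Proof.
move=> sD k l kl.
have D0 : 0 <= D by have := sD 0%N; rewrite expr0 mulr1; apply: le_trans.
suff : `|s l - s k| <= 2 * D * (2^-1 ^+ k - 2^-1 ^+ l).
  move/le_trans; apply; rewrite ler_wpM2l // ?mulr_ge0 // gerBl.
  by rewrite exprn_ge0 // invr_ge0.
rewrite -(subnKC kl); elim: (l - k)%N => [|m IHm].
  by rewrite addn0 !subrr normr0 mulr0.
have := ler_distD (s (k + m)%N) (s (k + m.+1)%N) (s k).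
have := sD (k + m)%N; rewrite addnS exprS; move: IHm.
by set x := _ ^+ (k + m); lra.
Qed.

Lemma half_pow_cvg (V : completeNormedModType R) (s : nat -> V) (D : R) :
  (forall k, `|s k.+1 - s k| <= D * 2^-1 ^+ k) -> cvgn s.
Proof.
move=> sD; apply: cauchy_seq_cvg => eps eps0.
have [N hN] := half_pow_small (2 * D) eps0; exists N => n Nn.
exact: le_lt_trans (half_pow_cauchy sD Nn) hN.
Qed.

Lemma cvg_lcomb (V : normedModType R) (a : nat -> nat -> R) b (x : nat -> V) n :
  (forall i, a ^~ i @ \oo --> b i) -> (fun k => lcomb (a k) x n) @ \oo --> lcomb b x n.
Proof.
move=> ab; elim: n => [|n IHn].
  rewrite [lcomb b x 0]big_ord0 (_ : (fun=> _) = cst 0); first exact: cvg_cst.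
  by apply/funext => k; rewrite /lcomb big_ord0.
rewrite lcombS (_ : (fun=> _) = (fun k => lcomb (a k) x n + a k n *: x n)).
  by apply: cvgD => //; apply: cvgZr_tmp; exact: ab.
by apply/funext => k; rewrite lcombS.
Qed.

End Limits.

Section BasisConstant.
Context {R : realType} {E : completeNormedModType R}.
Variable e : nat -> E.
Hypothesis eB : normalised_basis e.

Lemma basis_expansion : exists c : nat -> E -> R,
  forall v, lcomb (c ^~ v) e @ \oo --> v /\
    forall a, lcomb a e @ \oo --> v -> forall i, a i = c i v.
Proof.
have [_ /(_ _)/cid -/all_tag [c cP]] := eB.
exists (fun i v => c v i) => v; have [cv cu] := cP v.
have lE a : lcomb a e = series (fun k => a k *: e k).
  by apply/funext => n; rewrite /lcomb seriesEord.
split=> [|a]; first by rewrite lE.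
by rewrite lE => /cu ->.
Qed.

Let c := projT1 (cid basis_expansion).
Let P n v := lcomb (c ^~ v) e n.

Let P_cvg v : P ^~ v @ \oo --> v.
Proof. by have [] := projT2 (cid basis_expansion) v. Qed.

Let c_uniq v a : lcomb a e @ \oo --> v -> forall i, a i = c i v.
Proof. by have [_] := projT2 (cid basis_expansion) v; apply. Qed.

Let c_lin i (r : R) u v : c i (r *: u + v) = r * c i u + c i v.
Proof.
symmetry; move: i; apply: c_uniq.
rewrite (_ : lcomb _ _ = fun n => r *: P n u + P n v).
  by apply: cvgD; [apply: cvgZl_tmp|]; exact: P_cvg.
by apply/funext => n; rewrite lcombD lcombZ.
Qed.

Let P_lin n (r : R) u v : P n (r *: u + v) = r *: P n u + P n v.
Proof. by rewrite /P -lcombZ -lcombD; apply: eq_lcomb => i _; rewrite c_lin. Qed.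

Let c0 i : c i 0 = 0.
Proof.
have := c_lin i 1 0 0; rewrite scaler0 addr0 mul1r => /eqP.
by rewrite eq_sym -subr_eq0 addrK => /eqP.
Qed.

Let P0 n : P n 0 = 0.
Proof. by rewrite /P -[RHS](lcomb0 e n); apply: eq_lcomb => i _; exact: c0. Qed.

Let cB i u v : c i (u - v) = c i u - c i v.
Proof. by rewrite addrC -scaleN1r c_lin mulN1r addrC. Qed.

Let PB n u v : P n (u - v) = P n u - P n v.
Proof. by rewrite addrC -scaleN1r P_lin scaleN1r addrC. Qed.

Let PZ n (r : R) v : P n (r *: v) = r *: P n v.
Proof. by rewrite -[r *: v]addr0 P_lin P0 addr0. Qed.

Let c_le i v (D : R) : (forall n, `|P n v| <= D) -> `|c i v| <= 2 * D.
Proof.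
move=> PD; have e1 := proj1 eB i.
have -> : `|c i v| = `|P i.+1 v - P i v|.
  by rewrite /P lcombS addrAC subrr add0r normrZ e1 mulr1.
by have := ler_normB (P i.+1 v) (P i v); have := PD i; have := PD i.+1; lra.
Qed.

(** These sets are not known to be closed, so Baire's theorem is applied to their closures, and
    boundedness has to be regained from approximations. *)
Let A (D : R) := [set v | forall n, `|P n v| <= D].

Let A_cover v : exists N : nat, A N%:R v.
Proof.
have [M [_ PM]] := cvg_seq_bounded (cvgP _ (@P_cvg v)).
have hM : M < `|M| + 1 by have := ler_norm M; lra.
exists (Num.bound (`|M| + 1)) => n.
by rewrite (le_trans (PM _ hM n I)) // ltW // archi_boundP // addr_ge0.
Qed.

Let A_diff D u v : A D u -> A D v -> A (2 * D) (u - v).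
Proof.
move=> Au Av n; rewrite PB (le_trans (ler_normB _ _)) //.
by have := Au n; have := Av n; lra.
Qed.

(** By Baire, some closure contains a ball around a point [v0]; subtracting approximants of [v0]
    from approximants of [v0 + u] moves the ball to the origin and doubles the bound. *)
Let closure_A_ball : exists D r : R, [/\ 0 <= D, 0 < r &
  forall u, `|u| < r -> closure (A D) u].
Proof.
have [N] : exists N : nat, ~ dense (~` closure (A N%:R)).
  apply: contrapT => /forallNP dA.
  have /(_ setT) : dense (\bigcap_N ~` closure (A N%:R)).
    apply: Baire => N; split; last by apply: contrapT; exact: dA.
    by apply: closed_openC; exact: closed_closure.
  case=> [| |v [_ /= vA]]; [by exists 0|exact: openT|].
  by have [N vN] := A_cover v; apply: (vA N) => //; exact: subset_closure.
move/existsNP => [U /not_implyP [[v0 Uv0] /not_implyP [oU /nonemptyPn UA]]].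
have UAN : U `<=` closure (A N%:R).
  move=> v Uv; apply: contrapT => vA.
  by suff : (U `&` ~` closure (A N%:R)) v by rewrite UA.
have /nbhs_ballP [r /= r0 rU] : nbhs v0 U by exact: open_nbhs_nbhs.
exists (2 * N%:R), r; split=> [|//|u ur]; first by rewrite mulr_ge0.
have /closure_normP Av0 : closure (A N%:R) v0 by exact: UAN.
have /closure_normP Av0u : closure (A N%:R) (v0 + u).
  by apply: UAN; apply: rU; rewrite -ball_normE /= opprD addrA subrr sub0r normrN.
apply/closure_normP => eps eps0.
have [w1 Aw1 h1] := Av0 _ (divr_gt0 eps0 (ltr0n _ 2)).
have [w2 Aw2 h2] := Av0u _ (divr_gt0 eps0 (ltr0n _ 2)).
exists (w2 - w1); first exact: A_diff.
have -> : u - (w2 - w1) = (v0 + u - w2) - (v0 - w1).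
  by rewrite !opprB [RHS]addrC -[v0 + u - w2]addrA subrKA addrCA.
by rewrite (le_lt_trans (ler_normB _ _)) // (splitr eps) ltrD.
Qed.

Let half_approx : exists2 M : R, 0 <= M & forall u, exists w,
  `|u - w| <= 2^-1 * `|u| /\ forall n, `|P n w| <= M * `|u|.
Proof.
have [D [r [D0 r0 rA]]] := closure_A_ball.
exists (2 * D / r); first by rewrite divr_ge0 ?mulr_ge0 // ltW.
move=> u; have [->|u0] := eqVneq u 0.
  by exists 0; rewrite subr0 !normr0 !mulr0; split=> // n; rewrite P0 normr0.
have {}u0 : 0 < `|u| by rewrite normr_gt0.
(* Scaled by [t], the vector has norm [r / 2] and lies in the ball; half of that norm as accuracy
   becomes half of the norm of [u] after scaling back. *)
pose t := r / (2 * `|u|).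
have t0 : 0 < t by apply: divr_gt0 => //; apply: mulr_gt0.
have tu : `|t *: u| = r / 2.
  by rewrite normrZ gtr0_norm // /t; field; rewrite gt_eqF.
have /rA/closure_normP /(_ (t * `|u| / 2)) : `|t *: u| < r by rewrite tu; lra.
have tu0 : 0 < t * `|u| / 2 by apply: divr_gt0 => //; exact: mulr_gt0.
move=> /(_ tu0) [w Aw uw].
exists (t^-1 *: w); split=> [|n].
  rewrite -(ler_pM2l t0) -[t in t * `|_|]gtr0_norm // -normrZ scalerBr scalerA.
  by rewrite divff ?gt_eqF // scale1r (le_trans (ltW uw)) //; lra.
rewrite PZ normrZ gtr0_norm ?invr_gt0 // (le_trans (ler_wpM2l _ (Aw n))) //.
  by rewrite invr_ge0 ltW.
rewrite le_eqVlt; apply/orP; left; apply/eqP.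
by rewrite /t; field; rewrite !gt_eqF.
Qed.

(** Successive approximation as in the open mapping theorem: the remainders [u_ k] halve in norm,
    the coordinates of the accumulated corrections [s k] converge geometrically, and uniqueness of
    expansions identifies their limits with the coefficients of [u]. *)
Let P_bound : exists B : R, forall v n, `|P n v| <= B * `|v|.
Proof.
have [M M0 /choice [w hw]] := half_approx.
exists (2 * M) => u.
pose u_ k := iter k (fun u => u - w u) u.
pose s k := u - u_ k.
have uk k : `|u_ k| <= 2^-1 ^+ k * `|u|.
  elim: k => [|k IHk]; first by rewrite expr0 mul1r.
  by rewrite /u_ iterS (le_trans (hw _).1) // exprS -mulrA ler_wpM2l // invr_ge0.
have Ps n k : `|P n (s k.+1) - P n (s k)| <= (M * `|u|) * 2^-1 ^+ k.
  rewrite -PB (_ : s k.+1 - s k = w (u_ k)); last first.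
    by rewrite /s /u_ iterS -/(u_ k) !opprB -addrA subrKA addrC subrK.
  by rewrite (le_trans ((hw _).2 n)) // -mulrA ler_wpM2l // mulrC uk.
have Psl n k l : (k <= l)%N -> `|P n (s l) - P n (s k)| <= 2 * (M * `|u|) * 2^-1 ^+ k.
  by apply: (half_pow_cauchy (s := fun k => P n (s k))); exact: Ps.
have cs i : cvgn (fun k => c i (s k)).
  apply: (@half_pow_cvg R R _ (2 * (M * `|u|))) => k.
  rewrite -mulrA -cB.
  by apply: c_le => n; rewrite PB; exact: Ps.
pose a i := limn (fun k => c i (s k)).
have S_cvg n : (fun k => P n (s k)) @ \oo --> lcomb a e n by apply: cvg_lcomb.
have Sk n k : `|lcomb a e n - P n (s k)| <= 2 * (M * `|u|) * 2^-1 ^+ k.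
  by apply: (cvg_norm_bound (S_cvg n) (N := k)) => l kl; exact: Psl.
have au : lcomb a e @ \oo --> u.
  apply/cvgrPdist_lt => eps eps0.
  have eps3 : 0 < eps / 3 by lra.
  have [k hk] := half_pow_small (2 * (M * `|u|) + `|u|) eps3.
  have p0 : (0 : R) <= 2^-1 ^+ k by rewrite exprn_ge0 // invr_ge0.
  have /cvgrPdist_lt/(_ _ eps3) [N _ hN] := @P_cvg (s k).
  exists N => // n /= Nn.
  have := hN _ Nn; rewrite /= => h1.
  have h2 := Sk n k.
  have h3 : `|u - s k| <= 2^-1 ^+ k * `|u| by rewrite opprB addrC subrK.
  have := ler_distD (s k) u (lcomb a e n); have := ler_distD (P n (s k)) (s k) (lcomb a e n).
  rewrite [`|P n _ - lcomb _ _ _|]distrC.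
  have h4 : 0 <= 2 * (M * `|u|) * 2^-1 ^+ k by rewrite !mulr_ge0.
  have h5 : 0 <= `|u| * 2^-1 ^+ k by rewrite !mulr_ge0.
  by move: hk; rewrite mulrDl; lra.
move=> n; have -> : P n u = lcomb a e n.
  by apply: eq_lcomb => i _; rewrite -(c_uniq au).
(* Since [s 0] is zero, the estimate at [k = 0] is the required bound. *)
have := Sk n 0%N; rewrite expr0 mulr1 /s /= subrr P0 subr0.
by rewrite mulrA.
Qed.

Lemma basis_coordinates : exists (c : nat -> E -> R) (B : R), [/\ 1 <= B,
  forall i (r : R) u v, c i (r *: u + v) = r * c i u + c i v,
  forall i j, c i (e j) = (i == j)%:R,
  forall v n, `|lcomb (c ^~ v) e n| <= B * `|v|
  & forall v, lcomb (c ^~ v) e @ \oo --> v].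
Proof.
have [B PB'] := P_bound; exists c, (Num.max 1 B); split=> //.
- by rewrite le_max lexx.
- move=> i j; rewrite -(@c_uniq (e j) (fun i => (i == j)%:R)) //.
  apply/cvgrPdist_lt => eps eps0; exists j.+1 => // n /= jn.
  by rewrite lcomb_delta // subrr normr0.
- by move=> v n; rewrite (le_trans (PB' v n)) // ler_wpM2r // le_max lexx orbT.
Qed.

End BasisConstant.

(** * Basic sequences *)

Section BlockBasis.
Context {R : realType} {E : completeNormedModType R}.
Implicit Types (e x : nat -> E) (F : {pred R}).

(** The functionals are linear on all of [E], but partial sums are bounded only on the closed span:
    outside it, the functionals that a block sequence inherits from the basis need not obey the
    bound [B]. *)
Definition basic_sequence x (c : nat -> E -> R) (B : R) : Prop :=
  [/\ 1 <= B, forall i, `|x i| = 1,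
   forall i (r : R) u v, c i (r *: u + v) = r * c i u + c i v,
   forall i j, c i (x j) = (i == j)%:R
   & forall v, closed_span (range x) v -> forall n, `|lcomb (c ^~ v) x n| <= B * `|v|].

(** The kernel of [g] in [V] is a subspace containing [A], and boundedness carries this over to
    limits. Identities between coordinates can thus be checked on the terms of a sequence. *)
Lemma bounded_zero_closed_span (E' : normedModType R) (V A : set E)
    (g : E -> E') (D : R) :
  linear_subspace V -> linear_on V g -> (forall v, V v -> `|g v| <= D * `|v|) ->
  closed_span A `<=` V -> (forall v, A v -> g v = 0) ->
  forall v, closed_span A v -> g v = 0.
Proof.
move=> lV lg gD AV gA v Av; have Vv := AV _ Av.
have D0 : 0 <= Num.max 1 D by rewrite le_max ler01.
have D1 : 0 < Num.max 1 D by rewrite lt_max ltr01.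
have lker : linear_subspace [set w | V w /\ g w = 0].
  apply/subspaceP; split; first by split; [exact: subspace0|exact: linear_on0 lV lg].
  move=> r u w [Vu gu] [Vw gw]; split; first exact: subspaceZD.
  by rewrite lg // gu gw scaler0 addr0.
have kA : linear_span A `<=` [set w | V w /\ g w = 0].
  apply: linear_span_sub => // w Aw; split; last exact: gA.
  by apply: AV; apply: sub_closed_span; exact: sub_linear_span.
apply/eqP; rewrite -normr_le0 leNgt; apply/negP => gv0.
move/closed_spanP : Av => /(_ _ (divr_gt0 gv0 D1)) [w /kA [Vw gw] vw].
have : `|g v| < `|g v|.
  rewrite -{1}[g v]subr0 -gw -(linear_onB lg) //.
  rewrite (le_lt_trans (gD _ (subspaceB lV Vv Vw))) //.
  apply: (@le_lt_trans _ _ (Num.max 1 D * `|v - w|)).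
    by rewrite ler_wpM2r // le_max lexx orbT.
  by rewrite mulrC -ltr_pdivlMr.
by rewrite ltxx.
Qed.

Section BasicSequence.
Variables (x : nat -> E) (c : nat -> E -> R) (B : R).
Hypothesis xB : basic_sequence x c B.

Let B1 : 1 <= B. Proof. by case: xB. Qed.
Let B0 : 0 <= B. Proof. exact: le_trans B1. Qed.
Let lx := closed_span_subspace (range x).

Lemma bs_norm i : `|x i| = 1. Proof. by case: xB. Qed.

Lemma bs_lin i (r : R) u v : c i (r *: u + v) = r * c i u + c i v.
Proof. by case: xB. Qed.

Lemma bs_delta i j : c i (x j) = (i == j)%:R.
Proof. by case: xB. Qed.

Lemma bs_mem i : closed_span (range x) (x i).
Proof. by apply: sub_closed_span; apply: sub_linear_span; exists i. Qed.

Lemma bs_lcomb_mem a n : closed_span (range x) (lcomb a x n).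
Proof. by apply: subspace_lcomb => // i _; exact: bs_mem. Qed.

Arguments bs_mem : clear implicits.
Arguments bs_lcomb_mem : clear implicits.

Lemma bs0 i : c i 0 = 0.
Proof.
have := bs_lin i 1 0 0; rewrite scaler0 addr0 mul1r => /eqP.
by rewrite eq_sym -subr_eq0 addrK => /eqP.
Qed.

Lemma bsB i u v : c i (u - v) = c i u - c i v.
Proof. by rewrite addrC -scaleN1r bs_lin mulN1r addrC. Qed.

Lemma bsD i u v : c i (u + v) = c i u + c i v.
Proof. by rewrite -[u]scale1r bs_lin mul1r scale1r. Qed.

Lemma bs_lcomb i a y n : c i (lcomb a y n) = \sum_(j < n) a j * c i (y j).
Proof.
elim: n => [|n IHn]; first by rewrite /lcomb !big_ord0 bs0.
by rewrite lcombS addrC bs_lin IHn big_ord_recr /= addrC.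
Qed.

Lemma bs_coef_lcomb i a n : c i (lcomb a x n) = if (i < n)%N then a i else 0.
Proof.
rewrite bs_lcomb; case: ltnP => i_n.
  rewrite (bigD1 (Ordinal i_n)) //= bs_delta eqxx mulr1 big1 ?addr0 // => j.
  by rewrite -val_eqE /= eq_sym bs_delta => /negPf ->; rewrite mulr0.
apply: big1 => j _; rewrite bs_delta; case: eqP => [ij|_]; last by rewrite mulr0.
by have := ltn_ord j; rewrite -ij ltnNge i_n.
Qed.

Lemma bs_coef_le i v : closed_span (range x) v -> `|c i v| <= 2 * B * `|v|.
Proof.
move=> Vv; have [_ _ _ _ /(_ _ Vv) PD] := xB.
have -> : `|c i v| = `|lcomb (c ^~ v) x i.+1 - lcomb (c ^~ v) x i|.
  by rewrite lcombS addrAC subrr add0r normrZ bs_norm mulr1.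
by have := ler_normB (lcomb (c ^~ v) x i.+1) (lcomb (c ^~ v) x i);
  have := PD i; have := PD i.+1; lra.
Qed.

Lemma bs_coef_lcomb_le a j n : (j < n)%N -> `|a j| <= 2 * B * `|lcomb a x n|.
Proof.
by move=> jn; have := bs_coef_le j (bs_lcomb_mem a n); rewrite bs_coef_lcomb jn.
Qed.

Lemma bs_coef_zero i (D : set nat) v : ~ D i -> closed_span (x @` D) v -> c i v = 0.
Proof.
move=> Di; apply: (@bounded_zero_closed_span R (closed_span (range x)) _ (c i) (2 * B)).
- exact: lx.
- by move=> r u w _ _; rewrite bs_lin.
- by move=> w; exact: bs_coef_le.
- by apply: closed_spanS => _ [j _ <-]; exists j.
- move=> _ [j Dj <-]; rewrite bs_delta; case: eqP => // ij.
  by case: Di; rewrite ij.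
Qed.

(** Deleting the first [k] terms of an approximant [w] costs a factor [1 + B]: the [k]-th partial
    sum of [v] vanishes, so that of [w] is that of [w - v]. *)
Lemma bs_tail_approx k v : closed_span (range x) v ->
  (forall i, (i < k)%N -> c i v = 0) -> forall eps : R, 0 < eps ->
  exists n a, (forall i, (i < k)%N -> a i = 0) /\ `|v - lcomb a x n| < eps.
Proof.
move=> Vv cv eps eps0.
have e0 : 0 < eps / (1 + B) by rewrite divr_gt0 // ltr_wpDr.
move/closed_spanP : (Vv) => /(_ _ e0) [w' /linear_span_rangeP [n [a ->]] vw].
exists (n + k)%N, (fun i => if (k <= i)%N then (if (i < n)%N then a i else 0) else 0).
split=> [i ik|]; first by rewrite leqNgt ik.
set b := fun i => _; set w := lcomb a x n in vw *.
have -> : lcomb b x (n + k) = w - lcomb (c ^~ w) x k.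
  rewrite {1}/w -(lcomb_trunc a x (leq_addr k n)).
  rewrite -(lcomb_trunc (c ^~ _) x (leq_addl n k)) -lcombB; apply: eq_lcomb => i _.
  by rewrite /b /w bs_coef_lcomb; case: (ltnP i k) => ik; rewrite ?subr0 ?subrr.
have Q0 : lcomb (c ^~ (v - w)) x k = - lcomb (c ^~ w) x k.
  rewrite -[RHS]scaleN1r -lcombZ; apply: eq_lcomb => i ik.
  by rewrite bsB cv // sub0r mulN1r.
have -> : v - (w - lcomb (c ^~ w) x k) = (v - w) - lcomb (c ^~ (v - w)) x k.
  by rewrite Q0 opprK opprB addrCA addrC.
have Vvw : closed_span (range x) (v - w) by apply: (subspaceB lx) => //; exact: bs_lcomb_mem.
have [_ _ _ _ /(_ _ Vvw k) Qk] := xB.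
rewrite (le_lt_trans (ler_normB _ _)) //.
move: vw; rewrite ltr_pdivlMr ?ltr_wpDr //; lra.
Qed.

Lemma bs_tail k v : closed_span (range x) v ->
  (forall i, (i < k)%N -> c i v = 0) -> closed_span (x @` [set n | (k <= n)%N]) v.
Proof.
move=> Vv cv; apply/closed_spanP => eps eps0.
have [n [a [ak va]]] := bs_tail_approx Vv cv eps0.
exists (lcomb a x n) => //; apply/linear_span_imageP; exists n, a.
by split=> // i /negP; rewrite -ltnNge; exact: ak.
Qed.

Lemma bs_tail_subspace k : Defs.subspace (closed_span (x @` [set n | (k <= n)%N])).
Proof.
have lk := closed_span_subspace (x @` [set n | (k <= n)%N]).
split; [exact: lk|exact: closed_closed_span|].
apply: (@not_fd_biorthogonal _ _ _ (fun i => x (k + i)%N) (fun i => c (k + i)%N)) => //.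
- move=> i; apply: sub_closed_span; apply: sub_linear_span.
  by exists (k + i)%N => //=; rewrite leq_addr.
- by move=> i r u w _ _; rewrite bs_lin.
- by move=> i j; rewrite bs_delta eqn_add2l.
Qed.

(* The first l vectors are moved past the gap, to the indices m, ..., m + l - 1; the
   constant does not depend on m or on the end r of the gap. *)
Lemma bs_skip_gap l m r : (m + l <= r.+1)%N ->
  kembeds (4 * B * l%:R + 1 + B) (closed_span (x @` [set n | ~~ (l <= n <= r)%N]))
    (closed_span (x @` [set n | (m <= n)%N])).
Proof.
move=> mlr; set V := closed_span _; set W := closed_span _.
have VX : V `<=` closed_span (range x) by apply: closed_spanS => _ [j _ <-]; exists j.
have lV : linear_subspace V by exact: closed_span_subspace.
have lW : linear_subspace W by exact: closed_span_subspace.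
have Wx i : W (x (m + i)%N).
  apply: sub_closed_span; apply: sub_linear_span.
  by exists (m + i)%N => //=; rewrite leq_addr.
have WX : W `<=` closed_span (range x) by apply: closed_spanS => _ [j _ <-]; exists j.
have gap i v : V v -> (l <= i <= r)%N -> c i v = 0.
  by move=> Vv ilr; apply: bs_coef_zero Vv; rewrite /= ilr.
pose S v := lcomb (c ^~ v) (fun i => x (m + i)%N) l.
pose Q v := lcomb (c ^~ v) x l.
pose T v := S v + (v - Q v).
have cQ i v : V v -> (i <= r)%N -> c i (v - Q v) = 0.
  move=> Vv ir; rewrite bsB bs_coef_lcomb; case: ltnP => il; first by rewrite subrr.
  by rewrite gap ?il // subr0.
have WS v : W (S v) by apply: subspace_lcomb.
have Sle v (D : R) : (forall i, (i < l)%N -> `|c i v| <= D) -> `|S v| <= D * l%:R.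
  move=> cD; rewrite /S /lcomb (le_trans (ler_norm_sum _ _ _)) //.
  apply: (@le_trans _ _ (\sum_(i < l) D)); last by rewrite sumr_const card_ord mulr_natr.
  by apply: ler_sum => i _; rewrite normrZ bs_norm mulr1 cD.
have Qle v (D : R) : (forall i, (i < l)%N -> `|c i v| <= D) -> `|Q v| <= D * l%:R.
  move=> cD; rewrite /Q /lcomb (le_trans (ler_norm_sum _ _ _)) //.
  apply: (@le_trans _ _ (\sum_(i < l) D)); last by rewrite sumr_const card_ord mulr_natr.
  by apply: ler_sum => i _; rewrite normrZ bs_norm mulr1 cD.
have WT v : V v -> W (T v).
  move=> Vv; apply: (subspaceD lW) => //; apply: bs_tail.
    by apply: (subspaceB lx); [exact: VX|exact: bs_lcomb_mem].
  move=> i im; apply: cQ => //; rewrite -ltnS (leq_trans _ mlr) //.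
  by rewrite (leq_trans im) // leq_addr.
have cT v i : V v -> (i < l)%N -> c (m + i)%N (T v) = c i v.
  move=> Vv il; rewrite bsD cQ // ?addr0; last first.
    by rewrite -ltnS (leq_trans _ mlr) // ltn_add2l.
  rewrite /S bs_lcomb (bigD1 (Ordinal il)) //= bs_delta eqxx mulr1 big1 ?addr0 //.
  by move=> j; rewrite -val_eqE /= eq_sym bs_delta eqn_add2l => /negPf ->; rewrite mulr0.
exists T; split=> //.
  move=> k u v _ _; rewrite /T /S /Q.
  have lin y : lcomb (c ^~ (k *: u + v)) y l = k *: lcomb (c ^~ u) y l + lcomb (c ^~ v) y l.
    by rewrite -lcombZ -lcombD; apply: eq_lcomb => i _; rewrite bs_lin.
  by rewrite !lin opprD [k *: u + v + _]addrACA -scalerBr addrACA -scalerDr.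
move=> v Vv; have Tv : closed_span (range x) (T v) by apply: WX; exact: WT.
have l0 : (0 : R) <= l%:R by [].
split.
  (* The coordinates of [T v] at [m + i] are those of [v] at [i], so [Q v] and [S v] both have norm
     at most [2 * B * l] times that of [T v]; adding [T v] itself gives [4 * B * l + 1]. The
     remaining [B] serves the upper bound, where [Q v] is a partial sum of [v]. *)
  have h i : (i < l)%N -> `|c i v| <= 2 * B * `|T v|.
    by move=> il; rewrite -(cT v i) //; exact: bs_coef_le.
  have := Sle v _ h; have := Qle v _ h.
  have := ler_normB (T v) (S v); have := ler_normD (Q v) (v - Q v).
  rewrite addrC subrK [T v - S v]addrC addrA addNr add0r.
  have : 0 <= B * `|T v| by rewrite mulr_ge0.
  by rewrite !mulrDl mul1r => *; lra.
have h i : (i < l)%N -> `|c i v| <= 2 * B * `|v|.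
  by move=> il; apply: bs_coef_le; exact: VX.
have := Sle v _ h; have [_ _ _ _ /(_ _ (VX _ Vv) l)] := xB.
have := ler_normD (S v) (v - Q v); have := ler_normB v (Q v).
have : 0 <= B * l%:R * `|v| by rewrite !mulr_ge0.
by rewrite /T /Q !mulrDl mul1r => *; lra.
Qed.

(** Contrapositive: if for each constant [K] there is a tail from [M K] on into which [Y] does not
    [K]-embed, gaps are chosen so long that [bs_skip_gap] moves everything outside the [k]-th one
    into such a tail. The constant [C] depends only on [k] and the start of the gap, so the end can
    be chosen after it. *)
Lemma not_tight_embeds : ~ tight_with_constants x ->
  exists (Y : completeNormedModType R) (K : R),
    [/\ ~ finite_dimensional [set: Y], 1 <= K
      & forall m, kembeds K [set: Y] (closed_span (x @` [set n | (m <= n)%N]))].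
Proof.
apply: contra_notP => noY Y nY.
have /choice [M MP] : forall K : R, exists m, 1 <= K ->
    ~ kembeds K [set: Y] (closed_span (x @` [set n | (m <= n)%N])).
  move=> K; have [K1|K1] := pselect (1 <= K); last by exists 0%N.
  apply: contrapT => /forallNP h; apply: noY; exists Y, K; split=> // m.
  by apply: contrapT => hm; apply: (h m) => _.
pose C (k l : nat) : R := Num.max 1 k%:R * (4 * B * l%:R + 1 + B).
pose r' k l := (M (C k l) + l)%N.
pose l := fix l k := if k is k'.+1 then (r' k' (l k')).+1 else 0%N.
exists l, (fun k => r' k (l k)); split=> [k|k]; first by rewrite leq_addl.
have lT : linear_subspace [set: Y] by apply/subspaceP.
move=> /(embeds_kembeds lT (closed_span_subspace _)) h1.
have h2 := @bs_skip_gap (l k) (M (C k (l k))) (r' k (l k)) (leqnSn _).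
have D1 : 1 <= 4 * B * (l k)%:R + 1 + B.
  have : 0 <= 4 * B * (l k)%:R by rewrite !mulr_ge0.
  by have := B0; lra.
have m1 : (1 : R) <= Num.max 1 k%:R by rewrite le_max lexx.
apply: (MP (C k (l k))); first by rewrite (le_trans m1) // ler_peMr // (le_trans _ m1).
by apply: kembeds_trans h1 h2; [exact: le_trans m1|exact: le_trans D1].
Qed.

End BasicSequence.
End BlockBasis.

(** * Block sequences *)

Section Blocks.
Context {R : realType} {E : completeNormedModType R}.
Implicit Types (e x : nat -> E) (F : {pred R}) (a : nat -> nat -> R).

(** [s n.+1] is one more than the last index in the support of the [n]-th block; the nonzero
    coefficient there turns a coordinate of the basis into a coordinate of the block sequence. *)
Definition block_data e F x a (s : nat -> nat) : Prop :=
  [/\ forall n, is_block e F (a n) (x n), forall n, (s n < s n.+1)%N,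
   forall n i, a n i != 0 -> (s n <= i < s n.+1)%N
   & forall n, a n (s n.+1).-1 != 0].

Lemma block_sequence_data e F x :
  block_sequence e F x -> exists a s, block_data e F x a s.
Proof.
move=> [a [ab asep]]; exists a.
have /choice [t tP] : forall n, exists t, a n t != 0 /\
    forall i, a n i != 0 -> (i <= t)%N.
  move=> n; have [_ x1 [N aN xN]] := ab n.
  have ex : exists i, a n i != 0.
    apply: contrapT => /forallNP a0; have := x1; rewrite xN big1 ?normr0.
      by move/eqP; rewrite eq_sym oner_eq0.
    by move=> i _; have /negP := a0 i; rewrite negbK => /eqP ->; rewrite scale0r.
  have bd i : a n i != 0 -> (i <= N)%N.
    by move=> ai; rewrite leqNgt; apply: contra ai => /ltnW /aN ->.
  by have [t at0 tmax] := ex_maxnP ex bd; exists t.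
exists (fun n => if n is m.+1 then (t m).+1 else 0%N).
have st n : ((if n is m.+1 then (t m).+1 else 0) <= t n)%N.
  case: n => // n; exact: asep (tP n).1 (tP n.+1).1.
split=> [//|n|n i ai|n]; last exact: (tP n).1.
  exact: st.
rewrite ltnS (tP n).2 // andbT; case: n ai => // n ai.
exact: asep (tP n).1 ai.
Qed.

Lemma block_dataS e F x a s : block_data e F x a s ->
  forall m n, (m <= n)%N -> (s m <= s n)%N.
Proof.
move=> [_ sS _ _] m n /subnKC <-; elim: (n - m)%N => [|k IHk]; first by rewrite addn0.
by rewrite addnS (leq_trans IHk) // ltnW.
Qed.

Lemma block_expansion e F x a s n m : block_data e F x a s -> (n < m)%N ->
  x n = lcomb (a n) e (s m).
Proof.
move=> xa nm; have [ab _ asep _] := xa; have [_ _ [N aN ->]] := ab n.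
have a0 i : (s m <= i)%N -> a n i = 0.
  move=> mi; apply/eqP; apply: contraTT mi => /asep /andP[_ +].
  by rewrite -ltnNge => /leq_trans; apply; exact: block_dataS xa _ _ _.
have := @lcomb_widen _ _ (a n) e _ _ (leq_maxl N (s m)) aN.
by rewrite (@lcomb_widen _ _ (a n) e _ _ (leq_maxr N (s m)) a0).
Qed.

Lemma block_lcomb e F x a s (q : nat -> R) n : block_data e F x a s ->
  lcomb q x n = lcomb (fun i => \sum_(j < n) q j * a j i) e (s n).
Proof.
move=> xa; rewrite /lcomb; under [RHS]eq_bigr do rewrite scaler_suml.
rewrite exchange_big /=; apply: eq_bigr => j _.
rewrite (block_expansion xa (ltn_ord j)) /lcomb scaler_sumr.
by apply: eq_bigr => i _; rewrite scalerA.
Qed.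

(** A partial sum over blocks is the partial sum of the basis at the end of the last block: this
    holds on each term of [x], hence on the closed span by continuity. So the constant of the basis
    serves all its block sequences. *)
Lemma block_constant e : normalised_basis e -> exists B : R, forall F x,
  block_sequence e F x -> exists c, basic_sequence x c B.
Proof.
move=> eB; have [c [B [B1 clin cdelta cB _]]] := basis_coordinates eB.
exists B => F x /block_sequence_data [a [s xa]].
have [ab sS asep alast] := xa.
have c0 i : c i 0 = 0.
  have := clin i 1 0 0; rewrite scaler0 addr0 mul1r => /eqP.
  by rewrite eq_sym -subr_eq0 addrK => /eqP.
have clc i b n : c i (lcomb b e n) = if (i < n)%N then b i else 0.
  elim: n => [|n IHn]; first by rewrite /lcomb big_ord0 c0.
  rewrite lcombS addrC clin IHn cdelta.
  have -> : (i < n.+1)%N = (i == n) || (i < n)%N by rewrite ltnS leq_eqVlt.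
  by case: eqP => [->|_] /=; rewrite ?ltnn ?mulr1n ?mulr0n ?mulr1 ?mulr0 ?addr0 ?add0r.
pose t n := (s n.+1).-1.
have ts n : (t n < s n.+1)%N by rewrite /t prednK // (leq_ltn_trans _ (sS n)).
have cx i m n : (n < m)%N -> c i (x n) = if (i < s m)%N then a n i else 0.
  by move=> nm; rewrite (block_expansion xa nm) clc.
have cdx i j : c (t i) (x j) / a i (t i) = (i == j)%:R.
  rewrite (cx _ (maxn i j).+1) ?ltnS ?leq_maxr //.
  rewrite (leq_trans (ts i)) ?(block_dataS xa) ?ltnS ?leq_maxl //.
  have [<-|ij] := eqVneq i j; first by rewrite divff //; exact: alast.
  suff -> : a j (t i) = 0 by rewrite mul0r.
  apply/eqP; apply: contraNT ij => /asep /andP[h1 h2].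
  have /andP[h3 h4] := asep _ _ (alast i).
  rewrite eqn_leq leqNgt [(j <= i)%N]leqNgt; apply/andP; split; apply/negP => ij.
    by have := leq_trans (leq_trans h2 (block_dataS xa ij)) h3; rewrite ltnn.
  by have := leq_trans (leq_trans h4 (block_dataS xa ij)) h1; rewrite ltnn.
exists (fun n v => c (t n) v / a n (t n)); split=> //.
- by move=> i; have [] := ab i.
- by move=> i r u v; rewrite clin mulrDl mulrA.
move=> v Vv n.
pose c' n v := c (t n) v / a n (t n).
suff h : lcomb (c' ^~ v) x n - lcomb (c ^~ v) e (s n) = 0.
  by move/eqP : h; rewrite subr_eq0 => /eqP ->; exact: cB.
have c'lin i (r : R) u w : c' i (r *: u + w) = r * c' i u + c' i w.
  by rewrite /c' clin mulrDl mulrA.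
have coefb i u : `|c i u| <= 2 * B * `|u|.
  have -> : `|c i u| = `|lcomb (c ^~ u) e i.+1 - lcomb (c ^~ u) e i|.
    by rewrite lcombS addrAC subrr add0r normrZ (proj1 eB) mulr1.
  by have := ler_normB (lcomb (c ^~ u) e i.+1) (lcomb (c ^~ u) e i);
    have := cB u i; have := cB u i.+1; lra.
(* This bound depends on [n] and on the blocks; it is used only for continuity. *)
pose D := \sum_(i < n) (2 * B * `|(a i (t i))^-1|) + B.
apply: (@bounded_zero_closed_span R E E setT (range x)
  (fun v => lcomb (c' ^~ v) x n - lcomb (c ^~ v) e (s n)) D) => //.
- exact/subspaceP.
- move=> r u w _ _; rewrite scalerBr addrACA -opprD -!lcombZ -!lcombD.
  by congr (_ - _); apply: eq_lcomb => i _; rewrite ?c'lin ?clin.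
- move=> u _; rewrite (le_trans (ler_normB _ _)) // mulrDl lerD ?cB //.
  rewrite /lcomb (le_trans (ler_norm_sum _ _ _)) // mulr_suml ler_sum // => i _.
  have [_ x1 _] := ab i; rewrite normrZ x1 mulr1 /c' normrM mulrAC ler_wpM2r //.
- move=> _ [j _ <-]; apply/eqP; rewrite subr_eq0; apply/eqP.
  rewrite (@eq_lcomb _ _ _ (fun i => (i == j)%:R)) => [|i _]; last exact: cdx.
  have [jn|nj] := ltnP j n.
    rewrite lcomb_delta // [LHS](block_expansion xa jn); apply: eq_lcomb => i i_n.
    by rewrite (cx _ n) // i_n.
  transitivity (0 : E); last symmetry.
    rewrite -[RHS](lcomb0 x n); apply: eq_lcomb => i i_n.
    by case: eqP => // ij; move: i_n; rewrite ij ltnNge nj.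
  rewrite -[RHS](lcomb0 e (s n)); apply: eq_lcomb => i i_n.
  rewrite (cx _ j.+1) //; case: ifP => // _; apply/eqP.
  apply: contraTT i_n => /asep /andP[h _]; rewrite -leqNgt.
  exact: leq_trans (block_dataS xa nj) h.
Qed.
End Blocks.

Section BlockScalars.
Context {R : realType} {E : completeNormedModType R} (e : nat -> E) (F : {pred R}).
Hypothesis eF : block_scalars e F.

Lemma scalars1 : 1 \in F.
Proof. by case: eF => -[]. Qed.

Lemma scalarsB u v : u \in F -> v \in F -> u - v \in F.
Proof. by case: eF => -[_ + _] _ _ _; apply. Qed.

Lemma scalars_div u v : u \in F -> v \in F -> u / v \in F.
Proof. by case: eF => -[_ _ +] _ _ _; apply. Qed.

Lemma scalars0 : 0 \in F.
Proof. by rewrite -(subrr 1) scalarsB // scalars1. Qed.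

Lemma scalarsD u v : u \in F -> v \in F -> u + v \in F.
Proof.
by move=> Fu Fv; rewrite -[v]opprK scalarsB // -sub0r scalarsB // scalars0.
Qed.

Lemma scalarsM u v : u \in F -> v \in F -> u * v \in F.
Proof.
by move=> Fu Fv; rewrite -[v]invrK scalars_div // -div1r scalars_div // scalars1.
Qed.

Lemma scalars_sum n (f : nat -> R) : (forall i, f i \in F) -> \sum_(i < n) f i \in F.
Proof.
by move=> Ff; apply: (big_ind (fun u => u \in F)) => //; [exact: scalars0|exact: scalarsD].
Qed.

End BlockScalars.

Section BlockNear.
Context {R : realType} {E : completeNormedModType R}.
Implicit Types (e x : nat -> E) (F : {pred R}) (a : nat -> nat -> R).

Lemma rat_lcomb_near x (b : nat -> R) n (eta : R) : (forall i, `|x i| = 1) -> 0 < eta ->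
  exists q : nat -> rat, (forall i, b i = 0 -> q i = 0) /\
    `|lcomb b x n - lcomb (fun i => ratr (q i)) x n| < eta.
Proof.
move=> x1 eta0; have d0 : 0 < eta / n.+1%:R by rewrite divr_gt0.
have /choice [q qP] : forall i, exists q : rat,
    (b i = 0 -> q = 0) /\ `|b i - ratr q| < eta / n.+1%:R.
  move=> i; have [->|bi] := eqVneq (b i) 0.
    by exists 0; rewrite rmorph0 subrr normr0.
  have [|q] := @rat_in_itvoo R (b i) (b i + eta / n.+1%:R); first by rewrite ltrDl.
  rewrite in_itv /= => /andP[h1 h2]; exists q; split; first by move/eqP: bi.
  by rewrite distrC ger0_norm ?subr_ge0 ?ltW // ltrBlDl.
exists q; split=> [i|]; first by case: (qP i).
rewrite -lcombB (le_lt_trans (ler_norm_sum _ _ _)) //.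
apply: (@le_lt_trans _ _ (\sum_(i < n) eta / n.+1%:R)).
  by apply: ler_sum => i _; rewrite normrZ x1 mulr1 ltW //; case: (qP i).
rewrite sumr_const card_ord -[_ *+ n]mulr_natr mulrAC ltr_pdivrMr // ltr_pM2l //.
by rewrite ltr_nat.
Qed.

(** A gliding hump: a unit vector of [Z] killed by the first [k] coordinates is close to a rational
    combination [w0] of later terms. Dividing [w0] by its norm stays within [F], because [F]
    contains the norms of its combinations. *)
Lemma block_near e F x a s c B (Z : set E) k (d : R) :
  block_scalars e F -> block_data e F x a s -> basic_sequence x c B ->
  linear_subspace Z -> Z `<=` closed_span (range x) -> ~ finite_dimensional Z ->
  0 < d ->
  exists z w b k', [/\ Z z, linear_span (x @` [set n | (k <= n)%N]) w,
    is_block e F b w, forall i, b i != 0 -> (s k <= i < s k')%N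
    & (k < k')%N /\ `|w - z| <= d].
Proof.
move=> eF xa xc lZ Zx nZ d0; have [ab sS asep _] := xa.
have [z Zz [z0 cz]] : exists2 z, Z z & z != 0 /\ forall i, (i < k)%N -> c i z = 0.
  by apply: exists_common_zero => // i r u w _ _; rewrite (bs_lin xc).
wlog z1 : z Zz z0 cz / `|z| = 1.
  move=> h; have nz : `|z| != 0 by rewrite normr_eq0.
  apply: (h (`|z|^-1 *: z)); first exact: subspaceZ.
  - by rewrite scaler_eq0 invr_eq0 negb_or nz.
  - by move=> i ik; rewrite -[_ *: z]addr0 (bs_lin xc) (bs0 xc) cz // mulr0 addr0.
  - by rewrite normrZ normfV normr_id mulVf.
(* The two approximations cost [2 * eta], the normalisation another [2 * eta]; [8 * eta <= 1] keeps
   [w0] away from zero. *)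
pose eta := Num.min d 1 / 8.
have eta0 : 0 < eta by rewrite divr_gt0 // lt_min d0 ltr01.
have [etad eta1] : 8 * eta <= d /\ 8 * eta <= 1.
  rewrite /eta mulrCA divff ?mulr1 //; split; first by rewrite ge_min lexx.
  by rewrite ge_min lexx orbT.
have [n [b [bk zb]]] := bs_tail_approx xc (Zx _ Zz) cz eta0.
have [q [qb bq]] := rat_lcomb_near b n (bs_norm xc) eta0.
pose w0 := lcomb (fun i => ratr (q i)) x n; rewrite -/w0 in bq.
have zw0 : `|z - w0| < 2 * eta by have := ler_distD (lcomb b x n) z w0; lra.
have w0l : `|w0| < 1 + 2 * eta.
  by have := ler_distD z 0 w0; rewrite !sub0r !normrN z1; lra.
have w0g : 1 - 2 * eta < `|w0|.
  by have := ler_distD w0 0 z; rewrite !sub0r !normrN z1 [`|w0 - z|]distrC; lra.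
have w00 : 0 < `|w0| by lra.
pose qq i : R := if (i < n)%N then `|w0|^-1 * ratr (q i) else 0.
pose w := `|w0|^-1 *: w0.
have wE : w = lcomb qq x (k + n).+1.
  rewrite /w /w0 -lcombZ -(@lcomb_widen _ _ qq x n).
  - by apply: eq_lcomb => i i_n; rewrite /qq i_n.
  - by rewrite leqW // leq_addl.
  - by move=> i; rewrite /qq leqNgt => /negPf ->.
have qqk i : (i < k)%N -> qq i = 0.
  by move=> ik; rewrite /qq qb ?bk // rmorph0 mulr0 if_same.
have aF j i : a j i \in F by have [] := ab j.
have qF i : (ratr (q i) : R) \in F by have [_ _ + _] := eF; apply.
have w0F : `|w0| \in F.
  rewrite /w0 (block_lcomb _ _ xa); have [_ _ _] := eF; apply=> i.
  apply: (@scalars_sum _ _ _ _ eF n (fun j => ratr (q j) * a j i)) => j.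
  exact: (scalarsM eF).
have qqF i : qq i \in F.
  rewrite /qq; case: ifP => _; last exact: (scalars0 eF).
  by rewrite mulrC; apply: (scalars_div eF).
exists z, w, (fun i => \sum_(j < (k + n).+1) qq j * a j i), (k + n).+1; split.
- exact: Zz.
- apply/linear_span_imageP; exists (k + n).+1, qq; split=> // i /negP.
  by rewrite -ltnNge; exact: qqk.
- split.
  + move=> i; apply: (@scalars_sum _ _ _ _ eF _ (fun j => qq j * a j i)) => j.
    exact: (scalarsM eF).
  + by rewrite /w normrZ normfV normr_id mulVf // gt_eqF.
  + exists (s (k + n).+1) => [i si|]; last by rewrite wE (block_lcomb _ _ xa).
    apply: big1 => j _; apply/eqP; rewrite mulf_eq0; apply/orP; right.
    apply: contraTT si => /asep /andP[_ h]; rewrite -ltnNge.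
    exact: leq_trans h (block_dataS xa (ltn_ord j)).
- move=> i bi; have [j] : exists j : 'I_(k + n).+1, qq j * a j i != 0.
    apply: contrapT => /forallNP h; case/eqP: bi; apply: big1 => j _.
    by apply/eqP/negPn/negP; exact: h.
  rewrite mulf_eq0 negb_or => /andP[qj /asep /andP[h1 h2]].
  rewrite (leq_trans h2 (block_dataS xa (ltn_ord j))) andbT.
  apply: leq_trans h1; apply: (block_dataS xa); rewrite leqNgt.
  by apply: contra qj => /qqk ->.
- split; first by rewrite ltnS leq_addr.
  have ww0 : `|w - w0| = `|1 - `|w0| |.
    have -> : w - w0 = (`|w0|^-1 - 1) *: w0 by rewrite scalerBl scale1r.
    rewrite normrZ -{2}[`|w0|]normr_id -normrM.
    by rewrite mulrBl mulVf ?gt_eqF // mul1r.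
  have : `|w - w0| <= 2 * eta by rewrite ww0 ler_norml; apply/andP; split; lra.
  by have := ler_distD w0 w z; rewrite [`|w0 - z|]distrC; lra.
Qed.

Lemma block_approx e F x c B (C : R) (Z : set E) k :
  block_scalars e F -> block_sequence e F x -> basic_sequence x c B -> 0 < C ->
  linear_subspace Z -> Z `<=` closed_span (range x) -> ~ finite_dimensional Z ->
  exists z w : nat -> E, [/\ forall n, Z (z n),
    forall n, linear_span (x @` [set j | (k + n <= j)%N]) (w n),
    block_sequence e F w & forall n, C * \sum_(j < n) `|z j - w j| <= 2^-1 ].
Proof.
move=> eF /block_sequence_data [a [s xa]] xc C0 lZ Zx nZ.
(* These errors sum to at most half of [C^-1], the smallness that [equivn_perturb] asks for. *)
pose d n : R := C^-1 * 2^-1 ^+ n.+2.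
have d0 n : 0 < d n by rewrite mulr_gt0 ?invr_gt0 // exprn_gt0 // invr_gt0.
have /choice [f fP] : forall p : nat * nat, exists q : E * E * (nat -> R) * nat,
    [/\ Z q.1.1.1, linear_span (x @` [set n | (p.1 <= n)%N]) q.1.1.2,
    is_block e F q.1.2 q.1.1.2, forall i, q.1.2 i != 0 -> (s p.1 <= i < s q.2)%N
    & (p.1 < q.2)%N /\ `|q.1.1.2 - q.1.1.1| <= d p.2].
  move=> [m n]; have [z [w [b [k' h]]]] := block_near m eF xa xc lZ Zx nZ (d0 n).
  by exists (z, w, b, k').
pose t := fix t n := if n is n'.+1 then (f (t n', n')).2 else k.
have kt n : (k + n <= t n)%N.
  elim: n => [|n IHn]; first by rewrite addn0.
  by have [_ _ _ _ [h _]] := fP (t n, n); rewrite addnS; exact: leq_ltn_trans h.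
exists (fun n => (f (t n, n)).1.1.1), (fun n => (f (t n, n)).1.1.2); split.
- by move=> n; have [] := fP (t n, n).
- move=> n; have [_ + _ _ _] := fP (t n, n); apply: linear_spanS.
  by move=> _ [i /= ti <-]; exists i => //=; exact: leq_trans ti.
- exists (fun n => (f (t n, n)).1.2); split=> [n|n i j h1 h2].
    by have [] := fP (t n, n).
  have [_ _ _ /(_ _ h1) /andP[_ h3] _] := fP (t n, n).
  have [_ _ _ /(_ _ h2) /andP[h4 _] _] := fP (t n.+1, n.+1).
  exact: leq_trans h3 h4.
- move=> n; rewrite -ler_pdivlMl // .
  apply: (@le_trans _ _ (C^-1 * (2^-1 - 2^-1 ^+ n.+1))); last first.
    by rewrite ler_pM2l ?invr_gt0 // gerBl exprn_ge0 // invr_ge0.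
  elim: n => [|n IHn]; first by rewrite big_ord0 expr1 subrr mulr0.
  have [_ _ _ _ [_]] := fP (t n, n); rewrite distrC big_ord_recr /= /d.
  by move: IHn; rewrite !exprS; set y := _ ^+ n; set u := C^-1; lra.
Qed.

End BlockNear.

(** * Sequence spaces *)

(* [sn n a] is the norm of the sum of the [a i *: e i] for [i < n]. *)
Record seqnorm (R : realType) := SeqNorm {
  sn :> nat -> (nat -> R) -> R;
  sn_const : R;
  sn_triangle : forall n a b, sn n (fun i => a i + b i) <= sn n a + sn n b;
  snZ : forall n (r : R) a, sn n (fun i => r * a i) = `|r| * sn n a;
  sn_mono : forall n a, sn n a <= sn n.+1 a;
  sn_stable : forall n a, a n = 0 -> sn n.+1 a <= sn n a;
  sn_ub : forall n a, sn n a <= \sum_(i < n) `|a i|;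
  sn_lb : forall n a i, (i < n)%N -> `|a i| <= sn_const * sn n a;
  sn_delta : forall n i, (i < n)%N -> 1 <= sn n (fun j => (j == i)%:R) }.

Section SequenceSpace.
Context {R : realType} (q : seqnorm R).
Implicit Types (a b : nat -> R).

Definition trunc n a : nat -> R := fun i => if (i < n)%N then a i else 0.

(** Mere boundedness of the [q n a] could admit sequences outside the closed span of the unit
    vectors, as with the sup norm, and the unit vectors would not be a basis. *)
Definition finitely_approximable a : Prop := forall eps : R, 0 < eps ->
  exists N b, (forall i, (N <= i)%N -> b i = 0) /\
    forall n, q n (fun i => a i - b i) <= eps.

Lemma sn0 n : q n (fun=> 0) = 0.
Proof.
by rewrite (_ : (fun=> 0) = (fun i => 0 * 0)) ?snZ ?normr0 ?mul0r.
Qed.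

Lemma snN n a : q n (fun i => - a i) = q n a.
Proof.
rewrite (_ : (fun i => - a i) = (fun i => -1 * a i)) ?snZ ?normrN1 ?mul1r //.
by apply/funext => i; rewrite mulN1r.
Qed.

Lemma snB n a b : q n (fun i => a i - b i) <= q n a + q n b.
Proof. by rewrite -[q n b]snN; exact: sn_triangle. Qed.

Lemma sn_dist n a b c :
  q n (fun i => a i - c i) <= q n (fun i => a i - b i) + q n (fun i => b i - c i).
Proof.
rewrite (_ : (fun i => a i - c i) = (fun i => (a i - b i) + (b i - c i))).
  exact: sn_triangle.
by apply/funext => i; rewrite addrA subrK.
Qed.

Lemma sn_ge0 n a : 0 <= q n a.
Proof.
have := snB n a a; rewrite (_ : (fun i => _) = (fun=> 0)) ?sn0; last first.
  by apply/funext => i; rewrite subrr.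
lra.
Qed.

Lemma sn_le m n a : (m <= n)%N -> q m a <= q n a.
Proof.
move=> /subnKC <-; elim: (n - m)%N => [|k IHk]; first by rewrite addn0.
by rewrite addnS (le_trans IHk) // sn_mono.
Qed.

Lemma eq_sn n a b : (forall i, (i < n)%N -> a i = b i) -> q n a = q n b.
Proof.
have le c d : (forall i, (i < n)%N -> c i = d i) -> q n c <= q n d.
  move=> cd; have := sn_triangle q n (fun i => c i - d i) d.
  rewrite (_ : (fun i => _) = c); last by apply/funext => i; rewrite subrK.
  have := sn_ub q n (fun i => c i - d i); rewrite big1; first lra.
  by move=> i _; rewrite cd // subrr normr0.
by move=> ab; apply/eqP; rewrite eq_le !le // => i i_n; rewrite ab.
Qed.

Lemma sn_trunc m n a : (m <= n)%N -> q n (trunc m a) = q m a.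
Proof.
move=> mn; rewrite -(@eq_sn m (trunc m a)); last by move=> i im; rewrite /trunc im.
apply/eqP; rewrite eq_le [_ <= q n _]sn_le // andbT -(subnKC mn).
elim: (n - m)%N => [|k IHk]; first by rewrite addn0.
rewrite addnS (le_trans _ IHk) // sn_stable // /trunc.
by rewrite ltnNge leq_addr.
Qed.

Lemma sn_trunc_le m n a : q n (trunc m a) <= q n a.
Proof.
have [mn|nm] := leqP m n; first by rewrite sn_trunc // sn_le.
by rewrite le_eqVlt (@eq_sn n _ a) ?eqxx // => i i_n; rewrite /trunc (ltn_trans i_n).
Qed.

Lemma finitely_approximable_tail a : finitely_approximable a ->
  forall eps : R, 0 < eps ->
  exists N, forall m n, (N <= m)%N -> q n (fun i => a i - trunc m a i) <= eps.
Proof.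
move=> fa eps eps0; have [N [b [bN ab]]] := fa _ (divr_gt0 eps0 (ltr0n _ 2)).
exists N => m n Nm.
rewrite (_ : (fun i => _) = (fun i => (a i - b i) - trunc m (fun i => a i - b i) i)).
  have := snB n (fun i => a i - b i) (trunc m (fun i => a i - b i)).
  have := sn_trunc_le m n (fun i => a i - b i); have := ab n; lra.
apply/funext => i; rewrite /trunc; case: ltnP => im; first by rewrite !subrr.
by rewrite bN ?subr0 // (leq_trans Nm).
Qed.

Lemma finitely_approximable_bounded a : finitely_approximable a ->
  exists D : R, forall n, q n a <= D.
Proof.
move=> fa; have [N aN] := finitely_approximable_tail fa ltr01.
exists (1 + q N a) => n; have := sn_dist n a (trunc N a) (fun=> 0).
rewrite (_ : (fun i => a i - 0) = a); last by apply/funext => i; rewrite subr0.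
rewrite (_ : (fun i => _ - 0) = trunc N a); last by apply/funext => i; rewrite subr0.
have := aN N n (leqnn N).
have : q n (trunc N a) <= q N a.
  have [Nn|nN] := leqP N n; first by rewrite sn_trunc.
  by rewrite (le_trans (sn_trunc_le _ _ _)) // sn_le // ltnW.
lra.
Qed.

Lemma finitely_approximable0 : finitely_approximable (fun=> 0).
Proof.
move=> eps eps0; exists 0%N, (fun=> 0); split=> // n.
by rewrite (_ : (fun=> _) = (fun=> 0)) ?sn0 ?ltW //; apply/funext => i; rewrite subr0.
Qed.

Lemma finitely_approximableD a b : finitely_approximable a ->
  finitely_approximable b -> finitely_approximable (fun i => a i + b i).
Proof.
move=> fa fb eps eps0.
have [N [a' [aN aa]]] := fa _ (divr_gt0 eps0 (ltr0n _ 2)).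
have [M [b' [bM bb]]] := fb _ (divr_gt0 eps0 (ltr0n _ 2)).
exists (maxn N M), (fun i => a' i + b' i); split=> [i|n].
  by rewrite geq_max => /andP[h1 h2]; rewrite aN // bM // addr0.
rewrite (_ : (fun i => _) = (fun i => (a i - a' i) + (b i - b' i))).
  have := sn_triangle q n (fun i => a i - a' i) (fun i => b i - b' i).
  by have := aa n; have := bb n; lra.
by apply/funext => i; rewrite opprD addrACA.
Qed.

Lemma finitely_approximableZ (r : R) a : finitely_approximable a ->
  finitely_approximable (fun i => r * a i).
Proof.
move=> fa eps eps0; have r1 : 0 < 1 + `|r| by rewrite ltr_pwDl.
have [N [b [bN ab]]] := fa _ (divr_gt0 eps0 r1).
exists N, (fun i => r * b i); split=> [i /bN ->|n]; first by rewrite mulr0.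
rewrite (_ : (fun i => _) = (fun i => r * (a i - b i))); last first.
  by apply/funext => i; rewrite mulrBr.
rewrite snZ; have := ab n; rewrite ler_pdivlMr // mulrDr mulr1 mulrC.
by have := sn_ge0 n (fun i => a i - b i); lra.
Qed.

Lemma finitely_approximableN a : finitely_approximable a ->
  finitely_approximable (fun i => - a i).
Proof.
move=> fa; rewrite (_ : (fun i => _) = (fun i => -1 * a i)).
  exact: finitely_approximableZ.
by apply/funext => i; rewrite mulN1r.
Qed.

Record xspace := XSpace { xval : nat -> R; xvalP : finitely_approximable xval }.

Lemma xspace_eq (x y : xspace) : xval x =1 xval y -> x = y.
Proof.
case: x y => [a fa] [b fb] /= /funext ab; subst b; congr XSpace.
exact: Prop_irrelevance.
Qed.

HB.instance Definition _ := gen_eqMixin xspace.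
HB.instance Definition _ := gen_choiceMixin xspace.

Definition xzero := XSpace finitely_approximable0.
Definition xadd x y := XSpace (finitely_approximableD (xvalP x) (xvalP y)).
Definition xopp x := XSpace (finitely_approximableN (xvalP x)).
Definition xscale r x := XSpace (finitely_approximableZ r (xvalP x)).

Let xaddA : associative xadd.
Proof. by move=> x y z; apply: xspace_eq => i; exact: addrA. Qed.
Let xaddC : commutative xadd.
Proof. by move=> x y; apply: xspace_eq => i; exact: addrC. Qed.
Let xadd0 : left_id xzero xadd.
Proof. by move=> x; apply: xspace_eq => i; exact: add0r. Qed.
Let xaddN : left_inverse xzero xopp xadd.
Proof. by move=> x; apply: xspace_eq => i; exact: addNr. Qed.

HB.instance Definition _ := GRing.isZmodule.Build xspace xaddA xaddC xadd0 xaddN.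

Let xscaleA r s x : xscale r (xscale s x) = xscale (r * s) x.
Proof. by apply: xspace_eq => i; exact: mulrA. Qed.
Let xscale1 : left_id 1 xscale.
Proof. by move=> x; apply: xspace_eq => i; exact: mul1r. Qed.
Let xscaleDr : right_distributive xscale +%R.
Proof. by move=> r x y; apply: xspace_eq => i; exact: mulrDr. Qed.
Let xscaleDl x : {morph xscale^~ x : r s / r + s}.
Proof. by move=> r s; apply: xspace_eq => i; exact: mulrDl. Qed.

HB.instance Definition _ := GRing.Zmodule_isLmodule.Build R xspace
  xscaleA xscale1 xscaleDr xscaleDl.

Definition xnorm (x : xspace) : R := sup (range (fun n => q n (xval x))).

Lemma xnorm_ub (x : xspace) n : q n (xval x) <= xnorm x.
Proof.
apply: ub_le_sup; last by exists n.
have [D xD] := finitely_approximable_bounded (xvalP x).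
by exists D => _ [k _ <-].
Qed.

Lemma xnorm_le (x : xspace) (D : R) : (forall n, q n (xval x) <= D) -> xnorm x <= D.
Proof.
move=> xD; apply: ge_sup; first by exists (q 0%N (xval x)), 0%N.
by move=> _ [n _ <-].
Qed.

Let xnormD x y : xnorm (x + y) <= xnorm x + xnorm y.
Proof.
apply: xnorm_le => n; rewrite (le_trans (sn_triangle _ _ _ _)) //.
by rewrite lerD // xnorm_ub.
Qed.

Let xnormZ (r : R) x : xnorm (r *: x) = `|r| * xnorm x.
Proof.
have le s y : xnorm (s *: y) <= `|s| * xnorm y.
  by apply: xnorm_le => n; rewrite snZ ler_wpM2l // xnorm_ub.
apply/eqP; rewrite eq_le le /=; have [->|r0] := eqVneq r 0.
  by rewrite normr0 mul0r; apply: le_trans (xnorm_ub _ 0%N); exact: sn_ge0.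
have := le r^-1 (r *: x); rewrite scalerA mulVf // scale1r normfV.
by rewrite -ler_pdivrMl ?invr_gt0 ?normr_gt0 // invrK.
Qed.

Let xnorm0_eq0 x : xnorm x = 0 -> x = 0.
Proof.
move=> x0; apply: xspace_eq => i; apply/eqP; rewrite -normr_le0.
have := sn_lb q (xval x) (ltnSn i); have := xnorm_ub x i.+1; rewrite x0 => h1.
have -> : q i.+1 (xval x) = 0 by apply/eqP; rewrite eq_le h1 sn_ge0.
by rewrite mulr0.
Qed.

HB.instance Definition _ := Lmodule_isNormed.Build R xspace xnormD xnormZ xnorm0_eq0.

Lemma xval_sub (x y : xspace) : xval (x - y) = fun i => xval x i - xval y i.
Proof. by []. Qed.

Lemma xval_add (x y : xspace) : xval (x + y) = fun i => xval x i + xval y i.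
Proof. by []. Qed.

Lemma xval_scale r (x : xspace) : xval (r *: x) = fun i => r * xval x i.
Proof. by []. Qed.

Lemma xnormE (x : xspace) : `|x| = xnorm x. Proof. by []. Qed.

Let xcomplete (F : set_system xspace) : ProperFilter F -> cauchy F -> cvg F.
Proof.
move=> FF /cauchyP Fc.
have p2 k : (0 : R) < 2^-1 ^+ k by rewrite exprn_gt0 // invr_gt0.
(* The Cauchy filter is replaced by a sequence with geometric errors. It converges coordinatewise,
   and its estimates pass to the limit because each [q n] depends on finitely many coordinates. *)
have /choice [x xF] : forall k : nat, exists x, F (ball x (2^-1 ^+ k : R)).
  by move=> k; exact: Fc.
have xkl k l : (k <= l)%N -> `|x k - x l| <= 2 * 2^-1 ^+ k.
  move=> kl; have [y []] := filter_ex (filterI (xF k) (xF l)).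
  rewrite -!ball_normE /= => h1 h2; have := ler_distD y (x k) (x l).
  rewrite [`|y - x l|]distrC.
  have : (2^-1 : R) ^+ l <= 2^-1 ^+ k.
    by rewrite ler_wiXn2l // ?invr_ge0 // invf_le1 // ler1n.
  by lra.
have sD k l n : (k <= l)%N ->
    q n (fun i => xval (x k) i - xval (x l) i) <= 2 * 2^-1 ^+ k.
  by move=> kl; rewrite -xval_sub (le_trans (xnorm_ub _ _)) // -xnormE xkl.
pose D := sn_const q * 2.
have xi i k l : (k <= l)%N -> `|xval (x k) i - xval (x l) i| <= `|D| * 2^-1 ^+ k.
  move=> kl; have := sn_lb q (fun i => xval (x k) i - xval (x l) i) (ltnSn i).
  move=> /le_trans; apply; apply: le_trans (ler_norm _) _.
  rewrite normrM [`|q _ _|]ger0_norm ?sn_ge0 // /D normrM normr_nat -mulrA.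
  by rewrite ler_wpM2l // sD.
have xcvg i : cvgn (fun k => xval (x k) i).
  apply: (@half_pow_cvg R R _ `|D|) => k; rewrite distrC; exact: xi.
pose a i := limn (fun k => xval (x k) i).
have ax n k : q n (fun i => xval (x k) i - a i) <= 2 * 2^-1 ^+ k.
  apply/ler_addgt0Pr => eps eps0.
  have [L hL] : exists L, forall l, (L <= l)%N ->
      \sum_(i < n) `|xval (x l) i - a i| <= eps.
    elim: n eps eps0 => [|n IHn] eps eps0.
      by exists 0%N => l _; rewrite big_ord0 ltW.
    have [L hL] := IHn _ (divr_gt0 eps0 (ltr0n _ 2)).
    have /cvgrPdist_lt /(_ _ (divr_gt0 eps0 (ltr0n _ 2))) [M _ hM] := xcvg n.
    exists (maxn L M) => l; rewrite geq_max => /andP[Ll Ml].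
    rewrite big_ord_recr /= (splitr eps) lerD ?hL // distrC.
    by apply: ltW; exact: hM.
  pose l := maxn k L; have kl : (k <= l)%N by rewrite leq_maxl.
  have hl := hL l (leq_maxr _ _).
  have := sn_dist n (xval (x k)) (xval (x l)) a; have := sD k l n kl.
  have := sn_ub q n (fun i => xval (x l) i - a i); lra.
have fa : finitely_approximable a.
  move=> eps eps0; have eps2 : 0 < eps / 2 by rewrite divr_gt0.
  have [k hk] := half_pow_small 2 eps2.
  have [N [b [bN xb]]] := xvalP (x k) eps2; exists N, b; split=> // n.
  have := sn_dist n a (xval (x k)) b; have := xb n; have := ax n k.
  rewrite -snN (_ : (fun i => - _) = (fun i => a i - xval (x k) i)); last first.
    by apply/funext => i; rewrite opprB.
  lra.
apply/cvg_ex; exists (XSpace fa); apply/cvgrPdist_lt => eps eps0.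
have eps3 : 0 < eps / 3 by rewrite divr_gt0.
have [k hk] := half_pow_small 1 eps3.
have xa : `|x k - XSpace fa| <= 2 * 2^-1 ^+ k by apply: xnorm_le => n; exact: ax.
apply: filterS (xF k) => y; rewrite -ball_normE /= => xy.
by have := ler_distD (x k) (XSpace fa) y; rewrite [`|XSpace fa - x k|]distrC; lra.
Qed.

HB.instance Definition _ := Uniform_isComplete.Build xspace xcomplete.

Lemma xdelta_subproof i : finitely_approximable (fun j => (j == i)%:R).
Proof.
move=> eps eps0; exists i.+1, (fun j => (j == i)%:R); split=> [j ij|n].
  by case: eqP => // ji; rewrite ji ltnn in ij.
rewrite (_ : (fun=> _) = (fun=> 0)) ?sn0 ?ltW //.
by apply/funext => j; rewrite subrr.
Qed.

Definition xdelta i : xspace := XSpace (xdelta_subproof i).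

Lemma xval_lcomb a n : xval (lcomb a xdelta n) = trunc n a.
Proof.
apply/funext => i; elim: n => [|n IHn]; first by rewrite /lcomb big_ord0.
rewrite lcombS xval_add IHn xval_scale /trunc /=.
have -> : (i < n.+1)%N = (i == n) || (i < n)%N by rewrite ltnS leq_eqVlt.
by case: eqP => [->|_] /=; rewrite ?ltnn ?mulr1 ?add0r // mulr0 addr0.
Qed.

Lemma xnorm_lcomb a n : `|lcomb a xdelta n| = q n a.
Proof.
rewrite xnormE; apply/eqP; rewrite eq_le; apply/andP; split.
  apply: xnorm_le => m; rewrite xval_lcomb.
  have [nm|mn] := leqP n m; first by rewrite sn_trunc.
  by rewrite (le_trans (sn_trunc_le _ _ _)) // sn_le // ltnW.
by rewrite -(sn_trunc a (leqnn n)) -xval_lcomb; exact: xnorm_ub.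
Qed.

Lemma norm_xdelta i : `|xdelta i| = 1.
Proof.
rewrite -(@lcomb_delta _ _ xdelta i i.+1) // xnorm_lcomb; apply/eqP.
rewrite eq_le sn_delta // andbT (le_trans (sn_ub _ _ _)) //.
rewrite (bigD1 (Ordinal (ltnSn i))) //= eqxx normr1 big1 ?addr0 // => j.
by rewrite -val_eqE /= => /negPf ->; rewrite normr0.
Qed.

Lemma xspace_tail (x : xspace) (eps : R) : 0 < eps ->
  exists N, forall m, (N <= m)%N -> `|x - lcomb (xval x) xdelta m| <= eps.
Proof.
move=> eps0; have [N hN] := finitely_approximable_tail (xvalP x) eps0.
exists N => m Nm; apply: xnorm_le => n; rewrite xval_sub xval_lcomb; exact: hN.
Qed.

Lemma xspace_expansion (x : xspace) : lcomb (xval x) xdelta @ \oo --> x.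
Proof.
apply/cvgrPdist_le => eps eps0.
by have [N hN] := xspace_tail x eps0; exists N.
Qed.

Lemma xdelta_normalised_basis : normalised_basis xdelta.
Proof.
split=> [n|x]; first exact: norm_xdelta.
have lE a : series (fun k => a k *: xdelta k) = lcomb a xdelta.
  by apply/funext => n; rewrite /lcomb seriesEord.
exists (xval x); split; first by rewrite lE; exact: xspace_expansion.
move=> b; rewrite lE => bx; apply/funext => i; apply/eqP.
rewrite -subr_eq0 -normr_le0; apply/ler_addgt0Pr => eps eps0; rewrite add0r.
have D1 : 0 < 1 + `|sn_const q| by rewrite ltr_pwDl.
have /cvgrPdist_lt /(_ _ (divr_gt0 eps0 D1)) [N _ hN] := bx.
have := hN (maxn N i.+1) (leq_maxl _ _); rewrite /= xnormE => h.
have := xnorm_ub (x - lcomb b xdelta (maxn N i.+1)) i.+1.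
rewrite xval_sub xval_lcomb => h2.
have := sn_lb q (fun j => xval x j - trunc (maxn N i.+1) b j) (ltnSn i).
rewrite /trunc leq_max ltnSn orbT => /le_trans; apply.
apply: le_trans (ler_norm _) _; rewrite normrM [`|q _ _|]ger0_norm ?sn_ge0 //.
apply: (@le_trans _ _ ((1 + `|sn_const q|) * (eps / (1 + `|sn_const q|)))).
  by apply: ler_pM; rewrite ?sn_ge0 ?ler_wpDl // (le_trans h2) // ltW.
by rewrite mulrC divfK // gt_eqF.
Qed.

Lemma xspace_not_fd : ~ finite_dimensional [set: xspace].
Proof.
apply: (@not_fd_biorthogonal _ _ _ xdelta (fun i x => xval x i)) => //.
exact/subspaceP.
Qed.

(** Tails of an element of [xspace] are small, so by the comparison of norms the series with the
    same coefficients in [E] is Cauchy; its sum defines the embedding. *)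
Lemma xspace_kembeds (E : completeNormedModType R) (x : nat -> E)
    (K : R) : 0 <= K ->
  (forall n a, q n a <= K * `|lcomb a x n| /\ `|lcomb a x n| <= K * q n a) ->
  kembeds K [set: xspace] (closed_span (range x)).
Proof.
move=> K0 qx.
have xcv (v : xspace) : cvgn (lcomb (xval v) x).
  apply: cauchy_seq_cvg => eps eps0.
  have K1 : 0 < 1 + K by rewrite ltr_pwDl.
  have [N hN] := finitely_approximable_tail (xvalP v) (divr_gt0 eps0 K1).
  exists N => n Nn.
  rewrite -(lcomb_trunc _ x Nn) -lcombB (le_lt_trans (qx _ _).2) //.
  rewrite (@le_lt_trans _ _ (K * (eps / (1 + K)))) ?ler_wpM2l ?hN //.
  by rewrite mulrA ltr_pdivrMr // mulrC ltr_pM2l // ltrDr.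
pose T (v : xspace) : E := limn (lcomb (xval v) x).
exists T; split.
- move=> r u v _ _; apply/cvg_lim => //.
  rewrite (_ : lcomb _ x = fun n => r *: lcomb (xval u) x n + lcomb (xval v) x n).
    by apply: cvgD; [apply: cvgZl_tmp|]; exact: xcv.
  by apply/funext => n; rewrite -lcombZ -lcombD.
- move=> v _; apply/closed_spanP => eps eps0.
  have /cvgrPdist_lt /(_ _ eps0) [N _ hN] := xcv v.
  exists (lcomb (xval v) x N); last exact: hN N (leqnn _).
  by apply/linear_span_rangeP; exists N, (xval v).
- move=> v _; split.
    apply: xnorm_le => m; apply/ler_addgt0Pr => eps eps0.
    have K1 : 0 < 1 + K by rewrite ltr_pwDl.
    have /cvgrPdist_lt /(_ _ (divr_gt0 eps0 K1)) [N _ hN] := xcv v.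
    have := hN (maxn N m) (leq_maxl _ _); rewrite /= => h.
    apply: le_trans (sn_le _ (leq_maxr N m)) _.
    apply: le_trans (qx _ _).1 _.
    apply: (@le_trans _ _ (K * (`|T v| + eps / (1 + K)))).
      rewrite ler_wpM2l //; have := ler_distD (T v) (lcomb (xval v) x (maxn N m)) 0.
      by rewrite !subr0 distrC -/(T v) in h *; lra.
    rewrite mulrDr lerD2l mulrA ler_pdivrMr // mulrC ler_pM2l // ler_wpDl //.
  rewrite -[T v]subr0; apply: (cvg_norm_bound (xcv v) (N := 0%N)) => n _.
  rewrite subr0 (le_trans (qx _ _).2) // ler_wpM2l //; exact: xnorm_ub.
Qed.

End SequenceSpace.

(** * Local minimality excludes tightness *)

(** Whatever the intervals, the tail past the one indexed by an integer above [K * K] avoids that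
    interval; the square is the price of [kembeds_embeds]. *)
Lemma uniform_embedding_not_tight (R : realType) (E Y : completeNormedModType R)
    (x : nat -> E) (K : R) : ~ finite_dimensional [set: Y] -> 0 <= K ->
  (forall m, kembeds K [set: Y] (closed_span (x @` [set n | (m <= n)%N]))) ->
  ~ tight_with_constants x.
Proof.
move=> nY K0 YK /(_ Y nY) [l [r [lr nE]]].
have KN : K * K <= (Num.bound (K * K))%:R by rewrite ltW // archi_boundP // mulr_ge0.
apply: (nE (Num.bound (K * K))).
apply: (@kembeds_embeds _ _ _ K) => //; first exact/subspaceP.
apply: kembedsS (YK (r (Num.bound (K * K))).+1); apply: closed_spanS.
move=> _ [i /= ri <-]; exists i => //=.
by rewrite negb_and -!ltnNge ri orbT.
Qed.

Section MaxPartialSums.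
Context {R : realType} {E : normedModType R}.
Variables (y : nat -> E) (C : R).
Hypotheses (y1 : forall i, `|y i| = 1)
  (yC : forall a j n, (j < n)%N -> `|a j| <= C * `|lcomb a y n|).

(** Norms of initial segments need not increase with their length, as [seqnorm] requires; their
    running maximum does, and for a basic sequence it exceeds the norm by a factor at most the basis
    constant. *)
Fixpoint max_partial n (a : nat -> R) : R :=
  if n is m.+1 then Num.max (max_partial m a) `|lcomb a y n| else 0.

Lemma max_partial_ge n a : `|lcomb a y n| <= max_partial n a.
Proof.
by case: n => [|n] /=; [rewrite /lcomb big_ord0 normr0|rewrite le_max lexx orbT].
Qed.

Lemma max_partial_ge0 n a : 0 <= max_partial n a.
Proof. exact: le_trans (max_partial_ge n a). Qed.

Lemma max_partial_le n a (D : R) : 0 <= D ->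
  (forall k, (k <= n)%N -> `|lcomb a y k| <= D) -> max_partial n a <= D.
Proof.
move=> D0; elim: n => [//|n IHn] aD /=.
by rewrite ge_max aD // IHn // => k kn; rewrite aD // ltnW.
Qed.

Lemma max_partial_mono n m a : (m <= n)%N -> max_partial m a <= max_partial n a.
Proof.
move=> /subnKC <-; elim: (n - m)%N => [|k IHk]; first by rewrite addn0.
by rewrite addnS /= le_max IHk.
Qed.

Lemma max_partial_ub k n a : (k <= n)%N -> `|lcomb a y k| <= max_partial n a.
Proof. by move=> kn; exact: le_trans (max_partial_ge k a) (max_partial_mono a kn). Qed.

Lemma coef_bound_ge0 : 0 <= C.
Proof.
have := yC (fun=> 1) (ltnSn 0); rewrite normr1 leNgt => h.
rewrite leNgt; apply: contra h => C0.
by rewrite (@le_lt_trans _ _ 0) // mulr_le0_ge0 // ltW.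
Qed.

Lemma max_partial_triangle n a b :
  max_partial n (fun i => a i + b i) <= max_partial n a + max_partial n b.
Proof.
apply: max_partial_le => [|k kn]; first by rewrite addr_ge0 // max_partial_ge0.
by rewrite lcombD (le_trans (ler_normD _ _)) // lerD // max_partial_ub.
Qed.

Lemma max_partialZ n (r : R) a :
  max_partial n (fun i => r * a i) = `|r| * max_partial n a.
Proof.
elim: n => [|n IHn] /=; first by rewrite mulr0.
by rewrite IHn lcombZ normrZ maxr_pMr.
Qed.

Lemma max_partial_ler n a : max_partial n a <= max_partial n.+1 a.
Proof. exact: max_partial_mono. Qed.

Lemma max_partial_stable n a : a n = 0 -> max_partial n.+1 a <= max_partial n a.
Proof.
by move=> an; rewrite /= ge_max lexx lcombS an scale0r addr0 max_partial_ge.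
Qed.

Lemma max_partial_sum n a : max_partial n a <= \sum_(i < n) `|a i|.
Proof.
apply: max_partial_le => [|k kn]; first exact: sumr_ge0.
rewrite (le_trans (ler_norm_sum _ _ _)) //.
rewrite (eq_bigr (fun i : 'I_k => `|a i|)) => [|i _]; last by rewrite normrZ y1 mulr1.
rewrite (big_ord_widen _ (fun i => `|a i|) kn) big_mkcond /=.
by apply: ler_sum => i _; case: ifP.
Qed.

Lemma max_partial_coef n a i : (i < n)%N -> `|a i| <= C * max_partial n a.
Proof.
move=> i_n; rewrite (le_trans (yC _ i_n)) // ler_wpM2l ?coef_bound_ge0 //.
exact: max_partial_ge.
Qed.

Lemma max_partial_delta n i : (i < n)%N -> 1 <= max_partial n (fun j => (j == i)%:R).
Proof.
move=> i_n; have := max_partial_ub (fun j => (j == i)%:R) i_n.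
by rewrite lcomb_delta // y1.
Qed.

Definition max_partial_seqnorm : seqnorm R :=
  SeqNorm max_partial_triangle max_partialZ max_partial_ler max_partial_stable
    max_partial_sum max_partial_coef max_partial_delta.

End MaxPartialSums.

Section LocallyMinimal.
Context {R : realType} {E : completeNormedModType R}.
Variables (x : nat -> E) (c : nat -> E -> R) (B : R).
Hypothesis xB : basic_sequence x c B.

Let B1 : 1 <= B. Proof. by case: xB. Qed.

Lemma bs_split N u v : linear_span (x @` [set j | (j < N)%N]) u ->
  linear_span (x @` [set j | (N <= j)%N]) v -> `|u| <= B * `|u + v|.
Proof.
move=> /linear_span_firstP [a uE] vN.
have cu i : (i < N)%N -> c i (u + v) = a i.
  move=> iN; rewrite (bsD xB) uE (bs_coef_lcomb xB) iN.
  rewrite (bs_coef_zero xB (D := [set j | (N <= j)%N]) (v := v)) ?addr0 //.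
    by rewrite /= leqNgt iN.
  exact: sub_closed_span.
have uE' : u = lcomb (c ^~ (u + v)) x N.
  by rewrite [LHS]uE; apply: eq_lcomb => i /cu ->.
rewrite {1}uE'.
have [_ _ _ _ + ] := xB; apply; apply: (subspaceD (closed_span_subspace _)).
  by rewrite uE; exact: bs_lcomb_mem.
by apply: sub_closed_span; apply: linear_spanS vN => _ [j _ <-]; exists j.
Qed.

Lemma bs_subsequence_coef (t : nat -> nat) n a j : (j < n)%N ->
  (forall i, (i < n)%N -> t i = t j -> i = j) ->
  `|a j| <= 2 * B * `|lcomb a (x \o t) n|.
Proof.
move=> jn tinj.
have mem : closed_span (range x) (lcomb a (x \o t) n).
  apply: (subspace_lcomb _ (closed_span_subspace _)) => i _.
  exact: bs_mem.
have := bs_coef_le xB (t j) mem.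
rewrite (bs_lcomb xB) (bigD1 (Ordinal jn)) //= (bs_delta xB) eqxx mulr1 big1 ?addr0 //.
move=> i ij; rewrite (bs_delta xB); case: eqP => [h|_]; last by rewrite mulr0.
by move: ij; rewrite -val_eqE /= (tinj i (ltn_ord i) (esym h)) eqxx.
Qed.

(** Local minimality is applied with the tail from [m] on as [Z]. A perturbation, which doubles the
    constant, replaces closed spans by finite combinations, so that the copy ends before some
    [N]. *)
Lemma tail_copy (K : R) (t : nat -> nat) m :
  (forall Z G : set E, Defs.subspace Z -> Z `<=` closed_span (range x) ->
     linear_subspace G -> finite_dimensional G -> G `<=` closed_span (range x) ->
     embeds K G Z) ->
  (forall i j, (i < m)%N -> (j < m)%N -> t i = t j -> i = j) ->
  exists N (u : nat -> E),
    (forall i, (i < m)%N -> linear_span (x @` [set j | (m <= j < N)%N]) (u i)) /\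
    equivn (Num.max 1 K * 2) m (x \o t) u.
Proof.
move=> xK tinj; set K1 := Num.max 1 K.
have K11 : 1 <= K1 by rewrite le_max lexx.
have K10 : 0 <= K1 by exact: le_trans K11.
have B0 : 0 <= B by exact: le_trans B1.
pose G := linear_span ((x \o t) @` [set i | (i < m)%N]).
have lG : linear_subspace G by exact: linear_span_subspace.
have Gx : G `<=` closed_span (range x).
  apply: linear_span_sub; first exact: closed_span_subspace.
  by move=> _ [i _ <-]; exact: bs_mem.
have [Zs Zc Zi] := bs_tail_subspace xB m.
have Zx : closed_span (x @` [set n | (m <= n)%N]) `<=` closed_span (range x).
  by apply: closed_spanS => _ [i _ <-]; exists i.
have := xK _ _ (bs_tail_subspace xB m) Zx lG (@finite_dimensional_span _ _ m _) Gx.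
move=> /(embeds_kembeds lG Zs) [T [lT TW TK]].
have Gy i : (i < m)%N -> G ((x \o t) i).
  by move=> im; apply: sub_linear_span; exists i.
have yT := equivn_lin lG lT TK Gy.
have yC a j : (j < m)%N -> `|a j| <= 2 * B * `|lcomb a (x \o t) m|.
  by move=> jm; apply: bs_subsequence_coef => // i im; exact: tinj.
have B20 : 0 <= 2 * B by rewrite mulr_ge0.
have TZ i : (i < m)%N -> closed_span (x @` [set n | (m <= n)%N]) ((T \o (x \o t)) i).
  by move=> im; apply: TW; exact: Gy.
have [u [uZ yu]] := equivn_closed_span B20 K10 yC TZ yT.
have [N uN] := linear_span_finite_support uZ; exists N, u; split=> // i im.
by apply: linear_spanS (uN i im) => _ [j [mj jN] <-]; exists j => //=; rewrite mj.
Qed.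

(** Course-of-values recursion. As [f] receives a function on all of [nat], the lower bound is
    stated at some [t'] that agrees with [t] on the values known so far. *)
Lemma strict_recursion (f : nat -> (nat -> nat) -> nat) :
  exists t : nat -> nat, (forall m, (t m < t m.+1)%N) /\
    forall m, exists t', (forall i, (i < m)%N -> t' i = t i) /\ (f m t' <= t m)%N.
Proof.
(* [g m] holds the values of [t] below [m]; [g k k.-1] is the last of them, or the default [0] when
   [k] is [0]. *)
pose g := fix g m : nat -> nat := if m is k.+1 then
  (fun i => if (i < k)%N then g k i else maxn (f k (g k)) (g k k.-1).+1) else (fun=> 0%N).
have gS m i : g m.+1 i = if (i < m)%N then g m i else maxn (f m (g m)) (g m m.-1).+1.
  by [].
pose t i := g i.+1 i.
have gt m i : (i < m)%N -> g m i = t i.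
  elim: m i => // m IHm i; rewrite ltnS leq_eqVlt => /orP[/eqP -> //|im].
  by rewrite gS im IHm.
exists t; split=> m.
  have -> : t m.+1 = maxn (f m.+1 (g m.+1)) (t m).+1 by rewrite /t gS ltnn.
  by rewrite leq_max leqnn orbT.
exists (g m); split=> [i|]; first exact: gt.
by rewrite /t gS ltnn leq_maxl.
Qed.

Lemma locally_minimal_not_tight :
  locally_minimal (closed_span (range x)) -> ~ tight_with_constants x.
Proof.
move=> [K xK]; set K2 := Num.max 1 K * 2.
have B0 : 0 <= B by exact: le_trans B1.
have K20 : 0 <= K2 by rewrite mulr_ge0 // le_max ler01.
have /choice [f fP] : forall p : nat * (nat -> nat), exists N,
    (forall i j, (i < p.1)%N -> (j < p.1)%N -> p.2 i = p.2 j -> i = j) ->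
    exists u : nat -> E,
    (forall i, (i < p.1)%N -> linear_span (x @` [set j | (p.1 <= j < N)%N]) (u i)) /\
    equivn K2 p.1 (x \o p.2) u.
  move=> [m t]; have [tinj|] := pselect (forall i j, (i < m)%N -> (j < m)%N ->
    t i = t j -> i = j); last by exists 0%N.
  by have [N [u h]] := tail_copy xK tinj; exists N => _; exists u.
have [t [tS tf]] := strict_recursion (fun m t => f (m, t)).
have tle i j : (i <= j)%N -> (t i <= t j)%N.
  move=> /subnKC <-; elim: (j - i)%N => [|k IHk]; first by rewrite addn0.
  by rewrite addnS (leq_trans IHk) // ltnW.
have tlt i j : (i < j)%N -> (t i < t j)%N.
  by move=> ij; apply: leq_trans (tS i) _; exact: tle.
have tinj i j : t i = t j -> i = j.
  move=> tij; case: (ltngtP i j) => // /tlt; rewrite tij ltnn //.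
pose y := x \o t.
have copy m : exists u : nat -> E,
    (forall i, (i < m)%N -> linear_span (x @` [set j | (m <= j < t m)%N]) (u i)) /\
    equivn K2 m y u.
  have [t' [t't ft]] := tf m.
  have [|u [uP yu]] := fP (m, t').
    by move=> i j im jm /=; rewrite !t't //; exact: tinj.
  exists u; split=> [i im|a].
    apply: linear_spanS (uP i im) => _ [j /= /andP[mj jt] <-]; exists j => //=.
    by rewrite mj (leq_trans jt).
  have := yu a; rewrite /y (@eq_lcombr _ _ a (x \o t) (x \o t')) // => i im /=.
  by rewrite t't.
have y1 i : `|y i| = 1 by exact: bs_norm xB _.
have yC a j n : (j < n)%N -> `|a j| <= 2 * B * `|lcomb a y n|.
  by move=> jn; apply: bs_subsequence_coef => // i _; exact: tinj.
pose q := max_partial_seqnorm y1 yC.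
have yfirst a n N : (forall i, (i < n)%N -> (t i < N)%N) ->
    linear_span (x @` [set j | (j < N)%N]) (lcomb a y n).
  move=> tN; apply: (subspace_lcomb _ (linear_span_subspace _)) => i i_n.
  by apply: sub_linear_span; exists (t i) => //; exact: tN.
have ylast a m k : linear_span (x @` [set j | (t m <= j)%N])
    (lcomb (fun i => a (m + i)%N) (fun i => y (m + i)%N) k).
  apply: (subspace_lcomb _ (linear_span_subspace _)) => i _.
  by apply: sub_linear_span; exists (t (m + i)%N) => //=; apply: tle; rewrite leq_addr.
have lsplit a (z : nat -> E) m n : (m <= n)%N -> lcomb a z n =
    lcomb a z m + lcomb (fun i => a (m + i)%N) (fun i => z (m + i)%N) (n - m).
  by move=> mn; rewrite -{1}(subnKC mn) /lcomb big_split_ord.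
have qB n a : q n a <= B * `|lcomb a y n|.
  apply: max_partial_le => [|k kn]; first by rewrite mulr_ge0.
  rewrite (lsplit a y k n kn); apply: (@bs_split (t k)) => //.
  by apply: yfirst => i; exact: tlt.
(* [K2 * B] pays for the exchanged initial part, [1 + B] for the common rest, and the outer factor
   for passing from the norm to [max_partial]. *)
pose L := B * (K2 * B + 1 + B).
have KL : K2 * B + 1 + B <= L.
  by rewrite /L ler_peMl // !addr_ge0 // mulr_ge0.
apply: (@uniform_embedding_not_tight R E (xspace q) x L (@xspace_not_fd _ q)) => [|m].
  by rewrite (le_trans _ KL) // !addr_ge0 // mulr_ge0.
have [u [uP yu]] := copy m.
(* The first [m] terms of [y] and their copy [u] both end before the index [t m], where the rest of
   [y] begins; so [bs_split] separates the rest from either of them with constant [B]. *)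
pose z i := if (i < m)%N then u i else y i.
have ztail : closed_span (range z) `<=` closed_span (x @` [set n | (m <= n)%N]).
  apply: closed_span_sub; [exact: closed_span_subspace|exact: closed_closed_span|].
  move=> _ [i _ <-]; apply: sub_closed_span; rewrite /z; case: ltnP => im.
    by apply: linear_spanS (uP i im) => _ [j /= /andP[mj _] <-]; exists j.
  apply: sub_linear_span; exists (t i) => //=; apply: leq_trans (im) _.
  elim: (i) => // j; move/leq_ltn_trans; apply; exact: tS.
apply: kembedsS ztail _; apply: xspace_kembeds => [|n a].
  by rewrite (le_trans _ KL) // !addr_ge0 // mulr_ge0.
have main : `|lcomb a y n| <= (K2 * B + 1 + B) * `|lcomb a z n| /\
    `|lcomb a z n| <= (K2 * B + 1 + B) * `|lcomb a y n|.
  have [mn|nm] := leqP m n; last first.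
    have [h1 h2] := yu (fun i => if (i < n)%N then a i else 0).
    have nm' := ltnW nm; rewrite !lcomb_trunc // in h1 h2.
    have zu : lcomb a z n = lcomb a u n.
      by apply: eq_lcombr => i i_n; rewrite /z (ltn_trans i_n nm).
    have K2L : K2 <= K2 * B + 1 + B.
      by have : K2 <= K2 * B by [rewrite ler_peMr]; lra.
    by rewrite zu; split; [apply: le_trans h1 _|apply: le_trans h2 _]; rewrite ler_wpM2r.
  rewrite (lsplit a y m n mn) (lsplit a z m n mn).
  have -> : lcomb a z m = lcomb a u m by apply: eq_lcombr => i im; rewrite /z im.
  rewrite (@eq_lcombr _ _ _ (fun i => z (m + i)%N) (fun i => y (m + i)%N)); last first.
    by move=> i _; rewrite /z ltnNge leq_addr.
  set v1 := lcomb a y m; set w1 := lcomb a u m; set v2 := lcomb _ _ _.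
  have v2t : linear_span (x @` [set j | (t m <= j)%N]) v2 by exact: ylast.
  have hv : `|v1| <= B * `|v1 + v2|.
    by apply: bs_split v2t; apply: yfirst => i; exact: tlt.
  have hw : `|w1| <= B * `|w1 + v2|.
    apply: bs_split v2t; apply: (subspace_lcomb _ (linear_span_subspace _)) => i im.
    by apply: linear_spanS (uP i im) => _ [j /= /andP[_ jt] <-]; exists j.
  have [h1 h2] := yu a; rewrite -/v1 -/w1 in h1 h2.
  have h3 : K2 * `|w1| <= K2 * (B * `|w1 + v2|) by rewrite ler_wpM2l.
  have h4 : K2 * `|v1| <= K2 * (B * `|v1 + v2|) by rewrite ler_wpM2l.
  have := ler_normD v1 v2; have := ler_normD w1 v2.
  have := ler_normB (v1 + v2) v1; have := ler_normB (w1 + v2) w1.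
  rewrite ![_ + v2 - _]addrAC !subrr !add0r !mulrDl !mul1r => *.
  by split; lra.
have [h1 h2] := main; split.
  by rewrite (le_trans (qB n a)) // /L -mulrA ler_wpM2l.
apply: le_trans h2 _; apply: ler_pM => //.
  by rewrite !addr_ge0 // mulr_ge0.
exact: max_partial_ge.
Qed.

End LocallyMinimal.

(** * The dichotomy *)

Section Stabilisation.
Context {R : realType} {E : completeNormedModType R}.
Implicit Types (e x y w : nat -> E) (F : {pred R}).

Definition list_embeds (K : R) n y (W : set E) : Prop :=
  exists u : nat -> E, (forall i, (i < n)%N -> W (u i)) /\ equivn K n y u.

Lemma list_embedsS (K : R) n y (W W' : set E) : W `<=` W' ->
  list_embeds K n y W -> list_embeds K n y W'.
Proof. by move=> WW' [u [uW yu]]; exists u; split=> // i /uW; exact: WW'. Qed.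

Lemma basis_block_sequence e F : normalised_basis e -> block_scalars e F ->
  block_sequence e F e.
Proof.
move=> [e1 _] eF; exists (fun n i => (i == n)%:R); split=> [n|n i j].
  split=> //.
    by move=> i; case: eqP => _; [exact: scalars1 eF|exact: scalars0 eF].
  exists n.+1 => [i ni|]; first by case: eqP => // ii; rewrite ii ltnn in ni.
  by rewrite -[LHS](lcomb_delta e (ltnSn n)).
by case: (i =P n) => [->|_]; case: (j =P n.+1) => [->|_]; rewrite ?eqxx.
Qed.

(** A block is coded by the list of codes of its coefficients in the countable [F]; a natural number
    as constant and a list of such lists again have a code. *)
Lemma block_lists_countable e F : block_scalars e F ->
  exists (K : nat -> nat) (n : nat -> nat) (v : nat -> nat -> E),
  forall (L N : nat) (y : nat -> E) (b : nat -> nat -> R),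
    (forall j, (j < N)%N -> is_block e F (b j) (y j)) ->
    exists k, [/\ K k = L, n k = N & forall j, (j < N)%N -> v k j = y j].
Proof.
move=> [_ /countable_injP [f finj] _ _].
pose phi m := xget 0 [set r : R | r \in F /\ f r = m].
have phiK r : r \in F -> phi (f r) = r.
  move=> Fr; rewrite /phi; case: xgetP => [r' _ [Fr' ff]|/(_ r) []//].
  by apply: finj; rewrite ?inE.
pose vec (l : seq nat) := lcomb (fun i => phi (nth 0%N l i)) e (size l).
pose dec k : nat * seq (seq nat) := odflt (0%N, [::]) (unpickle k).
exists (fun k => (dec k).1), (fun k => size (dec k).2).
exists (fun k j => vec (nth [::] (dec k).2 j)) => L N y b yb.
have /choice [m hm] : forall j, exists m, (j < N)%N -> y j = lcomb (b j) e m.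
  move=> j; have [jN|] := ltnP j N; last by exists 0%N.
  by have [_ _ [m _ ->]] := yb j jN; exists m.
exists (pickle (L, mkseq (fun j => mkseq (fun i => f (b j i)) (m j)) N)).
rewrite /dec pickleK /= size_mkseq; split=> // j jN.
rewrite nth_mkseq // /vec size_mkseq hm //; apply: eq_lcomb => i im.
by rewrite nth_mkseq // phiK //; have [+ _ _] := yb j jN; apply.
Qed.

(** For each coded pair in turn, either some further block sequence has no copy of the list in its
    span, and one passes to it, or all further block sequences have one. Both alternatives are
    inherited by further block sequences. *)
Lemma stabilised_block_sequence e F : normalised_basis e -> block_scalars e F ->
  exists x, block_sequence e F x /\
  forall (L N : nat) y (b : nat -> nat -> R),
    (forall j, (j < N)%N -> is_block e F (b j) (y j)) ->
    exists k, ~ list_embeds L%:R N y (linear_span (x @` [set n | (k.+1 <= n)%N])) \/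
      forall w, block_sequence e F w ->
        range w `<=` linear_span (x @` [set n | (k <= n)%N]) ->
        list_embeds L%:R N y (linear_span (range w)).
Proof.
move=> eB eF; have [K [n [v vP]]] := block_lists_countable eF.
pose P k W := list_embeds (K k)%:R (n k) (v k) W.
have /choice [f fP] : forall p : nat * (nat -> E), exists x', block_sequence e F p.2 ->
    [/\ block_sequence e F x', range x' `<=` linear_span (range p.2)
      & ~ P p.1 (linear_span (range x')) \/
        forall w, block_sequence e F w -> range w `<=` linear_span (range p.2) ->
          P p.1 (linear_span (range w))].
  move=> [k x] /=.
  have [[w [wb wx nP]]|h] := pselect (exists w, [/\ block_sequence e F w,
    range w `<=` linear_span (range x) & ~ P k (linear_span (range w))]).
    by exists w => _; split=> //; left.
  exists x => xb; split=> //; first exact: sub_linear_span.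
  by right=> w wb wx; apply: contrapT => nP; apply: h; exists w.
pose X := fix X k := if k is k'.+1 then f (k', X k') else e.
have Xb k : block_sequence e F (X k).
  elim: k => [|k IHk]; first exact: basis_block_sequence.
  by have [] := fP (k, X k) IHk.
have XS k l : (k <= l)%N -> range (X l) `<=` linear_span (range (X k)).
  move=> /subnKC <-; elim: (l - k)%N => [|m IHm].
    by rewrite addn0; exact: sub_linear_span.
  have [_ h _] := fP ((k + m)%N, X (k + m)%N) (Xb _); rewrite addnS.
  apply: subset_trans h _; apply: linear_span_sub => //.
  exact: linear_span_subspace.
have /choice [d dP] : forall k, exists d : (nat -> nat -> R) * (nat -> nat),
    block_data e F (X k) d.1 d.2.
  by move=> k; have [a [s h]] := block_sequence_data (Xb k); exists (a, s).
(* The next position is the end of the block just chosen. As the [m]-th block of any block sequence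
   starts at [m] or later, the diagonal has successive supports. *)
pose p := fix p k := if k is k'.+1 then (d k').2 (p k').+1 else 0%N.
pose x k := X k (p k).
have sk k m : (m <= (d k).2 m)%N.
  have [_ sS _ _] := dP k; elim: m => // m IHm; exact: leq_ltn_trans IHm (sS m).
exists x; split.
  exists (fun k => (d k).1 (p k)); split=> [k|k i j ai aj].
    by have [+ _ _ _] := dP k; apply.
  have [_ _ /(_ _ _ ai) /andP[_ h1] _] := dP k.
  have [_ _ /(_ _ _ aj) /andP[h2 _] _] := dP k.+1.
  by apply: leq_trans h1 (leq_trans _ h2); exact: (sk k.+1 (p k.+1)).
have xX k : linear_span (x @` [set j | (k <= j)%N]) `<=` linear_span (range (X k)).
  apply: linear_span_sub; first exact: linear_span_subspace.
  by move=> _ [j kj <-]; apply: (XS k j kj); exists (p j).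
move=> L N y b yb; have [k [KL nN vy]] := vP L N y b yb; exists k.
have Py W : P k W <-> list_embeds L%:R N y W.
  rewrite /P KL nN; split=> -[u [uW yu]]; exists u; split=> // a.
    by rewrite -(@eq_lcombr _ _ a (v k) y) //; exact: yu.
  by rewrite (@eq_lcombr _ _ a (v k) y) //; exact: yu.
(* Terms of [x] from [k] on come from [X k], before the pair [k] is treated, and those from [k.+1]
   on from [X k.+1], after it; hence the shift between the alternatives. *)
have [_ _ [nP|hP]] := fP (k, X k) (Xb k).
  left=> /(list_embedsS (xX k.+1)) /Py; exact: nP.
right=> w wb wx; apply/Py; apply: hP => //.
exact: subset_trans wx (xX k).
Qed.

Lemma not_fd_image (Y : normedModType R) (T : Y -> E) :
  linear_on setT T -> (forall u, T u = 0 -> u = 0) ->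
  ~ finite_dimensional [set: Y] -> ~ finite_dimensional (T @` [set: Y]).
Proof.
move=> lT Tinj nY /finite_dimensionalP [n [g Tg]]; apply: nY.
have lY : linear_subspace [set: Y] by apply/subspaceP.
have /choice [v vP] : forall i, exists v, (i < n)%N -> T v = g i.
  move=> i; have [i_n|] := ltnP i n; last by exists 0.
  have : (T @` [set: Y]) (g i) by rewrite Tg; apply: sub_linear_span; exists i.
  by case=> v _ Tv; exists v.
suff -> : [set: Y] = linear_span (v @` [set i | (i < n)%N]).
  exact: finite_dimensional_span.
apply/seteqP; split=> // u _; apply/linear_span_firstP.
have : (T @` [set: Y]) (T u) by exists u.
rewrite Tg => /linear_span_firstP [a Tu]; exists a.
apply/eqP; rewrite -subr_eq0; apply/eqP; apply: Tinj.
rewrite (linear_onB lT) // (linear_on_lcomb lY lT) // Tu.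
apply/eqP; rewrite subr_eq0; apply/eqP; apply: eq_lcombr => i i_n.
by rewrite /= vP.
Qed.

(** Copies are transported through [Y]: the blocks [y] are perturbed images of vectors of [Y], which
    another embedding sends into the given tail. Each perturbation contributes a factor [2] and each
    embedding a factor [K]. *)
Lemma not_tight_blocks e F x : normalised_basis e -> block_scalars e F ->
  block_sequence e F x -> ~ tight_with_constants x ->
  exists (K : R) y, [/\ 0 <= K, block_sequence e F y,
    forall n, linear_span (x @` [set j | (n <= j)%N]) (y n)
    & forall m N, list_embeds K N y (linear_span (x @` [set n | (m <= n)%N]))].
Proof.
move=> eB eF xb xnt; have [B eBc] := block_constant eB.
have [c xc] := eBc _ _ xb.
have B1 : 1 <= B by case: xc.
have B0 : 0 <= B by exact: le_trans B1.
have [Y [K [nY K1 YK]]] := not_tight_embeds xc xnt.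
have K0 : 0 <= K by exact: le_trans K1.
have lY : linear_subspace [set: Y] by apply/subspaceP.
have [T [lT TW TK]] := YK 0%N.
have C0 : 0 < 2 * B by rewrite mulr_gt0 // (lt_le_trans ltr01).
have [|||z [y [zT yx yb yz]]] :=
  @block_approx _ _ _ _ _ _ _ (2 * B) (T @` [set: Y]) 0 eF xb xc C0.
- exact: linear_on_image.
- by move=> _ [v _ <-]; apply: closed_spanS (TW v I) => _ [i _ <-]; exists i.
- apply: not_fd_image => // u Tu; apply/eqP; rewrite -normr_le0.
  by have [+ _] := TK u I; rewrite Tu normr0 mulr0.
have [c' yc] := eBc _ _ yb.
have yC n a j : (j < n)%N -> `|a j| <= 2 * B * `|lcomb a y n|.
  by move=> jn; exact: (bs_coef_lcomb_le yc).
have yzn n : equivn 2 n y z.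
  by apply: (equivn_perturb (yC n) (d := fun j => `|z j - y j|)).
have /choice [v vz] : forall n, exists v, T v = z n.
  by move=> n; have [v _ <-] := zT n; exists v.
have yv n : equivn (2 * K) n y v.
  apply: equivn_trans (yzn n) _ => //; apply: equivn_sym.
  have := @equivn_lin _ _ _ K n v setT T lY lT TK (fun _ _ => I).
  by move=> h a; rewrite (@eq_lcombr _ _ a z (T \o v)) // => i _; rewrite /= vz.
exists (2 * K * K * 2), y; split=> // [|m N]; first by rewrite !mulr_ge0.
have [S [lS SW SK]] := YK m.
have yS : equivn (2 * K * K) N y (S \o v).
  apply: equivn_trans (yv N) _ => //; first by rewrite mulr_ge0.
  exact: equivn_lin lY lS SK (fun _ _ => I).
apply: equivn_closed_span (yC N) _ yS => //; rewrite ?mulr_ge0 //.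
by move=> i _; exact: SW.
Qed.

(** The blocks [y] of [not_tight_blocks] exclude the first alternative of the stabilisation. So [G]
    is moved into the span of an initial segment of [y], this segment is copied into a block
    sequence [w] lying close to [Z], and [w] is moved into [Z]; the three maps have constants [2],
    [L] and [2]. *)
Lemma exists_tight_or_locally_minimal e F : normalised_basis e -> block_scalars e F ->
  exists x, block_sequence e F x /\
    (tight_with_constants x \/ locally_minimal (closed_span (range x))).
Proof.
move=> eB eF; have [B eBc] := block_constant eB.
have [x [xb xstab]] := stabilised_block_sequence eB eF.
have [xt|xnt] := pselect (tight_with_constants x); first by exists x; split=> //; left.
have [K2 [y [K20 yb yx yembeds]]] := not_tight_blocks eB eF xb xnt.
have [c' yc] := eBc _ _ yb.
have B1 : 1 <= B by case: yc.
have C0 : 0 < 2 * B by rewrite mulr_gt0 // (lt_le_trans ltr01).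
exists y; split=> //; right.
(* Only integer constants were stabilised. *)
pose L := Num.bound K2.
have K2L : K2 <= L%:R by rewrite ltW // archi_boundP.
exists ((2 * (L%:R * 2)) * (2 * (L%:R * 2))) => Z G [lZ _ nZ] Zy lG fG Gy.
apply: (@kembeds_embeds _ _ _ (2 * (L%:R * 2))) => //.
have [n [g [Gg gfree]]] := finite_dimensional_free fG.
have [c0 c00 gC] := free_coef_bound gfree.
have gG i : (i < n)%N -> closed_span (range y) (g i).
  by move=> i_n; apply: Gy; rewrite Gg; apply: sub_linear_span; exists i.
have gg : equivn 1 n g g by move=> a; rewrite mul1r.
have [u [uy gu]] := equivn_closed_span (ltW c00) ler01 gC gG gg.
rewrite mul1r in gu.
have [N uN] := linear_span_finite_support uy.
have yNb : exists b : nat -> nat -> R, forall j, (j < N)%N -> is_block e F (b j) (y j).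
  by have [b [hb _]] := yb; exists b => j _.
have [b hb] := yNb.
have [k [nk|hk]] := xstab L N y b hb.
  case: nk; have [u' [u'x yu']] := yembeds k.+1 N.
  by exists u'; split=> //; exact: equivn_le yu'.
have [z' [w [z'Z wy wb wz]]] := @block_approx _ _ _ _ _ _ _ (2 * B) Z k eF yb yc C0 lZ Zy nZ.
have [c'' wc] := eBc _ _ wb.
have wzn m : equivn 2 m w z'.
  apply: (equivn_perturb _ (d := fun j => `|z' j - w j|)) (wz m) => //.
  by move=> a j jm; exact: (bs_coef_lcomb_le wc).
have [|u' [u'w yu']] := hk w wb.
  move=> _ [i _ <-]; apply: linear_span_sub (wy i); first exact: linear_span_subspace.
  move=> _ [j /= kj <-]; apply: linear_spanS (yx j) => _ [m /= jm <-]; exists m => //=.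
  by rewrite (leq_trans (leq_trans _ kj) jm) // leq_addr.
have [M u'M] := linear_span_finite_support u'w.
have h1 : kembeds 2 G (linear_span (y @` [set j | (j < N)%N])).
  rewrite Gg; apply: equivn_kembeds gu (linear_span_subspace _) _ => i i_n.
  by apply: linear_spanS (uN i i_n) => _ [j [_ jN] <-]; exists j.
have h2 : kembeds L%:R (linear_span (y @` [set j | (j < N)%N]))
    (linear_span (w @` [set j | (j < M)%N])).
  apply: equivn_kembeds yu' (linear_span_subspace _) _ => i iN.
  by apply: linear_spanS (u'M i iN) => _ [j [_ jM] <-]; exists j.
have h3 : kembeds 2 (linear_span (w @` [set j | (j < M)%N])) Z.
  exact: equivn_kembeds (wzn M) lZ (fun i _ => z'Z i).
apply: kembeds_trans h1 _ => //; apply: kembeds_trans h2 h3 => //.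
Qed.

End Stabilisation.

(** * Block scalars, and a locally minimal example *)

Section ScalarsExist.
Context {R : realType} {E : completeNormedModType R} (e : nat -> E).

(** Terms for generating a field: label [0] is a difference, [1] a quotient, any other label the
    norm of a combination of [e]. The values have the closure properties by construction and are
    countable because trees are. *)
Fixpoint scalar_eval (t : GenTree.tree rat) : R :=
  match t with
  | GenTree.Leaf q => ratr q
  | GenTree.Node n l => let v := [seq scalar_eval s | s <- l] in
    if n == 0%N then v`_0 - v`_1 else if n == 1%N then v`_0 / v`_1
    else `|lcomb (nth 0 v) e (size v)|
  end.

Lemma block_scalars_exist : exists F : {pred R}, block_scalars e F.
Proof.
pose F : {pred R} := [pred r | `[< range scalar_eval r >]].
have FP r : r \in F <-> exists t, scalar_eval t = r.
  split=> [/asboolP [t _ tr]|[t tr]]; first by exists t.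
  by apply/asboolP; exists t.
exists F; split.
- split.
  + by apply/FP; exists (GenTree.Leaf 1); rewrite /= rmorph1.
  + move=> _ _ /FP [s <-] /FP [t <-]; apply/FP.
    by exists (GenTree.Node 0 [:: s; t]).
  + move=> _ _ /FP [s <-] /FP [t <-]; apply/FP.
    by exists (GenTree.Node 1 [:: s; t]).
- have -> : [set` F] = range scalar_eval.
    by apply/seteqP; split=> [r /FP [t <-]|r [t _ <-]]; [exists t|apply/FP; exists t].
  exact: card_le_trans (card_image_le _ _) (countableP _).
- by move=> q; apply/FP; exists (GenTree.Leaf q).
- move=> n a aF; apply/FP.
  have /choice [t tE] : forall i, exists t, scalar_eval t = a i.
    by move=> i; apply/FP; exact: aF.
  exists (GenTree.Node 2 (mkseq t n)); rewrite /= size_map size_mkseq.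
  congr `|_|; apply: eq_lcomb => i i_n.
  by rewrite (nth_map (GenTree.Leaf 0)) ?size_mkseq // nth_mkseq.
Qed.

End ScalarsExist.

Section EllOne.
Context {R : realType}.

Definition l1_partial n (a : nat -> R) : R := \sum_(i < n) `|a i|.

Lemma l1_partial_triangle n a b :
  l1_partial n (fun i => a i + b i) <= l1_partial n a + l1_partial n b.
Proof. by rewrite -big_split; apply: ler_sum => i _; exact: ler_normD. Qed.

Lemma l1_partialZ n (r : R) a : l1_partial n (fun i => r * a i) = `|r| * l1_partial n a.
Proof. by rewrite /l1_partial mulr_sumr; apply: eq_bigr => i _; exact: normrM. Qed.

Lemma l1_partial_mono n a : l1_partial n a <= l1_partial n.+1 a.
Proof. by rewrite /l1_partial big_ord_recr /= lerDl. Qed.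

Lemma l1_partial_stable n a : a n = 0 -> l1_partial n.+1 a <= l1_partial n a.
Proof. by move=> an; rewrite /l1_partial big_ord_recr /= an normr0 addr0. Qed.

Lemma l1_partial_coef n a i : (i < n)%N -> `|a i| <= 1 * l1_partial n a.
Proof.
by move=> i_n; rewrite mul1r /l1_partial (bigD1 (Ordinal i_n)) //= lerDl sumr_ge0.
Qed.

Lemma l1_partial_delta n i : (i < n)%N -> 1 <= l1_partial n (fun j => (j == i)%:R).
Proof.
move=> i_n; rewrite /l1_partial (bigD1 (Ordinal i_n)) //= eqxx normr1 lerDl.
exact: sumr_ge0.
Qed.

Definition l1_seqnorm : seqnorm R :=
  SeqNorm l1_partial_triangle l1_partialZ l1_partial_mono l1_partial_stable
    (fun n a => lexx _) l1_partial_coef l1_partial_delta.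

Local Notation l1 := (xspace l1_seqnorm).
Local Notation e := (@xdelta R l1_seqnorm).

Lemma l1_block_norm F (x : nat -> l1) : block_sequence e F x ->
  forall n a, `|lcomb a x n| = \sum_(i < n) `|a i|.
Proof.
move=> /block_sequence_data [b [s xb]] n a; have [bb sS bsep _] := xb.
elim: n => [|n IHn]; first by rewrite /lcomb !big_ord0 normr0.
rewrite big_ord_recr /= -IHn.
have [_ xn1 _] := bb n.
have -> : `|a n| = `|a n *: x n| by rewrite normrZ xn1 mulr1.
rewrite lcombS (block_lcomb a n xb) (block_expansion xb (ltnSn n)) -lcombZ.
set u := fun i => \sum_(j < n) _; set v := fun i => a n * _.
have sn := ltnW (sS n).
have u0 i : (s n <= i)%N -> u i = 0.
  move=> si; apply: big1 => j _; apply/eqP; rewrite mulf_eq0; apply/orP; right.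
  apply: contraTT si => /bsep /andP[_ h]; rewrite -ltnNge.
  exact: leq_trans h (block_dataS xb (ltn_ord j)).
have v0 i : (i < s n)%N -> v i = 0.
  move=> si; apply/eqP; rewrite mulf_eq0; apply/orP; right.
  by apply: contraTT si => /bsep /andP[h _]; rewrite -leqNgt.
rewrite (lcomb_widen e sn u0) -lcombD !xnorm_lcomb /= /l1_partial -big_split.
apply: eq_bigr => i _ /=; have [si|si] := ltnP i (s n).
  by rewrite v0 // addr0 normr0 addr0.
by rewrite u0 // add0r normr0 add0r.
Qed.

Lemma l1_block_not_tight F (x : nat -> l1) : block_sequence e F x ->
  ~ tight_with_constants x.
Proof.
move=> xb; apply: (@uniform_embedding_not_tight R _ l1 x 1 (@xspace_not_fd R _)) => // m.
have h : closed_span (range (fun i => x (m + i)%N)) `<=`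
    closed_span (x @` [set n | (m <= n)%N]).
  by apply: closed_spanS => _ [i _ <-]; exists (m + i)%N => //=; rewrite leq_addr.
apply: kembedsS h _; apply: xspace_kembeds => // n a.
pose a' i := if (i < m)%N then 0 else a (i - m)%N.
have -> : lcomb a (fun i => x (m + i)%N) n = lcomb a' x (m + n).
  rewrite lcomb_shift => [|i im]; last by rewrite /a' im.
  by apply: eq_lcomb => i _; rewrite /a' ltnNge leq_addr /= addKn.
rewrite (l1_block_norm xb) !mul1r.
suff -> : \sum_(i < m + n) `|a' i| = \sum_(i < n) `|a i| by [].
rewrite big_split_ord /= big1 ?add0r => [|i _]; last by rewrite /a' ltn_ord normr0.
by apply: eq_bigr => i _; rewrite /a' ltnNge leq_addr /= addKn.
Qed.

(** The dichotomy does the work: in l_1 it cannot return a tight block sequence. *)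
Lemma exists_locally_minimal : exists (E : completeNormedModType R) (e : nat -> E)
    (F : {pred R}) (x : nat -> E),
  [/\ ~ finite_dimensional [set: E], normalised_basis e, block_scalars e F,
      block_sequence e F x & locally_minimal (closed_span (range x))].
Proof.
have [F eF] := block_scalars_exist e.
have eB := xdelta_normalised_basis l1_seqnorm.
have [x [xb [/(l1_block_not_tight xb) //|xm]]] := exists_tight_or_locally_minimal eB eF.
by exists l1, e, F, x; split=> //; exact: xspace_not_fd.
Qed.

End EllOne.

(** * Norming functionals of the modified Tsirelson space *)

Section Norming.
Context {R : realType}.
Implicit Types (f g w : nat -> R).

(* The norming functionals of the modified Tsirelson space, restricted to its positive
   cone: bounding a node by the maximum of its children, instead of taking their sum,
   makes the disjointness of their supports unnecessary. *)
Inductive norming : (nat -> R) -> Prop :=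
| norming_leaf f n : (forall k, 0 <= f k <= 1) -> (forall k, k != n -> f k = 0) ->
    norming f
| norming_node f N (g : nat -> nat -> R) : (forall i, (i < N)%N -> norming (g i)) ->
    (forall i k, (i < N)%N -> (k < N)%N -> g i k = 0) -> (forall k, 0 <= f k) ->
    (forall k, f k = 0 \/ exists2 i, (i < N)%N & f k <= 2^-1 * g i k) -> norming f.

Lemma norming_itv f : norming f -> forall k, 0 <= f k <= 1.
Proof.
elim=> // {}f N g _ IHg _ f0 fg k; rewrite f0 /=.
have [->//|[i iN /le_trans]] := fg k; apply.
by have /andP[_] := IHg i iN k; lra.
Qed.

Lemma norming_ge0 f k : norming f -> 0 <= f k.
Proof. by move=> /norming_itv /(_ k) /andP[]. Qed.

Lemma norming_le f g : norming f -> (forall k, 0 <= g k <= f k) -> norming g.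
Proof.
case=> {}f.
  move=> n f1 fn gf; apply: (@norming_leaf _ n) => k.
    have /andP[-> /= h] := gf k; rewrite (le_trans h) //.
    by have /andP[] := f1 k.
  by move=> /fn fk; have := gf k; rewrite fk => h; apply/eqP; rewrite eq_le andbC.
move=> N h hN hs f0 fh gf; apply: (@norming_node _ N h) => // k.
  by have /andP[] := gf k.
have /andP[g0 gk] := gf k; have [fk|[i iN fk]] := fh k; last first.
  by right; exists i => //; exact: le_trans fk.
by left; apply/eqP; rewrite eq_le g0 andbT -fk.
Qed.

Lemma norming0 : norming (fun=> 0).
Proof. by apply: (@norming_leaf _ 0) => // k; rewrite lexx ler01. Qed.

(** A node with [N] children vanishes below [N], so if it meets the coordinates below [P] it has
    fewer than [P] children; a leaf meeting them vanishes from [P] on. Missing children are filled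
    with zero. *)
Lemma norming_children g P k' : norming g -> (k' < P)%N -> g k' != 0 ->
  exists G : nat -> nat -> R, (forall l, norming (G l)) /\
    forall k, (P <= k)%N -> g k = 0 \/ exists2 l, (l < P)%N & g k <= 2^-1 * G l k.
Proof.
case=> {}g.
  move=> n _ gn kP gk; exists (fun=> fun=> 0); split=> [l|k Pk]; first exact: norming0.
  left; apply: (gn); apply: contraNneq gk => kn; apply/eqP; apply: gn.
  by rewrite -kn ltn_eqF // (leq_trans kP).
move=> N h hN hs g0 gh kP gk.
have NP : (N < P)%N.
  apply: leq_trans kP; rewrite ltnS leqNgt; apply: contra gk => kN.
  have [->//|[i iN]] := gh k'; rewrite hs // mulr0 => h0.
  by rewrite eq_le h0 g0.
exists (fun l => if (l < N)%N then h l else fun=> 0); split=> [l|k Pk].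
  by case: ifP => [/hN//|_]; exact: norming0.
have [->|[i iN hi]] := gh k; first by left.
by right; exists i; [exact: ltn_trans NP|rewrite iN].
Qed.

Lemma sum_unique_le1 n (p : pred nat) :
  (forall i j, p i -> p j -> i = j) -> (\sum_(i < n) (p i : nat) <= 1)%N.
Proof.
move=> pu; elim: n => [|n IHn]; first by rewrite big_ord0.
rewrite big_ord_recr /=; have [pn|_] := boolP (p n); last by rewrite addn0.
rewrite big1 // => i _; case: (boolP (p i)) => // pi.
by have := ltn_ord i; rewrite (pu _ _ pi pn) ltnn.
Qed.

Definition pairing f w M := \sum_(k < M) f k * w k.

Lemma pairing_disjoint f w M : (forall k, f k = 0 \/ w k = 0) -> pairing f w M = 0.
Proof. by move=> fw; apply: big1 => k _; case: (fw k) => ->; rewrite ?mul0r ?mulr0. Qed.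

Section SpreadAverage.
Variables (w : nat -> nat -> R) (w0 : nat -> R) (E start : nat -> nat) (k0 : nat)
  (lam : R).
Hypotheses (k00 : (0 < k0)%N) (E0 : E 0%N = k0)
  (Estart : forall s, (k0 * E s <= start s)%N)
  (Emono : forall s, (start s <= E s.+1)%N)
  (w0_supp : forall k, (k0 <= k)%N -> w0 k = 0)
  (w_supp : forall s k, ~~ (start s <= k < E s.+1)%N -> w s k = 0)
  (w0_le : forall f M, norming f -> pairing f w0 M <= lam)
  (w_le : forall s f M, norming f -> pairing f (w s) M <= lam).

Let lam0 : 0 <= lam.
Proof. by have := w0_le 0 norming0; rewrite /pairing big_ord0. Qed.

Let E_start s : (E s <= start s)%N.
Proof. by apply: leq_trans (Estart s); rewrite leq_pmull. Qed.

Let E_le s t : (s <= t)%N -> (E s <= E t)%N.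
Proof.
move=> /subnKC <-; elim: (t - s)%N => [|m IHm]; first by rewrite addn0.
by rewrite addnS (leq_trans IHm) // (leq_trans (E_start _)).
Qed.

(** The support of each child begins in at most one interval from [E s] to [E s.+1], so the number
    of exceptional blocks is at most the number of children. *)
Let first_met (g : nat -> nat -> R) j s :=
  `[< (forall k, (k < E s)%N -> g j k = 0) /\ exists2 k, (k < E s.+1)%N & g j k != 0 >].

Let first_met_uniq (g : nat -> nat -> R) j s t : first_met g j s -> first_met g j t -> s = t.
Proof.
have lt a b : first_met g j a -> first_met g j b -> ~~ (a < b)%N.
  move=> /asboolP [_ [k kE gk]] /asboolP [g0 _]; apply/negP => ab.
  by rewrite g0 ?eqxx // in gk; exact: leq_trans kE (E_le ab).
by move=> hs ht; apply/eqP; rewrite eqn_leq leqNgt lt // leqNgt lt.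
Qed.

(* If every child of the root meeting the s-th block also meets an earlier one, then
   these children have at most E s children each, so there are few enough
   grandchildren to be the children of a single node past start s: one level of
   the tree, hence one factor 1/2, is saved. *)
Let old_pairing f N (g : nat -> nat -> R) s M : (N <= k0)%N ->
  (forall i, (i < N)%N -> norming (g i)) -> (forall k, 0 <= f k) ->
  (forall k, f k = 0 \/ exists2 i, (i < N)%N & f k <= 2^-1 * g i k) ->
  (forall j, (j < N)%N -> ~~ first_met g j s) ->
  pairing f (w s) M <= 2^-1 * lam.
Proof.
move=> Nk0 gN f0 fg old; set P := E s.
have /choice [G GP] : forall j, exists G : nat -> nat -> R, (forall l, norming (G l)) /\
    ((j < N)%N -> (exists2 k', (k' < P)%N & g j k' != 0) ->
      forall k, (P <= k)%N -> g j k = 0 \/ exists2 l, (l < P)%N & g j k <= 2^-1 * G l k).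
  move=> j; have [[jN [k' k'P gk']]|h] := pselect ((j < N)%N /\
      exists2 k', (k' < P)%N & g j k' != 0).
    by have [G [GN GE]] := norming_children (gN j jN) k'P gk'; exists G.
  by exists (fun=> fun=> 0); split=> [l|jN h']; [exact: norming0|case: h].
(* Doubling absorbs the deleted level: [f] is at most a quarter of a grandchild, so [2 * f] is at
   most half of one. *)
pose h k := if (start s <= k < E s.+1)%N then 2 * f k else 0.
have hN : norming h.
  (* The grandchild [l] of the child [j] gets the number [j * P + l]; it is admissible because
     [N * P <= k0 * E s <= start s]. *)
  apply: (@norming_node _ (N * P)
    (fun i k => if (start s <= k)%N then G (i %/ P)%N (i %% P)%N k else 0)).
  - move=> i _; apply: norming_le ((GP (i %/ P)%N).1 (i %% P)%N) _ => k.
    by case: ifP => _; rewrite norming_ge0 ?lexx //; exact: (GP _).1.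
  - move=> i k _ kNP; rewrite leqNgt (leq_trans kNP) //.
    by apply: leq_trans (Estart s); rewrite leq_mul2r Nk0 orbT.
  - by move=> k; rewrite /h; case: ifP => // _; rewrite mulr_ge0.
  - move=> k; rewrite /h; case: ifP => [/andP[sk kE]|_]; last by left.
    have [->|[j jN fgj]] := fg k; first by left; rewrite mulr0.
    have [gk|gk] := eqVneq (g j k) 0.
      left; apply/eqP; rewrite mulf_eq0; apply/orP; right.
      by rewrite eq_le f0 andbT (le_trans fgj) // gk mulr0.
    have Pk : (P <= k)%N := leq_trans (E_start s) sk.
    have met : exists2 k', (k' < P)%N & g j k' != 0.
      apply: contrapT => nm; case/negP: (old j jN); apply/asboolP; split; last by exists k.
      by move=> k' k'P; apply/eqP; apply: contrapT => /negP gk'; apply: nm; exists k'.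
    have [/eqP|[l lP gG]] := (GP j).2 jN met k Pk; first by rewrite (negPf gk).
    right; exists (j * P + l)%N.
      by rewrite (@leq_trans (j.+1 * P)) ?leq_mul2r ?jN ?orbT // mulSn addnC ltn_add2r.
    have P0 : (0 < P)%N by exact: leq_ltn_trans lP.
    rewrite sk divnMDl // divn_small // addn0 modnMDl modn_small //.
    by rewrite (le_trans _ gG) //; lra.
rewrite (_ : pairing f (w s) M = 2^-1 * pairing h (w s) M) ?ler_wpM2l ?w_le //.
rewrite /pairing mulr_sumr; apply: eq_bigr => k _; rewrite /h.
case: ifPn => [_|/w_supp ->]; last by rewrite !mulr0.
by rewrite mulrA mulrA mulVf // mul1r.
Qed.

(** A leaf misses [w0] or all the [w s], and a root with at least [k0] children misses [w0]. Any
    other root gives at most [lam / 2] on all but [k0] of the [4 * k0] blocks, so their average is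
    at most [5 / 8 * lam], rounded up to [3 / 4 * lam]; the half-sum with [w0] yields [7 / 8]. *)
Lemma spread_average_le f M : norming f ->
  pairing f (fun k => 2^-1 * (w0 k + (4 * k0)%:R^-1 * \sum_(s < 4 * k0) w s k)) M
  <= 7 / 8 * lam.
Proof.
move=> fN; set r := (4 * k0)%N; have l0 : 0 <= lam by exact: lam0.
have r0 : (0 : R) < r%:R by rewrite ltr0n muln_gt0.
have -> : pairing f (fun k => 2^-1 * (w0 k + r%:R^-1 * \sum_(s < r) w s k)) M =
    2^-1 * (pairing f w0 M + r%:R^-1 * \sum_(s < r) pairing f (w s) M).
  rewrite /pairing exchange_big !mulr_sumr -big_split mulr_sumr /=.
  apply: eq_bigr => k _; rewrite -mulr_sumr; lra.
have avg (D : R) : \sum_(s < r) pairing f (w s) M <= D * r%:R ->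
    r%:R^-1 * \sum_(s < r) pairing f (w s) M <= D.
  by move=> h; rewrite ler_pdivrMl // mulrC.
have avg_lam : r%:R^-1 * \sum_(s < r) pairing f (w s) M <= lam.
  apply: avg; rewrite mulr_natr -[in leRHS](card_ord r) -sumr_const.
  by apply: ler_sum => s _; exact: w_le.
have w0l := w0_le M fN.
have start0 s k : (k < k0)%N -> w s k = 0.
  move=> kk0; apply: w_supp; rewrite negb_and -ltnNge (leq_trans kk0) //.
  by rewrite -E0 (leq_trans (E_le (leq0n s))).
case: fN w0l avg avg_lam => {}f.
  move=> n f1 fn w0l avg avg_lam; have [nk0|k0n] := ltnP n k0.
    suff -> : \sum_(s < r) pairing f (w s) M = 0 by rewrite mulr0 addr0; lra.
    apply: big1 => s _; apply: pairing_disjoint => k.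
    by have [->|/fn] := eqVneq k n; [right; exact: start0|left].
  suff -> : pairing f w0 M = 0 by lra.
  apply: pairing_disjoint => k.
  by have [->|/fn] := eqVneq k n; [right; exact: w0_supp|left].
move=> N g gN gs f0 fg w0l avg avg_lam; have [k0N|/ltnW Nk0] := leqP k0 N.
  suff -> : pairing f w0 M = 0 by lra.
  apply: pairing_disjoint => k; have [kk0|] := ltnP k k0; last by right; exact: w0_supp.
  left; have [//|[i iN]] := fg k; rewrite gs ?mulr0 //; last exact: leq_trans k0N.
  by move=> h; apply/eqP; rewrite eq_le h f0.
suff : r%:R^-1 * \sum_(s < r) pairing f (w s) M <= 3 / 4 * lam by lra.
apply: avg.
have fN : norming f by exact: norming_node fg.
have le1 s : pairing f (w s) M <=
    2^-1 * lam + 2^-1 * lam * (\sum_(j < N) (first_met g j s : nat))%:R.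
  have [old|] := pselect (forall j, (j < N)%N -> ~~ first_met g j s).
    apply: (@le_trans _ _ (2^-1 * lam)); first exact: old_pairing fg old.
    by rewrite lerDl !mulr_ge0.
  move=> /existsNP [j /not_implyP [jN /negP]]; rewrite negbK => mj.
  apply: le_trans (w_le s M fN) _.
  rewrite (bigD1 (Ordinal jN)) //= mj natrD mulrDr mulr1.
  have : 0 <= 2^-1 * lam * (\sum_(i < N | i != Ordinal jN) (first_met g i s : nat))%:R.
    by rewrite !mulr_ge0.
  lra.
apply: (@le_trans _ _ (\sum_(s < r) (2^-1 * lam +
    2^-1 * lam * (\sum_(j < N) (first_met g j s : nat))%:R))).
  by apply: ler_sum => s _; exact: le1.
rewrite big_split /= sumr_const card_ord -[_ *+ r]mulr_natr -mulr_sumr -natr_sum.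
have cnt : (\sum_(s < r) \sum_(j < N) (first_met g j s : nat) <= k0)%N.
  rewrite exchange_big /=; apply: leq_trans Nk0.
  rewrite -[leqRHS]card_ord -sum1_card; apply: leq_sum => j _.
  by apply: sum_unique_le1 => s t; exact: first_met_uniq.
have : (\sum_(s < r) \sum_(j < N) (first_met g j s : nat))%:R <= r%:R / 4 :> R.
  rewrite /r natrM mulrAC divff // mul1r ler_nat //.
move/(ler_wpM2l (_ : 0 <= 2^-1 * lam)) => /(_ _) h.
apply: le_trans (lerD (lexx _) (h _)) _; first by rewrite mulr_ge0.
by have := mulr_ge0 l0 (ltW r0); lra.
Qed.

End SpreadAverage.

Section NoEllOne.
(* [Conv n] stands for the convex hull of the n-th tail of a positive block sequence. *)
Variable Conv : nat -> (nat -> R) -> Prop.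
Hypotheses
  (Conv_supp : forall n w, Conv n w -> exists M, forall k, ~~ (n <= k < M)%N -> w k = 0)
  (Conv_le : forall m n w, (m <= n)%N -> Conv n w -> Conv m w)
  (Conv_convex : forall n w w' (t : R), 0 <= t <= 1 -> Conv n w -> Conv n w' ->
    Conv n (fun k => t * w k + (1 - t) * w' k)).

Let attained (lam : R) := forall n, exists2 w, Conv n w &
  forall f M, norming f -> pairing f w M <= lam.

Let Conv_average n (w : nat -> nat -> R) r : (0 < r)%N -> (forall s, Conv n (w s)) ->
  Conv n (fun k => r%:R^-1 * \sum_(s < r) w s k).
Proof.
move=> + wC; elim: r => // -[_ _|r IHr _].
  rewrite (_ : (fun k => _) = w 0%N) //; apply/funext => k.
  by rewrite invr1 mul1r big_ord_recl big_ord0 addr0.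
have := @Conv_convex n _ _ (r.+1%:R / r.+2%:R) _ (IHr isT) (wC r.+1).
rewrite (_ : (fun k => _ * (_ * _) + _) = (fun k => r.+2%:R^-1 * \sum_(s < r.+2) w s k)).
  apply; rewrite divr_ge0 //= ler_pdivrMr // mul1r ler_nat //.
apply/funext => k; rewrite [in RHS]big_ord_recr /= [r.+2%:R]mulrS; field.
by apply/andP; split; rewrite gt_eqF //; have := ler0n R r; lra.
Qed.

(** The new vector is an average of vectors of the hull and stays in it. In [start], the term
    [k0 * E s] makes room for the grandchildren, and [n0] keeps the blocks in the required hull. *)
Let attained_step lam : attained lam -> attained (7 / 8 * lam).
Proof.
move=> alam n0.
have /choice [W WP] : forall n, exists p : (nat -> R) * nat, [/\ Conv n p.1,
    (forall f M, norming f -> pairing f p.1 M <= lam)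
    & forall k, ~~ (n <= k < p.2)%N -> p.1 k = 0].
  move=> n; have [w wC wl] := alam n; have [M wM] := Conv_supp wC.
  by exists (w, M).
pose k0 := maxn 1 (W n0).2.
pose E := fix E s := if s is s'.+1 then
  maxn (W (k0 * E s' + n0)%N).2 (k0 * E s' + n0) else k0.
pose start s := (k0 * E s + n0)%N.
pose w s := (W (start s)).1.
exists (fun k => 2^-1 * ((W n0).1 k + (4 * k0)%:R^-1 * \sum_(s < 4 * k0) w s k)).
  have [W0 _ _] := WP n0.
  have wC s : Conv n0 (w s).
    by have [h _ _] := WP (start s); apply: Conv_le h; rewrite leq_addl.
  have avgC : Conv n0 (fun k => (4 * k0)%:R^-1 * \sum_(s < 4 * k0) w s k).
    by apply: Conv_average => //; rewrite muln_gt0 leq_max.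
  have := @Conv_convex n0 _ _ 2^-1 _ W0 avgC.
  rewrite (_ : (fun k => _ * _ + _) = (fun k => 2^-1 * ((W n0).1 k +
      (4 * k0)%:R^-1 * \sum_(s < 4 * k0) w s k))); first by apply; lra.
  by apply/funext => k; set y := _ * \sum_(_ < _) _; lra.
move=> f M; apply: (@spread_average_le w (W n0).1 E start k0 lam) => //.
- by rewrite leq_max.
- by move=> s; rewrite leq_addr.
- by move=> s; rewrite leq_max leqnn orbT.
- move=> k k0k; have [_ _ h] := WP n0; apply: h; apply/negP => /andP[_ kM].
  by move: (leq_trans kM (leq_maxr 1 _)); rewrite ltnNge k0k.
- move=> s k skE; have [_ _ h] := WP (start s); apply: h.
  apply: contra skE => /andP[-> kM] /=; apply: leq_trans kM _.
  by rewrite leq_maxl.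
- by move=> g L gN; have [_ h _] := WP n0; exact: h.
- by move=> s g L gN; have [_ h _] := WP (start s); exact: h.
Qed.

(** The factor [7 / 8] is iterated on all tails at once, since each step averages vectors taken from
    many tails. *)
Lemma norming_no_l1 (c : R) : 0 < c ->
  (forall n, exists2 w, Conv n w & forall f M, norming f -> pairing f w M <= 1) ->
  exists2 w, Conv 0 w & forall f M, norming f -> pairing f w M < c.
Proof.
move=> c0 a1.
have aj j : attained ((7 / 8) ^+ j).
  by elim: j => [|j IHj]; [rewrite expr0|rewrite exprS; exact: attained_step].
have /cvgrPdist_lt /(_ c c0) [N _ hN] : geometric (1 : R) (7 / 8) @ \oo --> (0 : R).
  by apply: cvg_geometric; rewrite ger0_norm; lra.
have [w w0 wN] := aj N 0%N; exists w => // f M /(wN f M) /le_lt_trans; apply.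
have := hN N (leqnn N); rewrite /= distrC subr0 mul1r.
exact: le_lt_trans (ler_norm _).
Qed.

End NoEllOne.

End Norming.

(** * The 2-convexified modified Tsirelson space is tight *)

Section Tsirelson.
Context {R : realType}.
Implicit Types (f a b : nat -> R).

Definition sq a : nat -> R := fun k => a k ^+ 2.

Lemma sq_ge0 a k : 0 <= sq a k.
Proof. exact: sqr_ge0. Qed.

Lemma pairing_ge0 f a M : norming f -> 0 <= pairing f (sq a) M.
Proof.
by move=> fN; apply: sumr_ge0 => k _; apply: mulr_ge0; [exact: norming_ge0|exact: sq_ge0].
Qed.

Lemma pairing_mono f a m n : norming f -> (m <= n)%N ->
  pairing f (sq a) m <= pairing f (sq a) n.
Proof.
move=> fN /subnKC <-; elim: (n - m)%N => [|k IHk]; first by rewrite addn0.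
rewrite addnS (le_trans IHk) // /pairing big_ord_recr /= lerDl.
by apply: mulr_ge0; [exact: norming_ge0|exact: sq_ge0].
Qed.

(** The weighted sum of the squares of [B * a k - C * b k] is nonnegative and equals
    [B * (A * B - C ^+ 2)]; the case [B = 0] is treated apart. *)
Lemma weighted_cauchy_schwarz f a b M : (forall k, 0 <= f k) ->
  \sum_(k < M) f k * (a k * b k) <=
  Num.sqrt (pairing f (sq a) M) * Num.sqrt (pairing f (sq b) M).
Proof.
move=> f0; set C := \sum_(_ < _) _; set A := pairing _ _ _; set B := pairing f _ _.
have A0 : 0 <= A by apply: sumr_ge0 => k _; rewrite mulr_ge0 ?sq_ge0.
have B0 : 0 <= B by apply: sumr_ge0 => k _; rewrite mulr_ge0 ?sq_ge0.
rewrite -sqrtrM //; apply: le_trans (ler_norm _) _.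
rewrite -sqrtr_sqr ler_sqrt ?mulr_ge0 //.
have [B00|B00] := eqVneq B 0.
  suff -> : C = 0 by rewrite expr0n /= mulr_ge0.
  apply: big1 => k _.
  have /eqP : f k * b k ^+ 2 = 0.
    have := psumr_eq0P (P := predT) (fun (k : 'I_M) _ => mulr_ge0 (f0 k) (sqr_ge0 (b k))) B00.
    by apply.
  by rewrite mulf_eq0 sqrf_eq0 => /orP[] /eqP ->; rewrite ?mul0r ?mulr0 ?mulr0.
have : 0 <= \sum_(k < M) f k * (B * a k - C * b k) ^+ 2.
  by apply: sumr_ge0 => k _; rewrite mulr_ge0 ?sqr_ge0.
have expand x y : \sum_(k < M) f k * (x * a k - y * b k) ^+ 2 =
    x ^+ 2 * A - 2 * x * y * C + y ^+ 2 * B.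
  rewrite /A /C /B /pairing !mulr_sumr -sumrB -big_split /=.
  by apply: eq_bigr => k _; rewrite /sq; ring.
rewrite expand.
have -> : B ^+ 2 * A - 2 * B * C * C + C ^+ 2 * B = B * (A * B - C ^+ 2) by ring.
by rewrite pmulr_rge0 ?subr_ge0 // lt_def B00.
Qed.

Lemma sqrt_pairingD f a b M : norming f ->
  Num.sqrt (pairing f (sq (fun k => a k + b k)) M) <=
  Num.sqrt (pairing f (sq a) M) + Num.sqrt (pairing f (sq b) M).
Proof.
move=> fN; set A := pairing f (sq a) M; set B := pairing f (sq b) M.
have A0 : 0 <= A by exact: pairing_ge0.
have B0 : 0 <= B by exact: pairing_ge0.
rewrite -[leRHS]ger0_norm ?addr_ge0 ?sqrtr_ge0 // -sqrtr_sqr ler_sqrt ?sqr_ge0 //.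
rewrite sqrrD !sqr_sqrtr //.
have := weighted_cauchy_schwarz a b M (fun k => norming_ge0 k fN); rewrite -/A -/B.
have -> : pairing f (sq (fun k => a k + b k)) M =
    A + (\sum_(k < M) f k * (a k * b k)) * 2 + B.
  rewrite /A /B /pairing mulr_suml -!big_split /=.
  by apply: eq_bigr => k _; rewrite /sq; ring.
lra.
Qed.

Lemma sqrt_pairing_ub f a M : norming f ->
  Num.sqrt (pairing f (sq a) M) <= \sum_(k < M) `|a k|.
Proof.
move=> fN; have S0 n : 0 <= \sum_(k < n) `|a k| by apply: sumr_ge0.
rewrite -[leRHS]ger0_norm // -sqrtr_sqr ler_sqrt ?sqr_ge0 //.
elim: M => [|M IHM]; first by rewrite /pairing !big_ord0 expr0n.
rewrite /pairing !big_ord_recr /= -/(pairing f (sq a) M) sqrrD.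
have fa : f M * sq a M <= `|a M| ^+ 2.
  rewrite real_normK ?num_real // ler_piMl ?sqr_ge0 //.
  by have /andP[] := norming_itv fN M.
have : 0 <= (\sum_(k < M) `|a k|) * `|a M| by rewrite mulr_ge0.
by move: IHM; rewrite mulr2n; lra.
Qed.

(** The 2-convexification: the square root of the modified Tsirelson norm of the squares, that is, a
    supremum of weighted l_2 seminorms. *)
Definition tnorm M a : R :=
  sup [set Num.sqrt (pairing f (sq a) M) | f in [set f | norming f]].

Lemma tnorm_ge M a f : norming f -> Num.sqrt (pairing f (sq a) M) <= tnorm M a.
Proof.
move=> fN; apply: ub_le_sup; last by exists f.
by exists (\sum_(k < M) `|a k|) => _ [g gN <-]; exact: sqrt_pairing_ub.
Qed.

Lemma tnorm_le M a (D : R) :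
  (forall f, norming f -> Num.sqrt (pairing f (sq a) M) <= D) -> tnorm M a <= D.
Proof.
move=> aD; apply: ge_sup => [|_ [f fN <-]]; last exact: aD.
by exists (Num.sqrt (pairing (fun=> 0) (sq a) M)), (fun=> 0) => //; exact: norming0.
Qed.

Lemma tnorm_triangle M a b : tnorm M (fun i => a i + b i) <= tnorm M a + tnorm M b.
Proof.
apply: tnorm_le => f fN; apply: le_trans (sqrt_pairingD a b M fN) _.
by rewrite lerD ?tnorm_ge.
Qed.

Lemma tnorm_ge0 M a : 0 <= tnorm M a.
Proof. exact: le_trans (sqrtr_ge0 _) (tnorm_ge M a norming0). Qed.

Lemma tnormZ M (r : R) a : tnorm M (fun i => r * a i) = `|r| * tnorm M a.
Proof.
have le s b : tnorm M (fun i => s * b i) <= `|s| * tnorm M b.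
  apply: tnorm_le => f fN.
  rewrite (_ : pairing f _ M = s ^+ 2 * pairing f (sq b) M).
    by rewrite sqrtrM ?sqr_ge0 // sqrtr_sqr ler_wpM2l ?tnorm_ge.
  by rewrite /pairing mulr_sumr; apply: eq_bigr => k _; rewrite /sq; ring.
apply/eqP; rewrite eq_le le /=; have [->|r0] := eqVneq r 0.
  by rewrite normr0 mul0r tnorm_ge0.
have := le r^-1 (fun i => r * a i).
rewrite (_ : (fun i => _) = a); last by apply/funext => i; rewrite mulKf.
by rewrite normfV -ler_pdivrMl ?invr_gt0 ?normr_gt0 // invrK.
Qed.

Lemma tnorm_mono M a : tnorm M a <= tnorm M.+1 a.
Proof.
apply: tnorm_le => f fN; apply: le_trans _ (tnorm_ge _ _ fN).
by rewrite ler_sqrt ?pairing_mono ?pairing_ge0.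
Qed.

Lemma tnorm_stable M a : a M = 0 -> tnorm M.+1 a <= tnorm M a.
Proof.
move=> aM; apply: tnorm_le => f fN; apply: le_trans _ (tnorm_ge _ _ fN).
by rewrite /pairing big_ord_recr /= /sq aM expr0n mulr0 addr0.
Qed.

Lemma tnorm_ub M a : tnorm M a <= \sum_(k < M) `|a k|.
Proof. by apply: tnorm_le => f; exact: sqrt_pairing_ub. Qed.

Lemma tnorm_coef M a i : (i < M)%N -> `|a i| <= 1 * tnorm M a.
Proof.
move=> iM; rewrite mul1r.
have dN : norming (fun k => (k == i)%:R : R).
  apply: (@norming_leaf _ _ i) => k; last by move/negPf ->.
  by case: eqP; rewrite ?lexx ?ler01.
apply: le_trans _ (tnorm_ge M a dN).
rewrite /pairing (bigD1 (Ordinal iM)) //= eqxx mul1r big1 ?addr0 ?sqrtr_sqr //.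
by move=> k; rewrite -val_eqE /= => /negPf ->; rewrite mul0r.
Qed.

Lemma tnorm_delta M i : (i < M)%N -> 1 <= tnorm M (fun j => (j == i)%:R).
Proof.
by move=> iM; have := tnorm_coef (fun j => (j == i)%:R) iM; rewrite eqxx normr1 mul1r.
Qed.

Definition tsirelson_seqnorm : seqnorm R :=
  SeqNorm tnorm_triangle tnormZ tnorm_mono tnorm_stable tnorm_ub tnorm_coef tnorm_delta.

Local Notation T2 := (xspace tsirelson_seqnorm).
Local Notation e := (@xdelta R tsirelson_seqnorm).

Lemma pairing_le_norm f (u : T2) M : norming f -> pairing f (sq (xval u)) M <= `|u| ^+ 2.
Proof.
move=> fN; have h : Num.sqrt (pairing f (sq (xval u)) M) <= `|u|.
  by apply: le_trans (tnorm_ge M _ fN) _; exact: (xnorm_ub u M).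
by rewrite -[leLHS]sqr_sqrtr ?pairing_ge0 // ler_pXn2r // nnegrE ?sqrtr_ge0.
Qed.

(** The factor [2] gives slack below the supremum when [u] is nonzero; otherwise the zero functional
    serves. *)
Lemma norm_attained (u : T2) : exists f M, norming f /\
  `|u| ^+ 2 <= 2 * pairing f (sq (xval u)) M.
Proof.
apply: contrapT => h.
have le f M : norming f -> pairing f (sq (xval u)) M <= `|u| ^+ 2 / 2.
  move=> fN; rewrite leNgt; apply/negP => lt; apply: h; exists f, M; split=> //; lra.
have : `|u| <= Num.sqrt (`|u| ^+ 2 / 2).
  apply: xnorm_le => M; apply: tnorm_le => f fN.
  by rewrite ler_sqrt ?le // divr_ge0 ?sqr_ge0.
rewrite -{1}[`|u|]ger0_norm // -sqrtr_sqr ler_sqrt ?divr_ge0 ?sqr_ge0 // => u2.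
apply: h; exists (fun=> 0), 0%N; split; first exact: norming0.
by rewrite /pairing big_ord0 mulr0; have := sqr_ge0 `|u|; lra.
Qed.

Lemma finite_max N (g : nat -> nat -> R) : exists m : nat -> R,
  [/\ forall i k, (i < N)%N -> g i k <= m k, forall k, 0 <= m k
    & forall k, m k = 0 \/ exists2 i, (i < N)%N & m k = g i k].
Proof.
elim: N => [|N [m [gm m0 mg]]]; first by exists (fun=> 0); split=> // k; left.
exists (fun k => Num.max (m k) (g N k)); split=> [i k|k|k].
- rewrite ltnS leq_eqVlt le_max => /orP[/eqP ->|/gm ->//]; first by rewrite lexx orbT.
- by rewrite le_max m0.
- have [_|_] := leP (m k) (g N k); first by right; exists N.
  by have [|[i iN]] := mg k; [left|right; exists i => //; exact: ltnW].
Qed.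

(* The root of the new functional has the N given functionals as children: this
   is where the condition that the supports lie past N is used. *)
Lemma common_norming N (u : nat -> T2) :
  (forall i k, (i < N)%N -> (k < N)%N -> xval (u i) k = 0) ->
  exists h M, norming h /\
    forall i, (i < N)%N -> `|u i| ^+ 2 <= 4 * pairing h (sq (xval (u i))) M.
Proof.
move=> uN.
have /choice [f /choice [M fM]] : forall i, exists f, exists M, norming f /\
    `|u i| ^+ 2 <= 2 * pairing f (sq (xval (u i))) M by move=> i; exact: norm_attained.
pose g i k := if (k < N)%N then 0 else f i k.
have gN i : norming (g i).
  apply: norming_le (fM i).1 _ => k; rewrite /g.
  by case: ifP => _; rewrite norming_ge0 ?lexx //; exact: (fM i).1.
have [m [gm m0 mg]] := finite_max N g.
have hN : norming (fun k => 2^-1 * m k).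
  apply: (@norming_node _ _ N g) => [i _|i k _ kN|k|k].
  - exact: gN.
  - by rewrite /g kN.
  - by rewrite mulr_ge0.
  - by have [->|[i iN ->]] := mg k; [left; rewrite mulr0|right; exists i].
exists (fun k => 2^-1 * m k), (\max_(i < N) M i)%N; split=> // i iN.
have [_ h] := fM i; apply: le_trans h _.
apply: (@le_trans _ _ (4 * pairing (fun k => 2^-1 * m k) (sq (xval (u i))) (M i))).
  have -> : 4 * pairing (fun k => 2^-1 * m k) (sq (xval (u i))) (M i) =
      2 * pairing m (sq (xval (u i))) (M i).
    rewrite /pairing !mulr_sumr; apply: eq_bigr => k _; lra.
  rewrite ler_wpM2l //; apply: ler_sum => k _.
  have [kN|Nk] := ltnP k N; first by rewrite /sq uN // expr0n !mulr0.
  rewrite ler_wpM2r ?sq_ge0 //; have := gm i k iN.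
  by rewrite /g ltnNge Nk.
rewrite ler_wpM2l // pairing_mono //.
exact: (leq_bigmax (F := fun j : 'I_N => M j) (Ordinal iN)).
Qed.

(** Signs are chosen one at a time, so that the cross term [C] of the new vector with the sum so far
    contributes nonnegatively to the square. *)
Lemma good_signs N (u : nat -> T2) f M (b : nat -> R) : exists eps : nat -> R,
  (forall i, eps i ^+ 2 = 1) /\
  \sum_(i < N) b i ^+ 2 * pairing f (sq (xval (u i))) M <=
    pairing f (sq (xval (lcomb (fun i => eps i * b i) u N))) M.
Proof.
elim: N => [|N [eps [eps1 IHN]]].
  exists (fun=> 1); split=> [i|]; first by rewrite expr1n.
  rewrite big_ord0 /lcomb big_ord0 /pairing big1 // => k _.
  by rewrite /sq expr0n mulr0.
set v := lcomb _ u N in IHN.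
pose C := \sum_(k < M) f k * (xval v k * (b N * xval (u N) k)).
pose s : R := if 0 <= C then 1 else -1.
have s1 : s ^+ 2 = 1 by rewrite /s; case: ifP; rewrite ?expr1n ?sqrrN ?expr1n.
have sC : 0 <= s * C.
  rewrite /s; case: ifPn => [C0|]; first by rewrite mul1r.
  by rewrite -ltNge mulN1r oppr_ge0 => /ltW.
exists (fun i => if i == N then s else eps i); split=> [i|]; first by case: ifP.
have -> : lcomb (fun i => (if i == N then s else eps i) * b i) u N.+1 =
    v + (s * b N) *: u N.
  rewrite lcombS eqxx; congr (_ + _); apply: eq_lcomb => i iN.
  by rewrite ltn_eqF.
have -> : pairing f (sq (xval (v + (s * b N) *: u N))) M =
    pairing f (sq (xval v)) M + 2 * (s * C) +
    s ^+ 2 * (b N ^+ 2 * pairing f (sq (xval (u N))) M).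
  rewrite /pairing /C !mulr_sumr -!big_split /=; apply: eq_bigr => k _.
  by rewrite /sq; ring.
rewrite s1 mul1r big_ord_recr /=; lra.
Qed.

(** One functional handles all the [u i] up to a factor [4]: [2] from [norm_attained] and [2] from
    the weight of its root. *)
Lemma lower_two_estimate N (u : nat -> T2) (b : nat -> R) :
  (forall i k, (i < N)%N -> (k < N)%N -> xval (u i) k = 0) ->
  exists eps : nat -> R, (forall i, eps i ^+ 2 = 1) /\
    \sum_(i < N) b i ^+ 2 * `|u i| ^+ 2 <= 4 * `|lcomb (fun i => eps i * b i) u N| ^+ 2.
Proof.
move=> uN; have [h [M [hN hu]]] := common_norming uN.
have [eps [eps1 le]] := good_signs N u h M b; exists eps; split=> //.
apply: (@le_trans _ _ (4 * \sum_(i < N) b i ^+ 2 * pairing h (sq (xval (u i))) M)).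
  rewrite mulr_sumr; apply: ler_sum => i _.
  by rewrite [leRHS]mulrCA ler_wpM2l ?sqr_ge0 // hu.
rewrite ler_wpM2l // (le_trans le) //; exact: pairing_le_norm.
Qed.

Lemma sqr_sum_disjoint N (r : nat -> R) :
  (forall i j, (i < j)%N -> r i = 0 \/ r j = 0) ->
  (\sum_(i < N) r i) ^+ 2 = \sum_(i < N) r i ^+ 2.
Proof.
move=> rd; elim: N => [|N IHN]; first by rewrite !big_ord0 expr0n.
rewrite !big_ord_recr /= sqrrD IHN.
suff -> : (\sum_(i < N) r i) * r N = 0 by rewrite mul0rn addr0.
have [->|rN] := eqVneq (r N) 0; first by rewrite mulr0.
rewrite big1 ?mul0r // => i _; have [//|r0] := rd i N (ltn_ord i).
by rewrite r0 eqxx in rN.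
Qed.

Lemma tsirelson_tight : exists F, block_scalars e F /\ tight_with_constants e.
Proof.
have [F eF] := block_scalars_exist e; exists F; split=> //.
have eB := xdelta_normalised_basis tsirelson_seqnorm.
apply: contrapT => /(not_tight_blocks eB eF (basis_block_sequence eB eF)).
move=> [K [w [K0 wb _ wK]]].
have [a [s wa]] := block_sequence_data wb; have [ab sS asep _] := wa.
have adisj k i j : (i < j)%N -> a i k = 0 \/ a j k = 0.
  move=> ij; have [->|/asep /andP[_ h1]] := eqVneq (a i k) 0; first by left.
  have [->|/asep /andP[h2 _]] := eqVneq (a j k) 0; first by right.
  by have := leq_trans (leq_trans h1 (block_dataS wa ij)) h2; rewrite ltnn.
have xw i k : xval (w i) k = a i k.
  rewrite (block_expansion wa (ltnSn i)) xval_lcomb /trunc.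
  case: ifPn => // ks; apply/eqP; rewrite eq_sym.
  by apply: contraNT ks => /asep /andP[].
have xlw b N k : xval (lcomb b w N) k = \sum_(i < N) b i * a i k.
  elim: N => [|N IHN]; first by rewrite /lcomb !big_ord0.
  by rewrite lcombS xval_add IHN xval_scale xw big_ord_recr.
have sqlw b N k : sq (xval (lcomb b w N)) k = \sum_(i < N) b i ^+ 2 * a i k ^+ 2.
  rewrite /sq xlw (@sqr_sum_disjoint N (fun i => b i * a i k)) => [|i j ij].
    by apply: eq_bigr => i _; rewrite exprMn.
  by have [->|->] := adisj k i j ij; [left|right]; rewrite mulr0.
(* The first [N] blocks have a copy [u] past [N], to which [lower_two_estimate] applies. One
   [K ^+ 2] bounds the norms of the [u i] from below, the other transfers the estimate back to [w],
   where signs do not matter. *)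
have lower N b : \sum_(i < N) b i ^+ 2 <= 4 * K ^+ 4 * `|lcomb b w N| ^+ 2.
  have [u [uN wu]] := wK N N.
  have [|eps [eps1 le]] := @lower_two_estimate N u b.
    move=> i k iN kN; have /linear_span_imageP [n [c [cN ->]]] := uN i iN.
    by rewrite xval_lcomb /trunc cN ?if_same //= leqNgt kN.
  have norm_eps : `|lcomb (fun i => eps i * b i) w N| = `|lcomb b w N|.
    rewrite !xnormE /xnorm; congr sup; congr (_ @` _); apply/funext => n.
    rewrite /= /tnorm; congr sup; congr (_ @` _); apply/funext => f.
    congr Num.sqrt; apply: eq_bigr => k _; congr (_ * _); rewrite !sqlw.
    by apply: eq_bigr => i _; rewrite exprMn eps1 mul1r.
  have ui i : (i < N)%N -> 1 <= K ^+ 2 * `|u i| ^+ 2.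
    move=> iN; have [+ _] := wu (fun j => (j == i)%:R).
    have [_ w1 _] := ab i; rewrite !lcomb_delta // w1 -exprMn => h.
    by rewrite -[leLHS](expr1n _ 2) ler_pXn2r ?nnegrE ?mulr_ge0.
  apply: (@le_trans _ _ (K ^+ 2 * \sum_(i < N) b i ^+ 2 * `|u i| ^+ 2)).
    rewrite mulr_sumr; apply: ler_sum => i _.
    by rewrite mulrCA ler_peMr ?sqr_ge0 // ui.
  apply: (@le_trans _ _ (K ^+ 2 * (4 * (K * `|lcomb b w N|) ^+ 2))).
    rewrite ler_wpM2l ?sqr_ge0 // (le_trans le) // ler_wpM2l // -norm_eps.
    by rewrite ler_pXn2r ?nnegrE ?mulr_ge0 //; case: (wu (fun i => eps i * b i)).
  rewrite le_eqVlt; apply/orP; left; apply/eqP; ring.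
pose z k i : R := a i k ^+ 2.
(* Convex combinations of the squares of the blocks from [n] on; [lcomb b (fun=> 1 : R) N] is the
   sum of the weights. *)
pose Conv n (v : nat -> R) := exists N (b : nat -> R), [/\ forall i, 0 <= b i,
  forall i, (i < n)%N -> b i = 0, forall i, (N <= i)%N -> b i = 0,
  lcomb b (fun=> 1 : R) N = 1 & v = fun k => lcomb b (z k) N].
have si i : (i <= s i)%N by elim: i => // i IHi; exact: leq_ltn_trans IHi (sS i).
have [|||||v [N [b [b0 _ _ b1 vE]]] vle] := @norming_no_l1 R Conv _ _ _ (4 * K ^+ 4 + 1)^-1.
- move=> n _ [N [b [_ bn bN _ ->]]]; exists (s N) => k kN.
  apply: big1 => i _; rewrite /z /= /GRing.scale /=.
  have [bi|bi] := eqVneq (b i) 0; first by rewrite bi mul0r.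
  have [->|/asep /andP[h1 h2]] := eqVneq (a i k) 0; first by rewrite expr0n mulr0.
  case/negP: kN; rewrite (leq_trans h2) ?(block_dataS wa) // andbT.
  rewrite (leq_trans _ h1) // (leq_trans _ (si i)) // leqNgt.
  by apply: contra bi => /bn ->.
- move=> m n v mn [N [b [b0 bn bN b1 vE]]]; exists N, b; split=> // i im.
  by apply: bn; exact: leq_trans mn.
- move=> n v v' t /andP[t0 t1] [N [b [b0 bn bN b1 ->]]] [M [d [d0 dn dM d1 ->]]].
  exists (maxn N M), (fun i => t * b i + (1 - t) * d i); split=> [i|i i_n|i|| ].
  + by rewrite addr_ge0 // mulr_ge0 // subr_ge0.
  + by rewrite bn // dn // !mulr0 addr0.
  + by rewrite geq_max => /andP[h1 h2]; rewrite bN // dM // !mulr0 addr0.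
  + rewrite lcombD !lcombZ -(lcomb_widen _ (leq_maxl N M) bN).
    rewrite -(lcomb_widen _ (leq_maxr N M) dM) b1 d1 /GRing.scale /=; ring.
  + apply/funext => k; rewrite lcombD !lcombZ -(lcomb_widen _ (leq_maxl N M) bN).
    by rewrite -(lcomb_widen _ (leq_maxr N M) dM).
- by rewrite invr_gt0 ltr_wpDl // mulr_ge0 // exprn_ge0.
- move=> n; exists (z ^~ n).
    exists n.+1, (fun i => (i == n)%:R); split=> [i|i i_n|i ni||].
    + by [].
    + by rewrite ltn_eqF.
    + by rewrite gtn_eqF.
    + by rewrite lcomb_delta.
    + by apply/funext => k; rewrite lcomb_delta.
  move=> f M fN; have [_ wn _] := ab n.
  have := pairing_le_norm (w n) M fN; rewrite wn expr1n.
  suff -> : sq (xval (w n)) = z ^~ n by [].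
  by apply/funext => k; rewrite /sq xw.
(* Square roots of the weights turn the convex combination of squares into the square of a
   combination of [w]. The lower estimate then bounds [1] by [4 * K ^+ 4] over [4 * K ^+ 4 + 1]. *)
have := lower N (fun i => Num.sqrt (b i)).
have -> : \sum_(i < N) Num.sqrt (b i) ^+ 2 = 1.
  rewrite -b1 /lcomb; apply: eq_bigr => i _.
  by rewrite sqr_sqrtr // /GRing.scale /= mulr1.
have D0 : 0 < 4 * K ^+ 4 + 1 by rewrite ltr_wpDl // mulr_ge0 // exprn_ge0.
have wle : `|lcomb (fun i => Num.sqrt (b i)) w N| ^+ 2 <= (4 * K ^+ 4 + 1)^-1.
  have h : `|lcomb (fun i => Num.sqrt (b i)) w N| <= Num.sqrt (4 * K ^+ 4 + 1)^-1.
    apply: xnorm_le => M; apply: tnorm_le => f fN.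
    rewrite ler_sqrt ?invr_ge0 ?(ltW D0) //.
    rewrite (_ : sq _ = v) ?ltW ?vle // vE; apply/funext => k.
    by rewrite sqlw /lcomb; apply: eq_bigr => i _; rewrite sqr_sqrtr.
  rewrite -[leRHS]sqr_sqrtr ?invr_ge0 ?(ltW D0) //.
  by rewrite ler_pXn2r // nnegrE ?sqrtr_ge0.
rewrite leNgt; apply/negP; rewrite negbK.
apply: (@le_lt_trans _ _ (4 * K ^+ 4 * (4 * K ^+ 4 + 1)^-1)).
  by rewrite ler_wpM2l // mulr_ge0 // exprn_ge0.
by rewrite ltr_pdivrMr // mul1r ltrDl.
Qed.

End Tsirelson.

Theorem theorem4p4 (R : realType) :
  (forall (E : completeNormedModType R) (e : nat -> E) (F : {pred R}),
     ~ finite_dimensional [set: E] -> normalised_basis e ->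
     block_scalars e F ->
     exists x : nat -> E, block_sequence e F x /\
       (tight_with_constants x \/ locally_minimal (closed_span (range x)))) /\
  (forall (E : completeNormedModType R) (e : nat -> E) (F : {pred R})
      (x : nat -> E),
     ~ finite_dimensional [set: E] -> normalised_basis e ->
     block_scalars e F -> block_sequence e F x ->
     ~ (tight_with_constants x /\ locally_minimal (closed_span (range x)))) /\
  (exists (E : completeNormedModType R) (e : nat -> E) (F : {pred R})
      (x : nat -> E),
     [/\ ~ finite_dimensional [set: E], normalised_basis e,
         block_scalars e F, block_sequence e F x & tight_with_constants x]) /\
  (exists (E : completeNormedModType R) (e : nat -> E) (F : {pred R})
      (x : nat -> E),
     [/\ ~ finite_dimensional [set: E], normalised_basis e,
         block_scalars e F, block_sequence e F x
       & locally_minimal (closed_span (range x))]).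
Proof.
split; [|split; [|split]].
- by move=> E e F _; exact: exists_tight_or_locally_minimal.
- move=> E e F x _ eB _ xb [xt xm].
  have [B /(_ _ _ xb) [c xc]] := block_constant eB.
  exact: (locally_minimal_not_tight xc) xt.
- have [F [eF et]] := @tsirelson_tight R.
  have eB := xdelta_normalised_basis (@tsirelson_seqnorm R).
  exists (xspace (@tsirelson_seqnorm R)), (@xdelta R _), F, (@xdelta R _); split=> //.
    exact: xspace_not_fd.
  exact: basis_block_sequence.
- exact: exists_locally_minimal.
Qed.
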